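(* Let $k\ge 1$ and let $f:[0,1]\to[0,1]$ be a mixing piecewise expanding unimodal map with critical point $c$, both of whose branches $f_1,f_2$ are of class $C^{k+1}$. Let $\rho$ be the density of its unique absolutely continuous invariant probability measure, and let $\rho_0,\rho_1,\dots,\rho_k\in BV[0,1]$ be functions such that $\rho_0=\rho$ and $\rho_j'=\rho_{j+1}$ almost everywhere for $0\le j<k$. Then: (A) The set of points where $\rho$ is not differentiable has Hausdorff dimension zero. (B) If the critical orbit $\{f^n(c)\}_{n\ge1}$ is dense in $[0,1]$, then the set of points where $\rho$ is not differentiable is uncountable. (C) There is a set $\mathcal N\subset[0,1]$ of Hausdorff dimension zero such that $\rho$ is $k$ times differentiable in the sense of Whitney on $[0,1]\setminus\mathcal N$; that is, for every $\bar x\in[0,1]\setminus\mathcal N$, $$\rho(x)-\rho(\bar x)=\sum_{m=1}^k\frac{\rho_m(\bar x)}{m!}(x-\bar x)^m+o\big((x-\bar x)^k\big)\quad\text{as }x\to\bar x.$$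
   Context: A map $f:[0,1]\to[0,1]$ is a piecewise expanding unimodal map (PEUM) if there are a point $c\in(0,1)$ (the critical point), a number $\varepsilon>0$ and a constant $\lambda>1$ such that $f(x)=f_1(x)$ for $x\le c$ and $f(x)=f_2(x)$ for $x\ge c$, where $f_1$ is a $C^2$ map defined on $[0,c+\varepsilon]$, $f_2$ is a $C^2$ map defined on $[c-\varepsilon,1]$, $f_1(c)=f_2(c)$, and $|Df_j(x)|\ge\lambda$ for all $x$ in the domain of $f_j$, $j=1,2$. Such a map has a unique absolutely continuous invariant probability measure; its density $\rho$ is a function of bounded variation, and the representative is chosen so that at each discontinuity in $(0,1)$ the value of $\rho$ is the average of its left and right limits. ''Mixing'' means that $f$ is mixing with respect to this measure. A sequence $\rho_0,\dots,\rho_k$ as in the statement exists for such $f$ (this is a separate theorem of the same work). *)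

(* Defs.v *)
From mathcomp Require Export all_boot all_order all_algebra.
From mathcomp Require Export all_classical all_reals all_analysis.

Set Implicit Arguments.
Unset Strict Implicit.
Unset Printing Implicit Defensive.

Export numFieldNormedType.Exports.

Local Open Scope classical_set_scope.
Local Open Scope ring_scope.

(* Derivatives below are relative to a subset [D] of the line: only the points
   of [D] are seen, so that the derivative at an endpoint of an
   interval is the one-sided one and the arbitrary values outside [D] of a
   total function [R -> R] do not matter. At an interior point of [D] these
   are the usual notions. *)

Definition diff_quotient (R : realType) (f : R -> R) (x y : R) : R :=
  (f y - f x) / (y - x).

Definition has_deriv_within (R : realType) (D : set R) (f : R -> R)
    (x l : R) : Prop :=
  diff_quotient f x y @[y --> within D x^'] --> l.

Definition derivable_within (R : realType) (D : set R) (f : R -> R)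
    (x : R) : Prop :=
  cvg (diff_quotient f x y @[y --> within D x^']).

(* Meaningful only at the points where [f] is derivable within [D]. *)
Definition deriv_within (R : realType) (D : set R) (f : R -> R) : R -> R :=
  fun x => lim (diff_quotient f x y @[y --> within D x^']).

Definition deriv_within_n (R : realType) (D : set R) (n : nat) (f : R -> R) :
    R -> R :=
  iter n (@deriv_within R D) f.

Definition class_C (R : realType) (n : nat) (D : set R) (f : R -> R) : Prop :=
  (forall i, (i < n)%N -> forall x, D x ->
     derivable_within D (deriv_within_n D i f) x) /\
  (forall i, (i <= n)%N -> {within D, continuous (deriv_within_n D i f)}).

(* The supremum of the empty set is [-oo]; [maxe 0] makes [diam set0 = 0]. *)
Definition diam (R : realType) (U : set R) : \bar R :=
  maxe 0%E (ereal_sup [set (`|x - y|)%:E | x in U & y in U]).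

Definition hausdorff_premeasure (R : realType) (s delta : R) (A : set R) :
    \bar R :=
  ereal_inf [set (\sum_(0 <= i <oo) (diam (U i) `^ s))%E
    | U in [set U : nat -> set R |
             A `<=` \bigcup_i U i /\ forall i, (diam (U i) <= delta%:E)%E]].

Definition hausdorff_measure (R : realType) (s : R) (A : set R) : \bar R :=
  ereal_sup [set hausdorff_premeasure s delta A
    | delta in [set delta : R | 0 < delta]].

(* Only exponents [s > 0] are considered (which does not change the infimum):
   for [s = 0] a convention on [0 ^ 0] would be needed. *)
Definition hausdorff_dim (R : realType) (A : set R) : \bar R :=
  ereal_inf [set s%:E | s in [set s : R | 0 < s /\ hausdorff_measure s A = 0%E]].

(* A map of [0,1] into itself is represented by a total function [R -> R] whose
   values outside [0,1] are never used; likewise for [f1] and [f2] outside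
   [0,c+eps] and [c-eps,1]. *)

Definition peum (R : realType) (f : R -> R) (c eps lam : R) (f1 f2 : R -> R) :
    Prop :=
  [/\ (forall x, x \in `[0, 1] -> f x \in `[0, 1]),
      [/\ c \in `]0, 1[, 0 < eps & 1 < lam],
      [/\ (forall x, x \in `[0, c] -> f x = f1 x),
          (forall x, x \in `[c, 1] -> f x = f2 x) &
          f1 c = f2 c],
      class_C 2 `[0, c + eps] f1 /\ class_C 2 `[c - eps, 1] f2 &
      (forall x, x \in `[0, c + eps] ->
         lam <= `|deriv_within `[0, c + eps] f1 x|) /\
      (forall x, x \in `[c - eps, 1] ->
         lam <= `|deriv_within `[c - eps, 1] f2 x|)].

(* Measures on [0,1] are measures on the line giving full mass to [0,1]. *)

Definition acip (R : realType) (f : R -> R)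
    (mu : probability (measurableTypeR R) R) : Prop :=
  [/\ mu `[0%R, 1%R]%classic = 1%E,
      mu `<< @lebesgue_measure R &
      forall A : set (measurableTypeR R), measurable A ->
        mu (`[0%R, 1%R]%classic `&` f @^-1` A) = mu A].

Definition mixing (R : realType) (f : R -> R)
    (mu : probability (measurableTypeR R) R) : Prop :=
  forall A B : set (measurableTypeR R), measurable A -> measurable B ->
    mu (`[0%R, 1%R]%classic `&` (iter n f) @^-1` A `&` B) @[n --> \oo] --> (mu A * mu B)%E.

Definition density (R : realType) (mu : probability (measurableTypeR R) R)
    (rho : R -> R) : Prop :=
  forall A : set (measurableTypeR R), measurable A ->
    mu A = (\int[lebesgue_measure]_(x in A `&` `[0%R, 1%R]%classic) (rho x)%:E)%E.

Definition averaged_at_discontinuities (R : realType) (rho : R -> R) : Prop :=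
  forall x, x \in `]0, 1[ -> ~ {for x, continuous rho} ->
    exists l r : R, [/\ rho y @[y --> x^'-] --> l, rho y @[y --> x^'+] --> r &
      rho x = (l + r) / 2].

Definition nondiff_set (R : realType) (rho : R -> R) : set R :=
  [set x | x \in `[0, 1] /\ ~ derivable_within `[0, 1] rho x].

Definition critical_orbit (R : realType) (f : R -> R) (c : R) : set R :=
  [set iter n f c | n in [set n | (1 <= n)%N]].

(* Main.v *)
(* Write [P_l] for the primitive of [rho_l] and [G_l = rho_l - P_(l+1)] for the
   singular part of [rho_l]. The invariance of the density is a fixed point
   equation over the two inverse branches of [f]; differentiating it [j] times
   expresses [rho_j], off a countable set, through [rho_0, ..., rho_j] at the two
   preimages, the coefficient of [rho_j] being at most [lam^-1] in absolute
   value. Since [P_(l+1)] is Lipschitz, this equation contracts the oscillation of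
   the [G_l]: on a short interval missing the first [n] points of the orbits of
   [0], [c] and [1] it is [O(th^n)] for some [th < 1].

   Choose [r < 1] close to [1]. If [x] is at distance at least [r^n] from the
   [n]-th points of these orbits for all large [n], then
   [G_l y - G_l x = o(|y - x|^k)] for all [l < k], and integrating from [l = k]
   down to [l = 0] gives the Taylor expansion of [rho] at [x]. The remaining points
   lie in infinitely many balls of geometrically decreasing radii, hence form a set
   of dimension zero.

   If the critical orbit is dense, then [{f c, f (f c)} = {0, 1}]. A limit of [rho]
   at some [f^n c] with [n > 2] can be pulled back to [f^3 c]; there the branch
   ending at [f^2 c] contributes only on one side, so its contribution tends to
   [0], and [rho] tends to [0] at [f^2 c], hence at [c] and at all its preimages.
   These are dense, so [rho] would vanish. Thus [rho] is discontinuous on a dense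
   set, and by Baire its non-differentiability set is uncountable. *)

Require Import Defs.
From mathcomp Require Import all_boot all_order all_algebra.
From mathcomp Require Import all_classical all_reals all_analysis.
From mathcomp Require Import measurable_realfun ring lra zify.

Set Implicit Arguments.
Unset Strict Implicit.
Unset Printing Implicit Defensive.

Import Order.TTheory GRing.Theory Num.Theory.

Local Open Scope classical_set_scope.
Local Open Scope ring_scope.

(** Two difficulties shape the argument. First, [lam] is only known to exceed 1, so adding suprema
    over the two inverse branches would give a factor [2 / lam], possibly above 1. Oscillations are
    therefore bounded by increments of nondecreasing majorants: the inverse branches take values in
    [[0, c]] and [[c, 1]], so their increments add up to at most one total increment, and the factor
    is [lam^-1]. Second, the [rho_l] are only of bounded variation and linked by derivatives almost
    everywhere. Pointwise work takes place on a set [Gam] of points whose grand orbit misses 0, [c],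
    1 and all discontinuities of the [rho_l]: it is stable under images and preimages, with
    countable complement in [[0, 1]]. The first equation is the derivative of one for the primitive
    of the density, and the later ones extend to all of [Gam] by continuity. Primitives are
    controlled by a mean value inequality that tolerates countably many bad points, and the
    estimates reach points outside [Gam] because [rho] is there the average of its side limits. *)

Ltac clra := repeat match goal with H : forall _, _ |- _ => clear H end; lra.

(** * Derivatives and mean values with countably many exceptions *)

Section real_functions.
Context {R : realType}.
Implicit Types (F G : R -> R) (x y : R).

Lemma continuous_epsP F x :
  {for x, continuous F} <->
  (forall e : R, 0 < e -> exists2 d : R, 0 < d &
    forall y, `|y - x| < d -> `|F y - F x| < e).
Proof.
split=> [/cvgrPdist_lt cF e e0|H].
  have /nbhs_ballP[d /= d0 hd] := cF e e0.
  exists d => // y yx; rewrite distrC; apply: hd.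
  by rewrite /ball/= distrC.
apply/cvgrPdist_lt => e e0; have [d d0 hd] := H e e0.
apply/nbhs_ballP; exists d => //= y; rewrite /ball/= distrC => /hd.
by rewrite distrC.
Qed.

Lemma is_derive_epsP F x l :
  is_derive x 1 F l <->
  (forall e : R, 0 < e -> exists2 d : R, 0 < d &
    forall y, `|y - x| < d -> `|F y - F x - l * (y - x)| <= e * `|y - x|).
Proof.
split=> [dF e e0|H].
  have dFx := @derive_val _ _ _ _ _ _ _ dF.
  have := @ex_derive _ _ _ _ _ _ _ dF; rewrite /derivable => /cvgrPdist_le H.
  have := H _ e0; rewrite -[lim _]/(derive F x 1) dFx => /nbhs_ballP[d /= d0 hd].
  exists d => // y yx; have [->|yx0] := eqVneq y x.
    by rewrite !subrr mulr0 subr0 normr0 mulr0.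
  have := hd (y - x); rewrite /ball/= sub0r normrN => /(_ yx).
  rewrite subr_eq0 => /(_ yx0); rewrite /GRing.scale/= !mulr1 subrK => h.
  have yx1 : 0 < `|y - x| by rewrite normr_gt0 subr_eq0.
  rewrite -ler_pdivrMr// -normfV -normrM.
  apply: le_trans h; rewrite distrC le_eqVlt; apply/orP; left; apply/eqP.
  by congr (`|_|); field; rewrite subr_eq0.
have cl : h^-1 *: ((F \o shift x) (h *: 1) - F x) @[h --> 0^'] --> l.
  apply/cvgrPdist_le => e e0; have [d d0 hd] := H _ e0.
  apply/nbhs_ballP; exists d => //= h; rewrite /ball/= sub0r normrN => hh h0.
  rewrite /GRing.scale/= mulr1.
  have := hd (h + x); rewrite addrK => /(_ hh).
  rewrite -ler_pdivrMr ?normr_gt0// -normfV -normrM => h1.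
  apply: le_trans h1; rewrite distrC le_eqVlt; apply/orP; left; apply/eqP.
  by congr (`|_|); field.
split; first by apply/cvg_ex; exists l.
by apply/cvg_lim => //; exact: Rhausdorff.
Qed.

Lemma is_derive_local F G x l d : 0 < d ->
  (forall y, `|y - x| < d -> F y = G y) ->
  is_derive x 1 F l -> is_derive x 1 G l.
Proof.
move=> d0 FG /is_derive_epsP H; apply/is_derive_epsP => e e0.
have [d1 d10 hd] := H e e0; exists (Num.min d d1); first by rewrite lt_min d0.
move=> y; rewrite lt_min => /andP[y1 y2].
by rewrite -!FG ?subrr ?normr0//; exact: hd.
Qed.

Lemma uncountable_itvoo (a b : R) : a < b -> ~ countable `]a, b[%classic.
Proof.
move=> ab /countable_lebesgue_measure0.
rewrite lebesgue_measure_itv/= lte_fin ab -EFinB => -[] /eqP.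
by rewrite subr_eq0 => /eqP ba; rewrite ba ltxx in ab.
Qed.

(* If [H := F - (M + eta) id] increased from [a] to [b], every value [v] between
   [H a] and [H b] would be taken at a last point, where the derivative of [H]
   cannot be negative: these points would all be exceptional. *)
Lemma mean_value_countable F (E : set R) a b M : a <= b ->
  countable E -> (forall x, a <= x <= b -> {for x, continuous F}) ->
  (forall x, a < x < b -> ~ E x ->
    exists2 l : R, is_derive x 1 F l & l <= M) ->
  F b - F a <= M * (b - a).
Proof.
move=> ab cE cF dF; rewrite leNgt; apply/negP => MF.
have {}ab : a < b.
  rewrite lt_neqAle ab andbT; apply/eqP => ba; subst b.
  by rewrite !subrr mulr0 ltxx in MF.
(* Half of the excess of the mean slope over [M]: [H b] stays positive, while off [E] the derivative
   of [H] is at most [- eta]. *)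
pose eta := (F b - F a - M * (b - a)) / (2 * (b - a)).
have ba0 : 0 < b - a by rewrite subr_gt0.
have eta0 : 0 < eta by rewrite divr_gt0 ?mulr_gt0// subr_gt0.
pose H x := F x - F a - (M + eta) * (x - a).
have Hb : 0 < H b.
  have -> : H b = (F b - F a - M * (b - a)) / 2.
    by rewrite /H /eta; field; rewrite subr_eq0 gt_eqF.
  by rewrite divr_gt0// subr_gt0.
have Ha : H a = 0 by rewrite /H !subrr mulr0 subrr.
have cH x : a <= x <= b -> {for x, continuous H}.
  move=> /cF cFx; apply: cvgB; first by apply: cvgB => //; exact: cvg_cst.
  by apply: cvgM; [exact: cvg_cst|apply: cvgB => //; exact: cvg_cst].
apply: (uncountable_itvoo Hb).
apply: sub_countable (cE); apply: (@card_le_trans _ _ _ (H @` E)); last exact: card_image_le.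
apply: subset_card_le => v /=; rewrite in_itv/= => /andP[v0 vb].
pose S := [set x | a <= x <= b /\ H x <= v].
have Sa : S a by rewrite /S/= lexx ltW//= Ha; split => //; exact: ltW.
have supS : has_sup S.
  by split; [exists a|exists b => x [/andP[]]].
pose s := sup S.
have as_ : a <= s by apply: sup_upper_bound.
have sb : s <= b by apply: ge_sup; [exists a|move=> x [/andP[]]].
have /cH/continuous_epsP csH : a <= s <= b by rewrite as_.
have Hs1 : H s <= v.
  rewrite leNgt; apply/negP => vs.
  have [d d0 hd] := csH (H s - v) ltac:(by rewrite subr_gt0).
  have [x Sx sx] := sup_adherent d0 supS.
  have xs : x <= s by apply: sup_upper_bound.
  have /hd : `|x - s| < d by rewrite ler0_norm ?subr_le0// -/s in sx *; clra.
  by case: Sx => _ Hx; rewrite ltr_norml => /andP[]; clra.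
have {}sb : s < b.
  by rewrite lt_neqAle sb andbT; apply/eqP => sb'; rewrite sb' in Hs1; clra.
have after x : s < x -> x <= b -> v < H x.
  move=> sx xb; rewrite ltNge; apply/negP => Hx.
  have : x <= s by apply: sup_upper_bound => //; split => //; clra.
  clra.
have Hs : H s = v.
  apply/eqP; rewrite eq_le Hs1/= leNgt; apply/negP => vs.
  have [d d0 hd] := csH (v - H s) ltac:(by rewrite subr_gt0).
  pose x := Num.min b (s + d / 2).
  have xb : x <= b by rewrite ge_min lexx.
  have sx : s < x by rewrite lt_min sb/=; clra.
  have xd : x <= s + d / 2 by rewrite ge_min lexx orbT.
  have /hd : `|x - s| < d by rewrite gtr0_norm; clra.
  by have := after x sx xb; rewrite ltr_norml => ? /andP[]; clra.
have {}as_ : a < s.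
  by rewrite lt_neqAle as_ andbT; apply/eqP => sa; rewrite -sa Ha in Hs; clra.
exists s => //; apply: contrapT => Es.
have [|l dFs lM] := dF s _ Es; first by rewrite as_.
have /is_derive_epsP/(_ eta eta0)[d d0 hd] := dFs.
pose x := Num.min b (s + d / 2).
have xb : x <= b by rewrite ge_min lexx.
have sx : s < x by rewrite lt_min sb/=; clra.
have xd : x <= s + d / 2 by rewrite ge_min lexx orbT.
have xs0 : 0 < x - s by clra.
have := hd x; rewrite gtr0_norm// => /(_ ltac:(clra)); rewrite ler_norml => /andP[_ h].
have := after x sx xb; rewrite -Hs /H => h2.
have h3 : l * (x - s) <= M * (x - s) by rewrite ler_pM2r.
have : F x - F s <= eta * (x - s) + M * (x - s) by clra.
clra.
Qed.

Lemma mean_value_countable_norm F (E : set R) a b M : a <= b ->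
  countable E -> (forall x, a <= x <= b -> {for x, continuous F}) ->
  (forall x, a < x < b -> ~ E x ->
    exists2 l : R, is_derive x 1 F l & `|l| <= M) ->
  `|F b - F a| <= M * (b - a).
Proof.
move=> ab cE cF dF; rewrite ler_norml; apply/andP; split; last first.
  apply: (mean_value_countable ab cE cF) => x xab Ex.
  by have [l dl lM] := dF x xab Ex; exists l => //; rewrite (le_trans _ lM)// ler_norm.
rewrite lerNl opprB.
have -> : F a - F b = (\- F) b - (\- F) a by rewrite opprK addrC.
apply: (mean_value_countable ab cE).
  by move=> x xab; apply: cvgN; exact: cF.
move=> x xab Ex; have [l dl lM] := dF x xab Ex; exists (- l).
  exact: is_deriveN.
by rewrite (le_trans _ lM)// -normrN ler_norm.
Qed.

End real_functions.

(** * Inverse branches *)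

Section branches.
Context {R : realType}.
Implicit Types (p q s lam L x y : R) (f u : R -> R).

(** [s] is the orientation of the branch: bounds on [s * f] treat increasing and decreasing branches
    together. Bounding slopes of chords rather than derivatives makes sense up to the ends [p] and
    [q]. *)
Definition monotone_branch p q f s lam L :=
  [/\ p < q, 0 < lam, s = 1 \/ s = -1 &
    forall x y, p <= x -> x <= y -> y <= q ->
      lam * (y - x) <= s * (f y - f x) /\ s * (f y - f x) <= L * (y - x)].

Definition in_image p q f x := exists y, p <= y <= q /\ f y = x.

(* Off the image of [[p, q]] the inverse is extended by the constants [p] and
   [q], so that it is monotone on the line. *)
Definition branch_inv p q f s x : R :=
  if pselect (in_image p q f x) is left h then sval (cid h)
  else if s * (x - f p) < 0 then p else q.

(** One branch of a transfer operator, the weight being included in [u]: points without a preimage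
    in the branch receive 0. *)
Definition pushed p q f s u x : R :=
  if pselect (in_image p q f x) is left _ then u (branch_inv p q f s x) else 0.

Context p q f s lam L (Hb : monotone_branch p q f s lam L).

Local Notation J := (in_image p q f).
Local Notation psi := (branch_inv p q f s).

Lemma branch_inv_itv x : p <= psi x <= q.
Proof.
have [pq _ _ _] := Hb.
rewrite /branch_inv; case: pselect => [h|_]; first by case: (cid h) => ? [].
by case: ifP; rewrite lexx ltW.
Qed.

Lemma branch_invK x : J x -> f (psi x) = x.
Proof.
by rewrite /branch_inv; case: pselect => [h _|//]; case: (cid h) => ? [].
Qed.

Lemma branch_inj x y : p <= x <= q -> p <= y <= q -> f x = f y -> x = y.
Proof.
have [pq l0 _ H] := Hb => /andP[px xq] /andP[py yq] e.
case: (leP x y) => xy.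
  have [+ _] := H x y px xy yq; rewrite e subrr mulr0 pmulr_rle0// subr_le0 => yx.
  by apply/eqP; rewrite eq_le xy.
have [+ _] := H y x py (ltW xy) xq; rewrite e subrr mulr0 pmulr_rle0// subr_le0.
by rewrite leNgt xy.
Qed.

Lemma branch_fK y : p <= y <= q -> psi (f y) = y.
Proof.
move=> yi; apply: branch_inj; rewrite ?branch_inv_itv//.
by apply: branch_invK; exists y.
Qed.

Lemma branch_lipschitz x y : p <= x <= q -> p <= y <= q ->
  lam * `|y - x| <= `|f y - f x| /\ `|f y - f x| <= L * `|y - x|.
Proof.
have [pq l0 Hs H] := Hb.
wlog xy : x y / x <= y => [W|].
  case: (leP x y) => xy; first exact: W.
  by rewrite distrC (distrC (f y)) => ? ?; apply: W => //; exact: ltW.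
move=> /andP[px xq] /andP[py yq].
rewrite (ger0_norm (_ : 0 <= y - x)) ?subr_ge0//.
have [H1 H2] := H x y px xy yq.
have : 0 <= lam * (y - x) by apply: mulr_ge0; clra.
case: Hs H1 H2 => -> H1 H2 h.
  by rewrite ger0_norm; clra.
by rewrite ler0_norm; clra.
Qed.

Lemma in_imageP x : J x <-> s * f p <= s * x <= s * f q.
Proof.
have [pq l0 Hs H] := Hb; split=> [[y [/andP[py yq] <-]]|].
  have [+ _] := H p y (lexx _) py yq; have [+ _] := H y q py yq (lexx _).
  have : 0 <= lam * (y - p) by apply: mulr_ge0; clra.
  have : 0 <= lam * (q - y) by apply: mulr_ge0; clra.
  by move=> *; apply/andP; split; clra.
(* [f] is unknown outside [[p, q]]; composed with the retraction onto this segment it is continuous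
   on the line, and the intermediate value theorem applies. *)
move=> sx; pose cl y := Num.max p (Num.min q y).
have cli y : p <= cl y <= q.
  by rewrite /cl le_max ge_max ge_min !lexx (ltW pq).
have clE y : p <= y <= q -> cl y = y.
  by move=> /andP[py yq]; rewrite /cl (min_idPr yq) (max_idPr py).
have cllip y z : `|cl y - cl z| <= `|y - z|.
  wlog zy : y z / z <= y => [W|].
    by case: (leP z y) => zy; [exact: W|rewrite distrC (distrC y) W// ltW].
  rewrite (ger0_norm (_ : 0 <= y - z)) ?subr_ge0// ler_norml; rewrite /cl.
  have [h1|h1] := leP q y; have [h2|h2] := leP q z;
    rewrite ?(max_idPr (ltW pq)); try clra;
    have [h3|h3] := leP p z; try have [h4|h4] := leP p y; clra.
have cF : continuous (f \o cl).
  move=> z; apply/continuous_epsP => e e0.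
  have L0 : 0 < L + 1.
    have [a b] := H p q (lexx _) (ltW pq) (lexx _).
    have : 0 < L * (q - p).
      by apply: lt_le_trans (le_trans a b); rewrite mulr_gt0 ?subr_gt0.
    by rewrite pmulr_lgt0 ?subr_gt0// => ?; rewrite addr_gt0.
  exists (e / (L + 1)); first exact: divr_gt0.
  move=> y; rewrite ltr_pdivlMr// => yz /=.
  have [_ h] := branch_lipschitz (cli z) (cli y).
  apply: le_lt_trans h _; apply: le_lt_trans yz.
  rewrite mulrC; apply: (@le_trans _ _ (`|cl y - cl z| * (L + 1))).
    by rewrite ler_wpM2l// lerDl.
  by apply: ler_wpM2r; [exact: ltW|exact: cllip].
have [||y] := @IVT R (f \o cl) p q x (ltW pq).
- exact: continuous_subspaceT.
- rewrite /= !clE ?lexx ?(ltW pq)// ge_min le_max.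
  by case: Hs sx => ->; rewrite ?mul1r ?mulN1r ?lerN2 => /andP[-> ->]; rewrite ?orbT.
- by rewrite in_itv/= => yi; rewrite clE// => fy; exists y.
Qed.

Lemma branch_inv_trichotomy x :
  [\/ s * x < s * f p /\ psi x = p, J x | s * f q < s * x /\ psi x = q].
Proof.
have [pq l0 Hs H] := Hb.
case: (pselect (J x)) => Jx; first exact: Or32.
have nx : psi x = if s * (x - f p) < 0 then p else q.
  by rewrite /branch_inv; case: pselect.
have [+ _] := H p q (lexx _) (ltW pq) (lexx _).
have : 0 <= lam * (q - p) by apply: mulr_ge0; clra.
move/in_imageP/negP : Jx; rewrite negb_and -!ltNge => /orP[] h h1 h2.
  by apply: Or31; rewrite nx; split=> //; case: ltP; clra.
by apply: Or33; rewrite nx; split=> //; case: ltP; clra.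
Qed.

Lemma branch_inv_mono x y : x <= y -> 0 <= s * (psi y - psi x).
Proof.
have [pq l0 Hs H] := Hb => xy.
have /andP[py yq] := branch_inv_itv y.
have /andP[px xq] := branch_inv_itv x.
have [h _] := H p q (lexx _) (ltW pq) (lexx _).
have h0 : 0 <= lam * (q - p) by apply: mulr_ge0; clra.
case: (branch_inv_trichotomy x) => [[hx ->]|Jx|[hx ->]];
  case: (branch_inv_trichotomy y) => [[hy ->]|Jy|[hy ->]];
  try (have /in_imageP/andP[? ?] := Jx); try (have /in_imageP/andP[? ?] := Jy);
  try (case: Hs => sE; rewrite sE in hx hy h *; clra);
  try (case: Hs => sE; rewrite sE in hx h *; clra);
  try (case: Hs => sE; rewrite sE in hy h *; clra);
  try (case: Hs => sE; subst s; clra).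
case: (leP (psi x) (psi y)) => h'.
  have [h1 _] := H _ _ px h' yq; move: h1; rewrite !branch_invK// => h1.
  case: Hs => sE; subst s; first clra.
  have : lam * (branch_inv p q f (-1) y - branch_inv p q f (-1) x) <= 0 by clra.
  by rewrite pmulr_rle0//; clra.
have [h1 _] := H _ _ py (ltW h') xq; move: h1; rewrite !branch_invK// => h1.
case: Hs => sE; subst s; last clra.
have : lam * (branch_inv p q f 1 x - branch_inv p q f 1 y) <= 0 by clra.
by rewrite pmulr_rle0//; clra.
Qed.

Lemma branch_inv_lipschitz x y : J x -> J y ->
  `|psi y - psi x| <= `|y - x| / lam.
Proof.
have [pq l0 Hs H] := Hb => Jx Jy.
have [h _] := branch_lipschitz (branch_inv_itv x) (branch_inv_itv y).
by rewrite ler_pdivlMr// mulrC; move: h; rewrite !branch_invK.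
Qed.

(** The image is the segment between [f p] and [f q], so membership is locally constant away from
    its two ends. *)
Lemma in_image_near x : x <> f p -> x <> f q ->
  exists2 d : R, 0 < d & forall y, `|y - x| < d -> J y <-> J x.
Proof.
have [pq l0 Hs H] := Hb.
move=> /eqP xp /eqP xq; exists (Num.min `|x - f p| `|x - f q|).
  by rewrite lt_min !normr_gt0 !subr_eq0 xp.
have key a y : `|y - x| < `|x - a| -> ((a <= y) = (a <= x)) * ((y <= a) = (x <= a)).
  rewrite ltr_norml; have [xa|xa] := ltP x a.
    rewrite (ltr0_norm (_ : x - a < 0)) ?subr_lt0// => /andP[h1 h2].
    by split; [rewrite leNgt; clra|rewrite (ltW xa); clra].
  rewrite (ger0_norm (_ : 0 <= x - a)) ?subr_ge0// => /andP[h1 h2].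
  have ya : a < y by clra.
  have ax : a < x by clra.
  by rewrite (ltW ya) !leNgt ya ax.
move=> y; rewrite lt_min => /andP[/key[ep1 ep2] /key[eq1 eq2]].
rewrite !in_imageP; case: Hs => ->; first by rewrite !mul1r ep1 eq2.
by rewrite !mulN1r !lerN2 ep2 eq1.
Qed.

Lemma interior_branch_inv x : x <> f p -> x <> f q -> J x -> p < psi x < q.
Proof.
move=> xp xq Jx; have /andP[h1 h2] := branch_inv_itv x.
have e := branch_invK Jx; rewrite !lt_neqAle h1 h2 !andbT; apply/andP; split; apply/eqP => h.
  by apply: xp; rewrite -e -h.
by apply: xq; rewrite -h e.
Qed.

Lemma pushedE u x : J x -> pushed p q f s u x = u (psi x).
Proof. by rewrite /pushed; case: pselect. Qed.

Lemma pushed_out u x : ~ J x -> pushed p q f s u x = 0.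
Proof. by rewrite /pushed; case: pselect. Qed.

Lemma pushed_continuous u x : x <> f p -> x <> f q ->
  (J x -> {for psi x, continuous u}) ->
  {for x, continuous (pushed p q f s u)}.
Proof.
have [pq l0 Hs H] := Hb.
move=> xp xq cu; have [d d0 hd] := in_image_near xp xq.
apply/continuous_epsP => e e0; case: (pselect (J x)) => Jx; last first.
  exists d => // y /hd Jy; rewrite !pushed_out ?subrr ?normr0//.
  by move/Jy.
have /continuous_epsP/(_ e e0)[d1 d10 hd1] := cu Jx.
exists (Num.min d (d1 * lam)); first by rewrite lt_min d0 mulr_gt0.
move=> y; rewrite lt_min => /andP[/hd yd yd1].
have Jy : J y by apply/yd.
rewrite !pushedE//; apply: hd1; apply: le_lt_trans (branch_inv_lipschitz Jx Jy) _.
by rewrite ltr_pdivrMr.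
Qed.

(** The rule for inverse functions. At a preimage the lower bound on chord slopes excludes a zero
    derivative of [f]; off the image the pushed function is locally 0. *)
Lemma pushed_is_derive u u' f' x : x <> f p -> x <> f q ->
  (J x -> is_derive (psi x) 1 u (u' (psi x)) /\
          is_derive (psi x) 1 f (f' (psi x))) ->
  is_derive x 1 (pushed p q f s u) (pushed p q f s (fun y => u' y / f' y) x).
Proof.
have [pq l0 Hs H] := Hb.
move=> xp xq du; have [d d0 hd] := in_image_near xp xq.
case: (pselect (J x)) => Jx; last first.
  rewrite [X in is_derive _ _ _ X]pushed_out//.
  apply: (is_derive_local (F := cst 0) d0).
  by move=> y /hd yx; rewrite pushed_out// => /yx.
have {du}[/is_derive_epsP du /is_derive_epsP df] := du Jx.
rewrite pushedE//; set z := psi x in du df *.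
have f'0 : f' z != 0.
  apply/eqP => f'0; have [d1 d10 hd1] := df (lam / 2) ltac:(by rewrite divr_gt0).
  have /andP[pz zq] := interior_branch_inv xp xq Jx.
  pose y := Num.min q (z + d1 / 2).
  have yq : y <= q by rewrite ge_min lexx.
  have zy : z < y by rewrite lt_min zq/=; clra.
  have yd : y <= z + d1 / 2 by rewrite ge_min lexx orbT.
  have /hd1 : `|y - z| < d1 by rewrite gtr0_norm; clra.
  rewrite f'0 mul0r subr0 leNgt => /negP; apply.
  rewrite -/z in pz zq.
  have zi : p <= z <= q by apply/andP; split; clra.
  have yi : p <= y <= q by apply/andP; split; clra.
  have [h _] := branch_lipschitz zi yi.
  apply: lt_le_trans h; rewrite ltr_pM2r; last by rewrite normr_gt0; clra.
  by rewrite ltr_pdivrMr//; clra.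
apply/is_derive_epsP => e e0.
pose C := 1 + `|u' z / f' z|.
have C0 : 0 < C by rewrite ltr_pwDl.
pose e1 := e * lam / C.
have e10 : 0 < e1 by rewrite divr_gt0// mulr_gt0.
have [d1 d10 hd1] := du e1 e10; have [d2 d20 hd2] := df e1 e10.
exists (Num.min d (Num.min (d1 * lam) (d2 * lam))).
  by rewrite !lt_min d0 !mulr_gt0.
move=> y; rewrite !lt_min => /and3P[/hd yd yd1 yd2].
have Jy : J y by apply/yd.
have lip := branch_inv_lipschitz Jx Jy; rewrite -/z in lip.
rewrite !pushedE// -/z.
have := hd1 (psi y); rewrite -ltr_pdivrMr// in yd1.
move=> /(_ (le_lt_trans lip yd1)) h1.
have := hd2 (psi y); rewrite -ltr_pdivrMr// in yd2.
move=> /(_ (le_lt_trans lip yd2)).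
rewrite (branch_invK Jy) {1}/z (branch_invK Jx) => h2.
(* Since [f (psi y) = y], the error splits into the first order errors of [u] and of [f] at [psi y],
   a point within [|y - x| / lam] of [z]. *)
have -> : u (psi y) - u z - u' z / f' z * (y - x) =
  (u (psi y) - u z - u' z * (psi y - z)) -
  u' z / f' z * (y - x - f' z * (psi y - z)) by field.
apply: le_trans (ler_normB _ _) _; rewrite normrM.
apply: (@le_trans _ _ (C * (e1 * `|psi y - z|))).
  rewrite /C mulrDl mul1r; apply: lerD => //.
  by rewrite ler_wpM2l.
apply: (@le_trans _ _ (C * (e1 * (`|y - x| / lam)))).
  by rewrite !ler_pM2l.
by rewrite le_eqVlt; apply/orP; left; apply/eqP; rewrite /e1; field; rewrite !gt_eqF.
Qed.

End branches.

(** * Smooth functions *)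

Section smoothness.
Context {R : realType}.
Implicit Types (f g u v : R -> R) (U V : set R) (x y a b l p q lam L M : R).

Lemma derive1_is_derive u y : derivable u y 1 -> is_derive y 1 u ((derive1 u) y).
Proof. by move=> /derivableP; rewrite derive1E. Qed.

Lemma is_derive_derive1 u y l : is_derive y 1 u l -> (derive1 u) y = l.
Proof. by move=> ul; rewrite derive1E derive_val. Qed.

Lemma is_derive_continuous u y l : is_derive y 1 u l -> {for y, continuous u}.
Proof.
by move=> [/derivable1_diffP /differentiable_continuous].
Qed.

Lemma open_epsP U : open U <->
  forall x, U x -> exists2 d : R, 0 < d & forall y, `|y - x| < d -> U y.
Proof.
rewrite openE; split=> H x /H.
  by move=> /nbhs_ballP[d d0 hd]; exists d => // y yx; apply: hd; rewrite /ball/= distrC.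
move=> [d d0 hd]; apply/nbhs_ballP; exists d => // y; rewrite /ball/= distrC.
exact: hd.
Qed.

Lemma is_derive_ext U u v x l : open U -> U x -> (forall y, U y -> u y = v y) ->
  is_derive x 1 u l -> is_derive x 1 v l.
Proof.
move=> /open_epsP oU /oU[d d0 hd] uv; apply: (is_derive_local d0) => y /hd.
exact: uv.
Qed.

Definition bounded_continuous_on U u : Prop :=
  (exists M : R, forall y, U y -> `|u y| <= M) /\
  forall y, U y -> {for y, continuous u}.

Lemma bounded_continuous_on_ext U u v : open U -> (forall y, U y -> u y = v y) ->
  bounded_continuous_on U u -> bounded_continuous_on U v.
Proof.
move=> /open_epsP oU uv [[M uM] uc]; split.
  by exists M => y Uy; rewrite -uv//; exact: uM.
move=> y Uy; apply/continuous_epsP => e e0.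
have [d1 d10 hd1] := oU y Uy.
have /continuous_epsP/(_ e e0)[d2 d20 hd2] := uc y Uy.
exists (Num.min d1 d2); first by rewrite lt_min d10.
move=> z; rewrite lt_min => /andP[/hd1 Uz /hd2].
by rewrite !uv.
Qed.

Lemma bounded_continuous_onD U u v : bounded_continuous_on U u ->
  bounded_continuous_on U v -> bounded_continuous_on U (fun y => u y + v y).
Proof.
move=> [[M uM] uc] [[N vN] vc]; split; last first.
  by move=> y Uy; apply: cvgD; [exact: uc|exact: vc].
exists (M + N) => y Uy.
by apply: le_trans (ler_normD _ _) _; apply: lerD; [exact: uM|exact: vN].
Qed.

Lemma bounded_continuous_onM U u v : bounded_continuous_on U u ->
  bounded_continuous_on U v -> bounded_continuous_on U (fun y => u y * v y).
Proof.
move=> [[M uM] uc] [[N vN] vc]; split; last first.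
  by move=> y Uy; apply: cvgM; [exact: uc|exact: vc].
exists (M * N) => y Uy.
by rewrite normrM ler_pM//; [exact: uM|exact: vN].
Qed.

Lemma bounded_continuous_on_cst U a : bounded_continuous_on U (cst a).
Proof. by split=> [|y _]; first exists `|a|; last exact: cvg_cst. Qed.

(** Boundedness is required at each order because the branch intervals are open, while the
    contraction needs constants that are uniform up to their ends. *)
Fixpoint smooth_on n U u : Prop :=
  bounded_continuous_on U u /\
  if n is m.+1 then (forall y, U y -> derivable u y 1) /\ smooth_on m U (derive1 u)
  else True.

Lemma smooth_on_bounded_continuous n U u : smooth_on n U u ->
  bounded_continuous_on U u.
Proof. by case: n => [|n] []. Qed.

Lemma smooth_onW n U u : smooth_on n.+1 U u -> smooth_on n U u.
Proof.
elim: n u => [|n IH] u [uM [du su]]; first by split.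
by split => //; split => //; apply: IH.
Qed.

Lemma smooth_on_ext n U u v : open U -> (forall y, U y -> u y = v y) ->
  smooth_on n U u -> smooth_on n U v.
Proof.
move=> oU; elim: n u v => [|n IH] u v uv [uM].
  by move=> _; split => //; exact: bounded_continuous_on_ext uM.
move=> [du su]; split; first exact: bounded_continuous_on_ext uM.
have dv y : U y -> is_derive y 1 v (derive1 u y).
  by move=> Uy; apply: (is_derive_ext oU Uy uv); apply: derive1_is_derive; exact: du.
split; first by move=> y /dv [].
by apply: IH su => y /dv /is_derive_derive1.
Qed.

Lemma smooth_on_cst n U a : smooth_on n U (cst a).
Proof.
elim: n a => [|n IH] a; first by split => //; exact: bounded_continuous_on_cst.
split; first exact: bounded_continuous_on_cst.
split; first by move=> y _; exact: derivable_cst.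
have -> : derive1 (cst a : R -> R) = cst 0.
  by apply/funext => y; apply: is_derive_derive1; exact: is_derive_cst.
exact: IH.
Qed.

Lemma smooth_onD n U u v : open U -> smooth_on n U u -> smooth_on n U v ->
  smooth_on n U (fun y => u y + v y).
Proof.
move=> oU; elim: n u v => [|n IH] u v [uM +] [vN].
  by move=> _ _; split => //; exact: bounded_continuous_onD.
move=> [du su] [dv sv]; split; first exact: bounded_continuous_onD.
have d y : U y -> is_derive y 1 (fun y => u y + v y) (derive1 u y + derive1 v y).
  by move=> Uy; apply: is_deriveD; apply: derive1_is_derive; [exact: du|exact: dv].
split; first by move=> y /d[].
by apply: smooth_on_ext (IH _ _ su sv) => // y /d /is_derive_derive1.
Qed.

Lemma smooth_onM n U u v : open U -> smooth_on n U u -> smooth_on n U v ->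
  smooth_on n U (fun y => u y * v y).
Proof.
move=> oU; elim: n u v => [|n IH] u v su sv.
  split => //; apply: bounded_continuous_onM; apply: smooth_on_bounded_continuous;
  [exact: su|exact: sv].
have su' := smooth_onW su; have sv' := smooth_onW sv.
move: su sv => [uM [du su]] [vN [dv sv]]; split; first exact: bounded_continuous_onM.
have d y : U y -> is_derive y 1 (fun y => u y * v y)
    (u y * derive1 v y + v y * derive1 u y).
  by move=> Uy; apply: is_deriveM; apply: derive1_is_derive; [exact: du|exact: dv].
split; first by move=> y /d[].
have := smooth_onD oU (IH _ _ su' sv) (IH _ _ sv' su).
by apply: smooth_on_ext => // y /d /is_derive_derive1.
Qed.

(** The derivative of [1 / u] is [- u' / u ^ 2], in which [1 / u] is already smooth to one order
    less by the induction hypothesis. *)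
Lemma smooth_onV n U u lam : open U -> 0 < lam ->
  (forall y, U y -> lam <= `|u y|) ->
  smooth_on n U u -> smooth_on n U (fun y => (u y)^-1).
Proof.
move=> oU l0 ul.
have u0 y : U y -> u y != 0.
  by move=> /ul; apply: contraTneq => ->; rewrite normr0 -ltNge.
move=> su; have bd : bounded_continuous_on U (fun y => (u y)^-1).
  have [_ uc] := smooth_on_bounded_continuous su; split; last first.
    by move=> y Uy; apply: cvgV; [exact: u0|exact: uc].
  exists lam^-1 => y Uy; rewrite normfV lef_pV2 ?posrE//; first exact: ul.
  by rewrite normr_gt0 u0.
elim: n su => [|n IH] su; first by split.
have su' := IH (smooth_onW su); move: su => [_ [du su]]; split; first exact: bd.
have d y : U y -> is_derive y 1 (fun y => (u y)^-1)
    (-1 * (((u y)^-1 * (u y)^-1) * derive1 u y)).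
  move=> Uy; have -> : -1 * (((u y)^-1 * (u y)^-1) * derive1 u y) =
    - u y ^- 2 *: derive1 u y.
    by rewrite /GRing.scale/=; field; exact: u0.
  by apply: is_deriveV; [exact: u0|apply: derive1_is_derive; exact: du].
split; first by move=> y /d[].
have := smooth_onM oU (smooth_on_cst n U (-1)) (smooth_onM oU (smooth_onM oU su' su') su).
by apply: smooth_on_ext => // y /d /is_derive_derive1.
Qed.

Lemma smooth_onU n U V u : smooth_on n U u -> smooth_on n V u ->
  smooth_on n (U `|` V) u.
Proof.
have bd u' : bounded_continuous_on U u' -> bounded_continuous_on V u' ->
    bounded_continuous_on (U `|` V) u'.
  move=> [[M uM] uc] [[N vN] vc]; split; last by move=> y []; [exact: uc|exact: vc].
  exists (Num.max M N) => y.
  by rewrite le_max => -[/uM ->//|/vN ->]; rewrite orbT.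
elim: n u => [|n IH] u [uM +] [vN]; first by split => //; exact: bd.
move=> [du su] [dv sv]; split; first exact: bd.
by split; [move=> y []; [exact: du|exact: dv]|exact: IH].
Qed.

Lemma smooth_on_deriv n U u : smooth_on n.+1 U u -> smooth_on n U (derive1 u).
Proof. by case=> _ []. Qed.

Lemma has_deriv_within_interior a b f x l : a < x < b ->
  has_deriv_within `[a, b] f x l -> is_derive x 1 f l.
Proof.
move=> /andP[ax xb] /cvgrPdist_le H; apply/is_derive_epsP => e e0.
have := H _ e0; rewrite /within/= near_withinE => /nbhs_ballP[d /= d0 hd].
exists (Num.min d (Num.min (x - a) (b - x))); first by rewrite !lt_min d0 !subr_gt0 ax.
move=> y; rewrite !lt_min => /and3P[yd ya yb].
have [->|yx0] := eqVneq y x; first by rewrite !subrr mulr0 subr0 normr0 mulr0.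
have Dy : a <= y <= b.
  by move: ya yb; rewrite !ltr_norml => /andP[? ?] /andP[? ?]; apply/andP; split; clra.
have := hd y; rewrite /ball/= distrC => /(_ yd yx0); rewrite in_itv/= => /(_ Dy).
rewrite /diff_quotient => h.
have yx1 : 0 < `|y - x| by rewrite normr_gt0 subr_eq0.
rewrite -ler_pdivrMr// -normfV -normrM; apply: le_trans h.
rewrite distrC le_eqVlt; apply/orP; left; apply/eqP.
by congr (`|_|); field; rewrite subr_eq0.
Qed.

Lemma within_continuous_bounded a b f : {within `[a, b], continuous f} ->
  exists M : R, forall y, a <= y <= b -> `|f y| <= M.
Proof.
move=> cf; have : compact (f @` `[a, b]).
  by apply: continuous_compact => //; exact: segment_compact.
move=> /compact_bounded [M [_ hM]]; exists (M + 1) => y yab.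
by apply: (hM (M + 1)); [rewrite ltrDl|exists y; rewrite //= in_itv].
Qed.

Lemma class_C_deriv n a b f : class_C n.+1 `[a, b] f ->
  class_C n `[a, b] (deriv_within `[a, b] f).
Proof.
move=> [H1 H2]; split=> i ile.
  move=> x Dx; have := H1 i.+1 ile x Dx.
  by rewrite /deriv_within_n iterSr.
by have := H2 i.+1 ile; rewrite /deriv_within_n iterSr.
Qed.

Lemma class_C_is_derive n a b f y : class_C n.+1 `[a, b] f -> a < y < b ->
  is_derive y 1 f (deriv_within `[a, b] f y).
Proof.
move=> [H1 _] yab; apply: (has_deriv_within_interior yab).
apply: (H1 0%N) => //=; rewrite in_itv/=.
by move: yab => /andP[/ltW -> /ltW ->].
Qed.

(** Inside the segment the relative derivatives are the ordinary ones; their bounds come from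
    compactness of [[a, b]]. *)
Lemma class_C_smooth_on n a b p q f : a <= p -> q <= b ->
  class_C n `[a, b] f -> smooth_on n `]p, q[ f.
Proof.
move=> ap qb.
have bc f' : {within `[a, b], continuous f'} -> bounded_continuous_on `]p, q[ f'.
  move=> cf; split; last first.
    move=> y /=; rewrite in_itv/= => /andP[py yq].
    have yab : y \in `]a, b[ by rewrite in_itv/=; apply/andP; split; clra.
    move: cf => /(continuous_subspaceW (@subset_itv_oo_cc _ _ a b)).
    rewrite continuous_open_subspace; last exact: interval_open.
    by apply; rewrite inE.
  have [M hM] := within_continuous_bounded cf.
  by exists M => y; rewrite /= in_itv/= => /andP[? ?]; apply: hM; clra.
elim: n f => [|n IH] f Cf; first by split=> //; exact: bc (Cf.2 0%N (leqnn _)).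
split; first exact: bc (Cf.2 0%N (leq0n _)).
have d y : `]p, q[%classic y -> is_derive y 1 f (deriv_within `[a, b] f y).
  rewrite /= in_itv/= => /andP[py yq]; apply: (class_C_is_derive Cf).
  by apply/andP; split; clra.
split; first by move=> y /d[].
apply: smooth_on_ext (IH _ (class_C_deriv Cf)) => //.
by move=> y /d /is_derive_derive1.
Qed.

(** A change of sign would produce a zero of [g] by the intermediate value theorem, against the
    lower bound [lam] on its absolute value. *)
Lemma constant_sign p q g lam : 0 < lam ->
  (forall x, p < x < q -> {for x, continuous g} /\ lam <= `|g x|) ->
  exists s : R, (s = 1 \/ s = -1) /\ forall x, p < x < q -> lam <= s * g x.
Proof.
move=> l0 H; have [pq|qp] := ltP p q; last first.
  by exists 1; split; [left|move=> x /andP[? ?]; clra].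
have key x y : p < x < q -> p < y < q -> 0 < g x -> 0 < g y.
  move=> xi yi gx; rewrite ltNge; apply/negP => gy.
  have [z zi gz] : exists2 z : R, p < z < q & g z = 0.
    have cg a b : p < a -> b < q -> {within `[a, b], continuous g}.
      move=> pa bq; apply: continuous_in_subspaceT => z; rewrite inE/= in_itv/= => /andP[? ?].
      by apply: (H z _).1; apply/andP; split; clra.
    case: (leP x y) => xy.
      have [||z zi gz] := @IVT R g x y 0 xy.
      - by apply: cg; clra.
      - by rewrite ge_min le_max gy (ltW gx) orbT.
      - by exists z => //; move: zi; rewrite in_itv/= => /andP[? ?]; apply/andP; split; clra.
    have [||z zi gz] := @IVT R g y x 0 (ltW xy).
    - by apply: cg; clra.
    - by rewrite ge_min le_max gy (ltW gx) orbT.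
    - by exists z => //; move: zi; rewrite in_itv/= => /andP[? ?]; apply/andP; split; clra.
  have [_] := H z zi; rewrite gz normr0; clra.
pose m := (p + q) / 2; have mi : p < m < q by rewrite /m; apply/andP; split; clra.
have [gm|gm] := ltP 0 (g m).
  exists 1; split; [by left|move=> x xi; rewrite mul1r].
  by have [_] := H x xi; rewrite gtr0_norm//; exact: key gm.
exists (-1); split; [by right|move=> x xi; rewrite mulN1r].
have [_] := H x xi; rewrite ler0_norm// leNgt; apply/negP => gx.
by have := key _ _ xi mi gx; clra.
Qed.

Lemma class_C_branch a b p q f lam L : a <= p -> p < q -> q <= b -> 0 < lam ->
  class_C 2 `[a, b] f ->
  (forall x, x \in `[a, b] -> lam <= `|deriv_within `[a, b] f x|) ->
  (forall x, p < x < q -> `|deriv_within `[a, b] f x| <= L) ->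
  exists s : R, [/\ s = 1 \/ s = -1,
    forall x, p < x < q -> lam <= s * deriv_within `[a, b] f x &
    forall x y, p <= x -> x <= y -> y <= q ->
      lam * (y - x) <= s * (f y - f x) /\ s * (f y - f x) <= L * (y - x)].
Proof.
move=> ap pq qb l0 Cf fl fL.
have [|s [s1 hs]] := @constant_sign p q (deriv_within `[a, b] f) lam l0.
  move=> x xi; have /andP[px xq] := xi; split.
    by apply: (is_derive_continuous (class_C_is_derive (class_C_deriv Cf) _)); apply/andP; split; clra.
  by apply: fl; rewrite in_itv/=; apply/andP; split; clra.
exists s; split => // x y px xy yq.
have [->|xy0] := eqVneq x y; first by rewrite !subrr !mulr0.
have {xy0}xy1 : x < y by rewrite lt_neqAle xy0.
have cf : {within `[x, y], continuous f}.
  apply: (@continuous_subspaceW _ _ _ `[a, b]); last exact: (Cf.2 0%N).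
  by apply: subset_itv; rewrite bnd_simp; clra.
have df z : z \in `]x, y[ -> is_derive z 1 f (deriv_within `[a, b] f z).
  rewrite in_itv/= => /andP[xz zy].
  by apply: (class_C_is_derive Cf); apply/andP; split; clra.
have [z + ->] := MVT xy1 df cf.
rewrite in_itv/= => /andP[xz zy].
have zi : p < z < q by apply/andP; split; clra.
have yx0 : 0 < y - x by rewrite subr_gt0.
rewrite mulrA !ler_pM2r//; split; first exact: hs.
apply: le_trans (fL z zi); case: s1 => ->; first by rewrite mul1r ler_norm.
by rewrite mulN1r -normrN ler_norm.
Qed.

End smoothness.

(** * Functions of bounded variation *)

Section bounded_variation.
Context {R : realType}.
Implicit Types (u v : R -> R) (x y l : R).

Lemma at_right_eps u x l : u y @[y --> x^'+] --> l ->
  forall e : R, 0 < e -> exists2 d : R, 0 < d &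
    forall y, x < y -> y < x + d -> `|u y - l| < e.
Proof.
move=> /cvgrPdist_lt H e e0; have := H e e0.
rewrite /at_right near_withinE => /nbhs_ballP[d /= d0 hd].
exists d => // y xy yd; rewrite distrC; apply: hd => //.
by rewrite /ball/= distrC gtr0_norm; clra.
Qed.

Lemma at_left_eps u x l : u y @[y --> x^'-] --> l ->
  forall e : R, 0 < e -> exists2 d : R, 0 < d &
    forall y, y < x -> x - d < y -> `|u y - l| < e.
Proof.
move=> /cvgrPdist_lt H e e0; have := H e e0.
rewrite /at_left near_withinE => /nbhs_ballP[d /= d0 hd].
exists d => // y xy yd; rewrite distrC; apply: hd => //.
by rewrite /ball/= gtr0_norm; clra.
Qed.

Definition clamp01 x := Num.max 0 (Num.min 1 x).

Lemma clamp01_itv x : 0 <= clamp01 x <= 1.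
Proof. by rewrite /clamp01 le_max ge_max ge_min !lexx ler01. Qed.

Lemma clamp01_id x : 0 <= x <= 1 -> clamp01 x = x.
Proof. by move=> /andP[x0 x1]; rewrite /clamp01 (min_idPr x1) (max_idPr x0). Qed.

Lemma clamp01_le x y : x <= y -> clamp01 x <= clamp01 y.
Proof.
move=> xy; rewrite /clamp01; have [h1|h1] := leP 1 x; have [h2|h2] := leP 1 y;
  rewrite ?(max_idPr (@ler01 R)); try clra;
  have [h3|h3] := leP 0 x; try have [h4|h4] := leP 0 y; clra.
Qed.

(** The majorant is the total variation on [[0, x]]; clamping the argument makes it monotone on the
    whole line. *)
Lemma bounded_variation_majorant u : bounded_variation 0 1 u ->
  exists v, nondecreasing_fun v /\
    forall x y, 0 <= x -> x <= y -> y <= 1 -> `|u y - u x| <= v y - v x.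
Proof.
move=> bu; exists (fun x => fine (total_variation 0 (clamp01 x) u)).
have fin x : 0 <= x <= 1 -> total_variation 0 x u \is a fin_num.
  move=> /andP[x0 x1]; apply/bounded_variationP => //.
  exact: (bounded_variationl _ x1 bu).
split=> [x y xy|x y x0 xy y1].
  apply: fine_le; rewrite ?fin ?clamp01_itv//.
  apply: (@total_variation_nondecreasing _ 0 1); rewrite ?in_itv/= ?clamp01_itv//.
  exact: clamp01_le.
rewrite !clamp01_id; [|by apply/andP; split; clra..].
have xi : 0 <= x <= 1 by apply/andP; split; clra.
have yi : 0 <= y <= 1 by apply/andP; split; clra.
rewrite -lee_fin EFinB !fineK ?fin// leeBrDl ?fin//.
rewrite (total_variationD u x0 xy) leeD2l//; exact: total_variation_ge.
Qed.

Lemma nondecreasing_continuousP v x : nondecreasing_fun v ->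
  ~ discontinuity v x ->
  forall e : R, 0 < e -> exists2 d : R, 0 < d & v (x + d) - v (x - d) < e.
Proof.
move=> vm nd.
have cr : cvg (v y @[y --> x^'+]).
  apply: nondecreasing_at_right_is_cvgr.
    by near=> b => y z _ _; exact: vm.
  near=> b; exists (v x) => _ [z /= + <-]; rewrite in_itv/= => /andP[/ltW xz _].
  exact: vm.
have cl : cvg (v y @[y --> x^'-]).
  apply: nondecreasing_at_left_is_cvgr.
    by near=> b => y z _ _; exact: vm.
  near=> b; exists (v x) => _ [z /= + <-]; rewrite in_itv/= => /andP[_ /ltW xz].
  exact: vm.
have lr : lim (v y @[y --> x^'-]) = lim (v y @[y --> x^'+]).
  by apply: contrapT => /eqP lr; apply: nd.
move=> e e0; have e20 : 0 < e / 2 by rewrite divr_gt0.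
have [d1 d10 h1] := at_right_eps cr e20.
have [d2 d20 h2] := at_left_eps cl e20.
pose d := Num.min d1 d2 / 2.
have d0 : 0 < d by rewrite divr_gt0// lt_min d10.
have dd1 : d < d1.
  by have := d0; have : Num.min d1 d2 <= d1 by [rewrite ge_min lexx]; rewrite /d; clra.
have dd2 : d < d2.
  by have := d0; have : Num.min d1 d2 <= d2 by [rewrite ge_min lexx orbT]; rewrite /d; clra.
exists d => //.
have := h1 (x + d) ltac:(clra) ltac:(clra); have := h2 (x - d) ltac:(clra) ltac:(clra).
by rewrite lr !ltr_norml => /andP[? ?] /andP[? ?]; clra.
Unshelve. all: by end_near. Qed.

(** Where the monotone majorant is continuous, so is [u], and a monotone function has countably many
    jumps. *)
Lemma bounded_variation_discontinuities u : bounded_variation 0 1 u ->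
  countable [set x : R | 0 < x < 1 /\ ~ {for x, continuous u}].
Proof.
move=> /bounded_variation_majorant[v [vm uv]].
have vm01 : {in `[0, 1] &, nondecreasing_fun v} by move=> x y _ _; exact: vm.
apply: sub_countable (discontinuity_countable vm01).
apply: subset_card_le => x /= [/andP[x0 x1] ncu]; split.
  by rewrite in_itv/= x0.
apply: contrapT => nd; apply: ncu; apply/continuous_epsP => e e0.
have [d d0 hd] := nondecreasing_continuousP vm nd e0.
exists (Num.min d (Num.min x (1 - x))); first by rewrite !lt_min d0 x0 subr_gt0.
move=> y; rewrite !lt_min => /and3P[yd yx yx1].
move: yd yx yx1; do 3 rewrite ltr_norml => /andP[? ?].
apply: le_lt_trans hd; case: (leP x y) => xy.
  apply: le_trans (uv x y _ _ _) _; try clra.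
  have v1 : v y <= v (x + d) by apply: vm; clra.
  have v2 : v (x - d) <= v x by apply: vm; clra.
  clra.
rewrite distrC; apply: le_trans (uv y x _ _ _) _; try clra.
have v1 : v (x - d) <= v y by apply: vm; clra.
have v2 : v x <= v (x + d) by apply: vm; clra.
clra.
Qed.

Lemma bounded_variation_norm_le u : bounded_variation 0 1 u ->
  exists2 M : R, 0 < M & forall x, 0 <= x <= 1 -> `|u x| <= M.
Proof.
move=> /bounded_variation_majorant[v [vm uv]].
have v01 := vm 0 1 ler01.
exists (`|u 0| + (v 1 - v 0) + 1).
  by have := normr_ge0 (u 0); clra.
move=> x /andP[x0 x1]; have := uv 0 x ltac:(clra) x0 x1; have := vm x 1 x1.
have -> : u x = u 0 + (u x - u 0) by ring.
have := ler_normD (u 0) (u x - u 0); rewrite (addrC (u 0)) subrK; clra.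
Qed.

Lemma bounded_variation_integrable u : bounded_variation 0 1 u ->
  (@lebesgue_measure R).-integrable `[0, 1] (EFin \o u).
Proof.
move=> bu; have [v [vm uv]] := bounded_variation_majorant bu.
apply: measurable_bounded_integrable => //.
- by rewrite /= lebesgue_measure_itv/= lte_fin ltr01 -EFinB ltry.
(* Jordan decomposition: [v - u] is nondecreasing too, so [u] is a difference of monotone functions
   and thereby measurable. *)
- pose w x := v (clamp01 x) - u (clamp01 x).
  have wm : nondecreasing_fun w.
    move=> x y xy; have cxy := clamp01_le xy.
    have /andP[cx0 _] := clamp01_itv x; have /andP[_ cy1] := clamp01_itv y.
    have := uv _ _ cx0 cxy cy1; rewrite ler_norml /w => /andP[? ?]; clra.
  apply: (@eq_measurable_fun _ _ _ _ _ (v \- w)).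
    by move=> x; rewrite inE/= in_itv/= /w => xi; rewrite clamp01_id//; ring.
  by apply: measurable_funB; apply: nondecreasing_measurable.
- have [M M0 uM] := bounded_variation_norm_le bu.
  exists M; split; first exact: num_real.
  by move=> N MN x /=; rewrite in_itv/= => /uM /le_trans; apply; exact: ltW.
Qed.

Lemma bounded_variation_primitive u : bounded_variation 0 1 u ->
  let P x := (\int[lebesgue_measure]_(t in `[0, x]) u t)%R in
  (exists2 M : R, 0 < M & forall x y, 0 <= x <= 1 -> 0 <= y <= 1 ->
    `|P y - P x| <= M * `|y - x|) /\
  (forall x, 0 < x < 1 -> {for x, continuous u} -> is_derive x 1 P (u x)).
Proof.
move=> bu P; have iu := bounded_variation_integrable bu; split; last first.
  move=> x /andP[x0 x1] cux.
  have [dP eP] := continuous_FTC1_closed x1 iu x0 cux.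
  by rewrite -eP; exact: derive1_is_derive.
have [M M0 uM] := bounded_variation_norm_le bu; exists M => //.
move=> x y; wlog xy : x y / x <= y => [W|].
  by case: (leP x y) => xy; [exact: W|move=> xi yi; rewrite distrC (distrC y) W// ltW].
move=> /andP[x0 x1] /andP[y0 y1].
have sub (a b : itv_bound R) : (BLeft 0%R <= a)%O -> (b <= BRight 1%R)%O ->
    (@lebesgue_measure R).-integrable [set` Interval a b] (EFin \o u).
  by move=> a0 b1; apply: integrableS iu => //; exact: subset_itv.
rewrite (_ : P y - P x = (\int[lebesgue_measure]_(t in `]x, y]) u t)%R); last first.
  rewrite /P Rintegral_itvB//; first by apply: sub; rewrite ?bnd_simp.
have ixy : (@lebesgue_measure R).-integrable `]x, y] (EFin \o u).
  by apply: sub; rewrite ?bnd_simp.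
apply: le_trans (le_normr_Rintegral _ ixy) _ => //.
apply: (@le_trans _ _ (\int[lebesgue_measure]_(t in `]x, y]) M)%R).
  apply: le_Rintegral => //.
  - exact: integrable_norm ixy.
  - apply: measurable_bounded_integrable => //.
      by rewrite /= lebesgue_measure_itv/=; case: ifP => // _; rewrite -EFinB ltry.
    exact: bounded_cst.
  - move=> t /=; rewrite in_itv/= => /andP[? ?]; apply: uM.
    by apply/andP; split; clra.
rewrite Rintegral_cst//= lebesgue_measure_itv/= lte_fin.
have [xy1|xy1] := ltP x y.
  by rewrite -EFinB/= gtr0_norm// subr_gt0.
by rewrite mulr0 mulr_ge0// ltW.
Qed.

End bounded_variation.

(** * The differentiated transfer operator *)

Lemma finite_common_bound (R : realType) n (P : nat -> R -> Prop) :
  (forall j (M N : R), M <= N -> P j M -> P j N) ->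
  (forall j, (j < n)%N -> exists M, P j M) ->
  exists2 M : R, 1 <= M & forall j, (j < n)%N -> P j M.
Proof.
move=> Pm; elim: n => [_|n IH H]; first by exists 1.
have [M M1 hM] := IH (fun j jn => H j (ltnW jn)).
have [N hN] := H n (ltnSn n).
exists (Num.max M N); first by rewrite le_max M1.
move=> j; rewrite ltnS leq_eqVlt => /predU1P[->|jn].
  by apply: Pm hN; rewrite le_max lexx orbT.
by apply: Pm (hM j jn); rewrite le_max lexx.
Qed.

Section two_branches.
Context {R : realType}.
Implicit Types (p q s x y lam L : R) (f u v : R -> R).

Lemma in_image_segment p q f s lam L x y a b : monotone_branch p q f s lam L ->
  ~ (a <= f p <= b) -> ~ (a <= f q <= b) -> a <= x <= b -> a <= y <= b ->
  in_image p q f x -> in_image p q f y.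
Proof.
move=> Hb hp hq xi yi; have [pq l0 Hs H] := Hb.
rewrite !(in_imageP Hb); move/negP: hp; move/negP: hq.
rewrite !negb_and -!ltNge; move: xi yi => /andP[? ?] /andP[? ?].
by move=> /orP[?|?] /orP[?|?]; case: Hs => -> /andP[? ?]; apply/andP; split; clra.
Qed.

Lemma branch_between p q f s lam L y z t : monotone_branch p q f s lam L ->
  p <= y <= q -> p <= z <= q -> y <= t <= z \/ z <= t <= y ->
  f y <= f t <= f z \/ f z <= f t <= f y.
Proof.
move=> [pq l0 Hs H] /andP[py yq] /andP[pz zq].
wlog : y z py yq pz zq / y <= t <= z => [W [] h|/andP[yt tz] _].
- by apply: W => //; left.
- by apply/or_comm; apply: W => //; left.
have [h1 _] := H y t py yt ltac:(clra).
have [h2 _] := H t z ltac:(clra) tz zq.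
have h3 : 0 <= lam * (t - y) by apply: mulr_ge0; clra.
have h4 : 0 <= lam * (z - t) by apply: mulr_ge0; clra.
by case: Hs h1 h2 => -> ? ?; [left|right]; apply/andP; split; clra.
Qed.

(** The factor [s] restores monotonicity when the branch decreases. The total increment is at most
    that of [v] over [[p, q]] alone, which is what lets the two branches share one total increment
    of [v] over [[0, 1]]. *)
Lemma branch_inv_variation p q f s lam L v : monotone_branch p q f s lam L ->
  nondecreasing_fun v ->
  nondecreasing_fun (fun x => s * v (branch_inv p q f s x)) /\
  forall x y, s * v (branch_inv p q f s y) - s * v (branch_inv p q f s x) <= v q - v p.
Proof.
move=> Hb vm; have [pq l0 Hs H] := Hb; split=> x y.
  move=> /(branch_inv_mono Hb).
  by case: Hs => sE; subst s => h; [have := vm _ _ (_ : branch_inv p q f 1 x <= branch_inv p q f 1 y)|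
   have := vm _ _ (_ : branch_inv p q f (-1) y <= branch_inv p q f (-1) x)]; clra.
have /andP[h1 h2] := branch_inv_itv Hb x; have /andP[h3 h4] := branch_inv_itv Hb y.
have := vm _ _ h1; have := vm _ _ h2; have := vm _ _ h3; have := vm _ _ h4.
by case: Hs => sE; subst s; clra.
Qed.

End two_branches.

Definition expanding_unimodal (R : realType) (f : R -> R) (c s0 s1 lam L : R) :=
  [/\ 0 < c < 1, (forall x, 0 <= x <= 1 -> 0 <= f x <= 1), 1 < lam,
      monotone_branch 0 c f s0 lam L & monotone_branch c 1 f s1 lam L].

Section coefficients.
Context {R : realType}.
Variables (f : R -> R) (U : set R).
Implicit Types (y : R).

Local Notation df := (derive1 f).

(* [rho_j = L (\sum_(l <= j) coef j l * rho_l)], where [L u] sums [u] over the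
   preimages of a point: the case [j = 0] is the invariance of the density, and
   differentiating the equation for [j] gives the one for [j + 1]. *)
Fixpoint coef (j l : nat) : R -> R :=
  match j with
  | 0 => if l is 0 then (fun y => `|df y|^-1) else cst 0
  | i.+1 => fun y =>
      (derive1 (coef i l) y + (if l is m.+1 then coef i m y else 0)) / df y
  end.

Lemma coef_gt j l : (j < l)%N -> coef j l = cst 0.
Proof.
elim: j l => [|j IH] [|l]//=; rewrite ltnS => jl.
apply/funext => y; rewrite IH ?(ltnW jl)// ?IH//=; last exact: leq_trans jl _.
rewrite (_ : derive1 (cst 0) y = 0) ?addr0 ?mul0r//.
by apply: is_derive_derive1; exact: is_derive_cst.
Qed.

(** Both sums produced by the product rule are put on the range [l <= j + 1]: the first gains a term
    that vanishes with [coef j j.+1], the second is shifted by one. *)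
Lemma coef_recursion (r : nat -> R -> R) j y :
  (\sum_(l < j.+1) (derive1 (coef j l) y * r l y + coef j l y * r l.+1 y)) / df y =
  \sum_(l < j.+2) coef j.+1 l y * r l y.
Proof.
rewrite big_split/= mulrDl.
have -> : \sum_(l < j.+1) derive1 (coef j l) y * r l y =
          \sum_(l < j.+2) derive1 (coef j l) y * r l y.
  rewrite [RHS]big_ord_recr/= coef_gt//.
  rewrite (_ : derive1 (cst 0) y = 0) ?mul0r ?addr0//.
  by apply: is_derive_derive1; exact: is_derive_cst.
have -> : \sum_(l < j.+1) coef j l y * r l.+1 y =
    \sum_(l < j.+2) (if nat_of_ord l is m.+1 then coef j m y else 0) * r l y.
  by rewrite [RHS]big_ord_recl/= mul0r add0r.
rewrite -mulrDl -big_split/= mulr_suml; apply: eq_bigr => l _.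
by rewrite -mulrDl mulrAC.
Qed.

Context (lam : R) (k : nat).
Hypotheses (oU : open U) (lam1 : 1 < lam) (fU : smooth_on k.+1 U f).
Hypothesis (flam : forall y, U y -> lam <= `|df y|).
Hypothesis (absf : smooth_on k U (fun y => `|df y|^-1)).

Let lam0 : 0 < lam. Proof. exact: lt_trans lam1. Qed.

Lemma smooth_onW_le m n (u : R -> R) : (n <= m)%N -> smooth_on m U u -> smooth_on n U u.
Proof.
by move=> /subnK <-; elim: (m - n)%N => [//|i IH] h; apply: IH; exact: smooth_onW.
Qed.

(** Each step of the recursion differentiates once and so costs one order of smoothness. *)
Lemma coef_smooth j l : (j <= k)%N -> smooth_on (k - j) U (coef j l).
Proof.
elim: j l => [|j IH] l jk.
  by rewrite subn0; case: l => [|l] //=; exact: smooth_on_cst.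
have h m : smooth_on (k - j.+1).+1 U (coef j m).
  by rewrite -subSn//= subSS; apply: IH; exact: ltnW.
have e : smooth_on (k - j.+1) U (fun y => (df y)^-1).
  apply: (smooth_onV oU lam0 flam); apply: smooth_on_deriv.
  by apply: smooth_onW_le fU; rewrite ltnS leq_subr.
apply: (smooth_onM oU) e; apply: (smooth_onD oU); first exact: smooth_on_deriv.
by case: l => [|l]; [exact: smooth_on_cst|exact: smooth_onW].
Qed.

(** On the diagonal nothing is differentiated: since [coef j j.+1] vanishes, each step only divides
    by [df], and [coef j j] is [|df|^-1] divided by [df ^ j]. *)
Lemma coef_diag j y : U y -> `|coef j j y| <= lam^-1.
Proof.
move=> Uy; have dfy := flam Uy.
have inv : `|df y|^-1 <= lam^-1.
  by rewrite lef_pV2 ?posrE//; exact: lt_le_trans dfy.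
elim: j => [|j IH] /=; first by rewrite normfV normr_id.
rewrite coef_gt// (_ : derive1 (cst 0) y = 0); last first.
  by apply: is_derive_derive1; exact: is_derive_cst.
rewrite add0r normrM normfV; apply: le_trans inv.
rewrite ler_piMl ?invr_ge0//; apply: le_trans IH _.
by rewrite invf_le1// ltW.
Qed.

Lemma coef_bounds : exists2 C : R, 1 <= C & forall j l, (j < k)%N -> (l <= j)%N ->
  forall y, U y -> `|coef j l y| <= C /\ `|derive1 (coef j l) y / df y| <= C.
Proof.
have [||C C1 hC] := @finite_common_bound R k (fun j M =>
    forall l, (l < j.+1)%N -> forall y, U y ->
      `|coef j l y| <= M /\ `|derive1 (coef j l) y / df y| <= M).
- by move=> j M N MN h l lj y Uy; have [? ?] := h l lj y Uy; split; exact: le_trans MN.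
- move=> j jk; have [||M M1 hM] := @finite_common_bound R j.+1 (fun l M =>
    forall y, U y -> `|coef j l y| <= M /\ `|derive1 (coef j l) y / df y| <= M).
  + by move=> l M N MN h y Uy; have [? ?] := h y Uy; split; exact: le_trans MN.
  + move=> l lj; have s := coef_smooth l (ltnW jk).
    have [[M1 h1] _] := smooth_on_bounded_continuous s.
    have s' : smooth_on (k - j.+1).+1 U (coef j l) by rewrite -subSn.
    have [[M2 h2] _] := smooth_on_bounded_continuous (smooth_on_deriv s').
    exists (Num.max M1 M2) => y Uy; split; first by rewrite le_max h1.
    rewrite normrM normfV ler_pdivrMr; last exact: lt_le_trans (flam Uy).
    rewrite (@le_trans _ _ M2) ?h2//.
    have M20 : 0 <= M2 by exact: le_trans (h2 y Uy).
    apply: (@le_trans _ _ (M2 * `|df y|)).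
      by rewrite ler_peMr// (le_trans (ltW lam1))// flam.
    by rewrite ler_wpM2r// le_max lexx orbT.
  + by exists M => l lj y Uy; exact: hM.
- by exists C => // j l jk lj y Uy; exact: hC.
Qed.

End coefficients.

(** * Contraction of the singular parts *)

Lemma continuous_sum (R : realType) n (F : nat -> R -> R) (x : R) :
  (forall l, (l < n)%N -> {for x, continuous (F l)}) ->
  {for x, continuous (fun y => \sum_(l < n) F l y)}.
Proof.
elim: n => [_|n IH H].
  rewrite (_ : (fun y => _) = cst 0); first exact: cvg_cst.
  by apply/funext => y; rewrite big_ord0.
rewrite (_ : (fun y => _) = (fun y => \sum_(l < n) F l y + F n y)).
  by apply: cvgD; [apply: IH => l ln; apply: H; exact: ltnW|exact: H].
by apply/funext => y; rewrite big_ord_recr.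
Qed.

Lemma is_derive_sum_fun (R : realType) n (F dF : nat -> R -> R) (x : R) :
  (forall l, (l < n)%N -> is_derive x 1 (F l) (dF l x)) ->
  is_derive x 1 (fun y => \sum_(l < n) F l y) (\sum_(l < n) dF l x).
Proof.
elim: n => [_|n IH H].
  rewrite big_ord0 (_ : (fun y => _) = cst 0); first exact: is_derive_cst.
  by apply/funext => y; rewrite big_ord0.
rewrite big_ord_recr/= (_ : (fun y => _) = (fun y => \sum_(l < n) F l y + F n y)).
  by apply: is_deriveD; [apply: IH => l ln; apply: H; exact: ltnW|exact: H].
by apply/funext => y; rewrite big_ord_recr.
Qed.

Section pushed_linear.
Context {R : realType}.
Implicit Types (u v : R -> R).

Lemma eq_pushed p q f s u v (x : R) : (forall y, u y = v y) ->
  pushed p q f s u x = pushed p q f s v x.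
Proof. by move=> uv; rewrite /pushed; case: pselect. Qed.

Lemma pushedD p q f s u v (x : R) :
  pushed p q f s (fun y => u y + v y) x = pushed p q f s u x + pushed p q f s v x.
Proof. by rewrite /pushed; case: pselect; rewrite ?addr0. Qed.

Lemma pushedB p q f s u v (x : R) :
  pushed p q f s (fun y => u y - v y) x = pushed p q f s u x - pushed p q f s v x.
Proof. by rewrite /pushed; case: pselect; rewrite ?subr0. Qed.

End pushed_linear.

Section contraction.
Context {R : realType}.
Variables (f : R -> R) (c s0 s1 lam L : R) (k : nat).
Variables (rho Pr : nat -> R -> R) (Gam : set R).
Implicit Types (p q s x y a b : R) (v : nat -> R -> R).

Local Notation df := (derive1 f).
Local Notation U := [set y | 0 < y < c \/ c < y < 1].
Local Notation G := (fun l y => rho l y - Pr l.+1 y).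

Definition coef_comb (r : nat -> R -> R) j y := \sum_(l < j.+1) coef f j l y * r l y.

(** Pushing a function through the branches creates jumps at the images of their ends 0, [c] and 1,
    hence the start at [m = 1]. Taking a preimage of the segment lowers the time [n] by one. *)
Definition avoids n a b := forall m p, (1 <= m <= n)%N ->
  [\/ p = 0, p = c | p = 1] -> ~ (a <= iter m f p <= b).

Hypothesis Hf : expanding_unimodal f c s0 s1 lam L.
Hypothesis fU : smooth_on k.+1 U f.
Hypothesis flam : forall y, U y -> lam <= `|df y|.
Hypothesis absf : smooth_on k U (fun y => `|df y|^-1).
Hypothesis Gam_itv : forall x, Gam x ->
  [/\ 0 < x < 1, x <> c, x <> f 0, x <> f c & x <> f 1].
Hypothesis Gam_preim : forall x y, Gam x -> 0 <= y <= 1 -> f y = x -> Gam y.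
Hypothesis Gam_count : countable ([set x | 0 <= x <= 1] `\` Gam).
Hypothesis Pr_deriv : forall l x, (l <= k)%N -> Gam x -> is_derive x 1 (Pr l) (rho l x).
Hypothesis Pr_cont : forall l x, (l <= k)%N -> 0 < x < 1 -> {for x, continuous (Pr l)}.
Hypothesis rho_eq : forall j x, (j <= k)%N -> Gam x ->
  rho j x = pushed 0 c f s0 (coef_comb rho j) x + pushed c 1 f s1 (coef_comb rho j) x.

Let oU : open U.
Proof.
rewrite (_ : U = `]0, c[%classic `|` `]c, 1[%classic).
  by apply: openU; exact: interval_open.
by apply/seteqP; split => y /=; rewrite !in_itv.
Qed.

Let lam1 : 1 < lam. Proof. by case: Hf. Qed.

Lemma Gam_U x : Gam x -> U x.
Proof.
move=> /Gam_itv[/andP[x0 x1] /eqP xc _ _ _].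
by move: xc; rewrite neq_lt => /orP[xc|xc]; [left|right]; apply/andP.
Qed.

Lemma coef_is_derive j l y : (j < k)%N -> U y ->
  is_derive y 1 (coef f j l) (derive1 (coef f j l) y).
Proof.
move=> jk Uy; apply: derive1_is_derive.
have := coef_smooth oU lam1 fU flam absf l (ltnW jk).
by rewrite -(subnSK jk) => -[_ [+ _]]; apply.
Qed.

(** The constants [g l] are free; the contraction takes for them the values of [G l] at a reference
    preimage. *)
Lemma coef_primitive_is_derive j (g : nat -> R) y : (j < k)%N -> Gam y ->
  is_derive y 1 (fun y => \sum_(l < j.+1) coef f j l y * (Pr l.+1 y + g l))
   (\sum_(l < j.+1) (derive1 (coef f j l) y * (Pr l.+1 y + g l) +
                     coef f j l y * rho l.+1 y)).
Proof.
move=> jk Gy.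
apply: (@is_derive_sum_fun _ _ (fun l y => coef f j l y * (Pr l.+1 y + g l))
  (fun l y => derive1 (coef f j l) y * (Pr l.+1 y + g l) + coef f j l y * rho l.+1 y)).
move=> l lj.
have -> : derive1 (coef f j l) y * (Pr l.+1 y + g l) + coef f j l y * rho l.+1 y =
  coef f j l y * rho l.+1 y + (Pr l.+1 y + g l) * derive1 (coef f j l) y by ring.
apply: is_deriveM; first exact: coef_is_derive (Gam_U Gy).
have := is_deriveD (Pr_deriv (leq_trans lj jk) Gy) (is_derive_cst (g l) y 1).
by rewrite addr0.
Qed.

Lemma coef_primitive_continuous j (g : nat -> R) y : (j < k)%N -> U y ->
  {for y, continuous (fun y => \sum_(l < j.+1) coef f j l y * (Pr l.+1 y + g l))}.
Proof.
move=> jk Uy.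
apply: (@continuous_sum _ _ (fun l y => coef f j l y * (Pr l.+1 y + g l))) => l lj.
apply: cvgM; first exact: is_derive_continuous (coef_is_derive l jk Uy).
apply: cvgD; last exact: cvg_cst.
apply: Pr_cont; first exact: leq_trans lj jk.
have [c01 _ _ _ _] := Hf.
by case: Uy => /andP[? ?]; apply/andP; split; lra.
Qed.

Section one_branch.
Context p q s.
Hypothesis Hb : monotone_branch p q f s lam L.
Hypotheses (p0 : 0 <= p) (q1 : q <= 1).
Hypothesis pE : [\/ p = 0, p = c | p = 1].
Hypothesis qE : [\/ q = 0, q = c | q = 1].
Hypothesis pqU : forall y, p < y < q -> U y.

Local Notation psi := (branch_inv p q f s).
Local Notation J := (in_image p q f).

Lemma Gam_branch x : Gam x -> J x -> Gam (psi x) /\ U (psi x).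
Proof.
move=> Gx Jx; have Gp : Gam (psi x).
  apply: Gam_preim Gx _ (branch_invK s Jx).
  have /andP[px xq] := branch_inv_itv Hb x.
  by rewrite (le_trans p0 px) (le_trans xq q1).
by split => //; exact: Gam_U.
Qed.

Lemma avoids_segment n a b x y : (0 < n)%N -> avoids n a b ->
  a <= x <= b -> a <= y <= b -> J x -> J y.
Proof.
move=> n0 av; apply: (in_image_segment Hb).
  by apply: (av 1%N) => //; rewrite n0.
by apply: (av 1%N) => //; rewrite n0.
Qed.

Lemma avoids_neq n a b x : (0 < n)%N -> avoids n a b -> a <= x <= b ->
  x <> f p /\ x <> f q.
Proof.
by move=> n0 av xi; split=> e; [apply: (av 1%N p)|apply: (av 1%N q)] => //=;
  rewrite ?n0// -e.
Qed.

(** The inverse branch shortens the segment, and if the shortened segment met [f^m p], then [[a, b]]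
    would meet [f^(m+1) p]. So the bound at level [n] applies to the preimages; monotonicity of
    [s * vl (psi _)] then replaces [x] by the end [a]. *)
Lemma branch_oscillation (n : nat) (d : R) (vl Gl : R -> R) a b x : nondecreasing_fun vl ->
  (forall y z, Gam y -> Gam z -> y <= z -> z - y <= d -> avoids n y z ->
    `|Gl z - Gl y| <= vl z - vl y) ->
  Gam x -> Gam b -> a <= x <= b -> b - a <= d -> avoids n.+1 a b -> J b ->
  `|Gl (psi x) - Gl (psi b)| <= s * vl (psi b) - s * vl (psi a).
Proof.
move=> vm H Gx Gb xi bad av Jb; have /andP[ax xb] := xi.
have Jx : J x by apply: (avoids_segment _ av _ _ Jb) => //; apply/andP; split; lra.
have [Gy _] := Gam_branch Gx Jx; have [Gz _] := Gam_branch Gb Jb.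
have [vsm _] := branch_inv_variation Hb vm.
apply: (@le_trans _ _ (s * vl (psi b) - s * vl (psi x))); last first.
  by rewrite lerB//; exact: vsm.
have lip : `|psi b - psi x| <= d.
  apply: le_trans (branch_inv_lipschitz Hb Jx Jb) _; rewrite ger0_norm ?subr_ge0//.
  rewrite ler_pdivrMr; last exact: lt_trans lam1.
  apply: (@le_trans _ _ d); first lra.
  by rewrite ler_peMr ?(ltW lam1)//; lra.
have avp t m p' : (1 <= m <= n)%N -> [\/ p' = 0, p' = c | p' = 1] -> t = iter m f p' ->
    psi x <= t <= psi b \/ psi b <= t <= psi x -> False.
  move=> /andP[m1 mn] Hp te tb.
  apply: (av m.+1 p') => //=.
  rewrite -te.
  have := branch_between Hb (branch_inv_itv Hb x) (branch_inv_itv Hb b) tb.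
  by rewrite !branch_invK// => -[] /andP[? ?]; apply/andP; split; lra.
have mono := branch_inv_mono Hb xb; have [_ _ Hs _] := Hb.
move: lip; rewrite ler_norml => /andP[l1 l2].
case: (leP (psi x) (psi b)) => xb'.
  have h : `|Gl (psi b) - Gl (psi x)| <= vl (psi b) - vl (psi x).
    apply: H => // m p' m1 hp' tb; apply: (avp _ _ _ m1 hp' erefl); by left.
  rewrite distrC; apply: le_trans h _.
  by case: Hs => sE; subst s; first lra; have -> : branch_inv p q f (-1) b = branch_inv p q f (-1) x; lra.
have h : `|Gl (psi x) - Gl (psi b)| <= vl (psi x) - vl (psi b).
  apply: H => //; [exact: ltW|lra|].
  move=> m p' m1 hp' tb; apply: (avp _ _ _ m1 hp' erefl); by right.
apply: le_trans h _.
by case: Hs => sE; subst s; lra.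
Qed.

Lemma pushed_sum_bound (n : nat) (d : R) v (w : nat -> R -> R) (K : nat -> R) j a b x :
  (j < k)%N -> (forall l, (l < k)%N -> nondecreasing_fun (v l)) ->
  (forall l y z, (l < k)%N -> Gam y -> Gam z -> y <= z -> z - y <= d -> avoids n y z ->
    `|G l z - G l y| <= v l z - v l y) ->
  (forall l y, (l <= j)%N -> U y -> `|w l y| <= K l) -> (forall l, 0 <= K l) ->
  Gam x -> Gam b -> a <= x <= b -> b - a <= d -> avoids n.+1 a b ->
  `|pushed p q f s (fun y => \sum_(l < j.+1) w l y * (G l y - G l (psi b))) x|
    <= \sum_(l < j.+1) K l * (s * v l (psi b) - s * v l (psi a)).
Proof.
move=> jk vm H wK K0 Gx Gb xi bad av; have /andP[ax xb] := xi.
have D0 l : (l < k)%N -> 0 <= s * v l (psi b) - s * v l (psi a).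
  move=> lk; have [vsm _] := branch_inv_variation Hb (vm l lk).
  by rewrite subr_ge0 vsm//; lra.
have lk (l : 'I_j.+1) : (l < k)%N by apply: leq_trans jk; rewrite ltnS -ltnS.
case: (pselect (J x)) => Jx; last first.
  by rewrite pushed_out// normr0 sumr_ge0// => l _; rewrite mulr_ge0// D0.
have Jb : J b by apply: (avoids_segment _ av _ _ Jx) => //; apply/andP; split; lra.
rewrite pushedE//; apply: le_trans (ler_norm_sum _ _ _) _.
apply: ler_sum => l _; rewrite normrM; apply: ler_pM => //.
  by apply: wK; [rewrite -ltnS|exact: (Gam_branch Gx Jx).2].
apply: (@branch_oscillation n d (v l) (G l)) => //; first exact: vm.
by move=> y z; exact: H.
Qed.

Lemma pushed_sum_zero (w : nat -> R -> R) j b :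
  pushed p q f s (fun y => \sum_(l < j.+1) w l y * (G l y - G l (psi b))) b = 0.
Proof.
rewrite /pushed; case: pselect => // _.
by rewrite big1// => l _; rewrite subrr mulr0.
Qed.

End one_branch.

(** [G j] is split into a part linear in increments of the [G l], with coefficients bounded by
    [lam^-1] on the diagonal and by [C] below it, and a continuous part made of primitives. The
    derivative of the latter is again linear in these increments, so over a length at most [d] it
    costs the extra terms [C * d]. *)
Lemma contraction_step (C d : R) n v : 1 <= C -> 0 < d ->
  (forall j l, (j < k)%N -> (l <= j)%N ->
     forall y, U y -> `|coef f j l y| <= C /\ `|derive1 (coef f j l) y / df y| <= C) ->
  (forall l, (l < k)%N -> nondecreasing_fun (v l)) ->
  (forall l y z, (l < k)%N -> Gam y -> Gam z -> y <= z -> z - y <= d -> avoids n y z ->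
    `|G l z - G l y| <= v l z - v l y) ->
  exists v' : nat -> R -> R,
  [/\ forall l, (l < k)%N -> nondecreasing_fun (v' l),
   (forall l y z, (l < k)%N -> Gam y -> Gam z -> y <= z -> z - y <= d -> avoids n.+1 y z ->
    `|G l z - G l y| <= v' l z - v' l y) &
   forall j, (j < k)%N -> v' j 1 - v' j 0 <=
     \sum_(l < j.+1) ((if l == j :> nat then lam^-1 else C) + C * d) * (v l 1 - v l 0)].
Proof.
move=> C1 d0 HC vm H; have [/andP[c0 c1] _ _ B0 B1] := Hf.
have lam0 : 0 < lam by exact: lt_trans lam1.
have C0 : 0 <= C by exact: le_trans C1.
pose psi0 := branch_inv 0 c f s0; pose psi1 := branch_inv c 1 f s1.
pose kap j l : R := (if l == j :> nat then lam^-1 else C) + C * d.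
have kap0 j l : 0 <= kap j l.
  apply: addr_ge0; last by rewrite mulr_ge0//; lra.
  by case: ifP => _; [rewrite invr_ge0 ltW|lra].
(* The old majorants are pushed through both inverse branches; the signs make every term
   nondecreasing. *)
exists (fun j x => \sum_(l < j.+1) kap j l * (s0 * v l (psi0 x) + s1 * v l (psi1 x))).
have lk j (l : 'I_j.+1) : (j < k)%N -> (l < k)%N.
  by move=> jk; apply: leq_trans jk; rewrite ltnS -ltnS.
split.
- move=> j jk x y xy; apply: ler_sum => l _; rewrite ler_wpM2l//.
  have [h0 _] := branch_inv_variation B0 (vm l (lk j l jk)).
  have [h1 _] := branch_inv_variation B1 (vm l (lk j l jk)).
  by apply: lerD; [exact: h0|exact: h1].
- move=> j a b jk Ga Gb ab bad av.
  pose D0 l := s0 * v l (psi0 b) - s0 * v l (psi0 a).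
  pose D1 l := s1 * v l (psi1 b) - s1 * v l (psi1 a).
  have -> : \sum_(l < j.+1) kap j l * (s0 * v l (psi0 b) + s1 * v l (psi1 b)) -
    \sum_(l < j.+1) kap j l * (s0 * v l (psi0 a) + s1 * v l (psi1 a)) =
    \sum_(l < j.+1) kap j l * D0 l + \sum_(l < j.+1) kap j l * D1 l.
    by rewrite -big_split/= -sumrB; apply: eq_bigr => l _; rewrite /D0 /D1; ring.
  (* Reference values at the preimages of [b]: subtracting them makes [E0] and [E1] vanish at
     [b]. *)
  pose g0 l := G l (psi0 b); pose g1 l := G l (psi1 b).
  pose u0 y := \sum_(l < j.+1) coef f j l y * (Pr l.+1 y + g0 l).
  pose u1 y := \sum_(l < j.+1) coef f j l y * (Pr l.+1 y + g1 l).
  (* Inserting [rho l = (G l - g l) + (Pr l.+1 + g l)] into the equation for [rho j] gives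
     [G j = E0 + E1 - Q] on [Gam], the increments of [G l] going to [E0] and [E1] and the primitives
     to [Q]. *)
  pose Q x := Pr j.+1 x - (pushed 0 c f s0 u0 x + pushed c 1 f s1 u1 x).
  pose E0 (w : nat -> R -> R) := pushed 0 c f s0
    (fun y => \sum_(l < j.+1) w l y * (G l y - g0 l)).
  pose E1 (w : nat -> R -> R) := pushed c 1 f s1
    (fun y => \sum_(l < j.+1) w l y * (G l y - g1 l)).
  have i0 : [\/ 0 = 0 :> R, 0 = c | 0 = 1 :> R] by constructor 1.
  have ic : [\/ c = 0, c = c | c = 1] by constructor 2.
  have i1 : [\/ 1 = 0 :> R, 1 = c | 1 = 1 :> R] by constructor 3.
  have U0 y : 0 < y < c -> U y by left.
  have U1 y : c < y < 1 -> U y by right.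
  have GE x : Gam x -> G j x = E0 (coef f j) x + E1 (coef f j) x - Q x.
    move=> Gx; rewrite /E0 /E1 /Q (rho_eq (ltnW jk) Gx).
    have e (p q s : R) (g : nat -> R) : pushed p q f s (coef_comb rho j) x =
      pushed p q f s (fun y => \sum_(l < j.+1) coef f j l y * (G l y - g l)) x +
      pushed p q f s (fun y => \sum_(l < j.+1) coef f j l y * (Pr l.+1 y + g l)) x.
      rewrite -pushedD; apply: eq_pushed => y.
      by rewrite /coef_comb -big_split/=; apply: eq_bigr => l _; ring.
    by rewrite (e _ _ _ g0) (e _ _ _ g1) -/u0 -/u1; ring.
  pose w l y := derive1 (coef f j l) y / df y.
  (* Differentiating the primitives gives back the [rho l.+1], which cancel against the equation for
     [rho j.+1]; only increments of the [G l] survive, weighted by the derivative of [coef j l] over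
     [df]. *)
  have dQ x : a <= x <= b -> Gam x -> is_derive x 1 Q (E0 w x + E1 w x).
    move=> xi Gx.
    have [n0 nc] := avoids_neq i0 ic (ltn0Sn n) av xi.
    have [_ n1] := avoids_neq ic i1 (ltn0Sn n) av xi.
    have e (p q s : R) (g : nat -> R) :
      pushed p q f s (fun y => \sum_(l < j.+1) w l y * (G l y - g l)) x =
      pushed p q f s (coef_comb rho j.+1) x -
      pushed p q f s (fun y => (\sum_(l < j.+1) (derive1 (coef f j l) y * (Pr l.+1 y + g l) +
                     coef f j l y * rho l.+1 y)) / df y) x.
      rewrite -pushedB; apply: eq_pushed => y.
      rewrite /coef_comb -coef_recursion -mulrBl -sumrB mulr_suml; apply: eq_bigr => l _.
      by rewrite /w; ring.
    have dF y (h : U y) : is_derive y 1 f (df y).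
      by apply: derive1_is_derive; exact: fU.2.1.
    have -> : E0 w x + E1 w x = rho j.+1 x -
      (pushed 0 c f s0 (fun y => (\sum_(l < j.+1) (derive1 (coef f j l) y * (Pr l.+1 y + g0 l) +
                     coef f j l y * rho l.+1 y)) / df y) x +
       pushed c 1 f s1 (fun y => (\sum_(l < j.+1) (derive1 (coef f j l) y * (Pr l.+1 y + g1 l) +
                     coef f j l y * rho l.+1 y)) / df y) x).
      by rewrite /E0 /E1 !e (rho_eq jk Gx); ring.
    apply: is_deriveB; first exact: Pr_deriv.
    apply: is_deriveD.
      apply: (@pushed_is_derive _ _ _ _ _ _ _ B0 u0 (fun y => \sum_(l < j.+1) (derive1 (coef f j l) y * (Pr l.+1 y + g0 l) +
                     coef f j l y * rho l.+1 y)) df) => // Jx.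
      have [Gp Up] := Gam_branch B0 (lexx _) (ltW c1) Gx Jx.
      by split; [exact: coef_primitive_is_derive|exact: dF].
    apply: (@pushed_is_derive _ _ _ _ _ _ _ B1 u1 (fun y => \sum_(l < j.+1) (derive1 (coef f j l) y * (Pr l.+1 y + g1 l) +
                     coef f j l y * rho l.+1 y)) df) => // Jx.
    have [Gp Up] := Gam_branch B1 (ltW c0) (lexx _) Gx Jx.
    by split; [exact: coef_primitive_is_derive|exact: dF].
  have cQ x : a <= x <= b -> {for x, continuous Q}.
    move=> xi; have [n0 nc] := avoids_neq i0 ic (ltn0Sn n) av xi.
    have [_ n1] := avoids_neq ic i1 (ltn0Sn n) av xi.
    apply: cvgB.
      apply: Pr_cont => //.
      have [/andP[a0 _] _ _ _ _] := Gam_itv Ga; have [/andP[_ b1] _ _ _ _] := Gam_itv Gb.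
      by move: xi => /andP[? ?]; apply/andP; split; lra.
    apply: cvgD.
      apply: (pushed_continuous B0) => // Jx; apply: coef_primitive_continuous => //.
      by apply: U0; exact: (interior_branch_inv B0).
    apply: (pushed_continuous B1) => // Jx; apply: coef_primitive_continuous => //.
    by apply: U1; exact: (interior_branch_inv B1).
  have bE0 (w' : nat -> R -> R) (K : nat -> R) x : (forall l y, (l <= j)%N -> U y -> `|w' l y| <= K l) ->
    (forall l, 0 <= K l) -> Gam x -> a <= x <= b ->
    `|E0 w' x| <= \sum_(l < j.+1) K l * D0 l.
    move=> wK K0 Gx xi.
    by apply: (@pushed_sum_bound _ _ _ B0 _ _ i0 ic n d v w' K j) => //; lra.
  have bE1 (w' : nat -> R -> R) (K : nat -> R) x : (forall l y, (l <= j)%N -> U y -> `|w' l y| <= K l) ->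
    (forall l, 0 <= K l) -> Gam x -> a <= x <= b ->
    `|E1 w' x| <= \sum_(l < j.+1) K l * D1 l.
    move=> wK K0 Gx xi.
    by apply: (@pushed_sum_bound _ _ _ B1 _ _ ic i1 n d v w' K j) => //; lra.
  have Qab : `|Q b - Q a| <=
      (\sum_(l < j.+1) C * D0 l + \sum_(l < j.+1) C * D1 l) * (b - a).
    apply: (mean_value_countable_norm ab Gam_count cQ) => x /andP[ax xb] Gx'.
    have xi : a <= x <= b by rewrite !ltW.
    have Gx : Gam x.
      apply: contrapT => nG; apply: Gx'; split => //=.
      have [/andP[a0 _] _ _ _ _] := Gam_itv Ga; have [/andP[_ b1] _ _ _ _] := Gam_itv Gb.
      by apply/andP; split; lra.
    exists (E0 w x + E1 w x); first exact: dQ.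
    apply: le_trans (ler_normD _ _) _; apply: lerD.
      by apply: (bE0 _ (fun=> C)) => // l y lj Uy; exact: (HC j l jk lj y Uy).2.
    by apply: (bE1 _ (fun=> C)) => // l y lj Uy; exact: (HC j l jk lj y Uy).2.
  pose K l : R := if l == j :> nat then lam^-1 else C.
  have K0 l : 0 <= K l by rewrite /K; case: ifP => _; [rewrite invr_ge0 ltW|lra].
  have cK l y : (l <= j)%N -> U y -> `|coef f j l y| <= K l.
    move=> lj Uy; rewrite /K; case: eqP => [->|_].
      exact: (coef_diag lam1 flam).
    exact: (HC j l jk lj y Uy).1.
  have ai : a <= a <= b by rewrite lexx.
  have bi : a <= b <= b by rewrite lexx ab.
  have -> : G j b - G j a = - (Q b - Q a) - (E0 (coef f j) a + E1 (coef f j) a).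
    rewrite (GE b Gb) (GE a Ga) {1}/E0 {1}/E1 !pushed_sum_zero; ring.
  apply: le_trans (ler_normB _ _) _; rewrite normrN.
  have h1 := ler_normD (E0 (coef f j) a) (E1 (coef f j) a).
  have h2 := bE0 _ K a cK K0 Ga ai.
  have h3 := bE1 _ K a cK K0 Ga ai.
  have D00 l : (l < j.+1)%N -> 0 <= D0 l.
    move=> lj; have [h _] := branch_inv_variation B0 (vm l (leq_trans lj jk)).
    by rewrite /D0 subr_ge0; exact: h.
  have D10 l : (l < j.+1)%N -> 0 <= D1 l.
    move=> lj; have [h _] := branch_inv_variation B1 (vm l (leq_trans lj jk)).
    by rewrite /D1 subr_ge0; exact: h.
  have S0 : 0 <= \sum_(l < j.+1) C * D0 l.
    by apply: sumr_ge0 => l _; rewrite mulr_ge0 ?D00//; lra.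
  have S1 : 0 <= \sum_(l < j.+1) C * D1 l.
    by apply: sumr_ge0 => l _; rewrite mulr_ge0 ?D10//; lra.
  have h4 : (\sum_(l < j.+1) C * D0 l + \sum_(l < j.+1) C * D1 l) * (b - a) <=
            (\sum_(l < j.+1) C * D0 l + \sum_(l < j.+1) C * D1 l) * d.
    by rewrite ler_wpM2l// addr_ge0.
  have e (D : nat -> R) : \sum_(l < j.+1) kap j l * D l =
      \sum_(l < j.+1) K l * D l + (\sum_(l < j.+1) C * D l) * d.
    by rewrite mulr_suml -big_split/=; apply: eq_bigr => l _; rewrite /kap /K; ring.
  rewrite !e; move: Qab h4; rewrite mulrDl (mulrDl _ _ d); lra.
(* The branches contribute at most [v l c - v l 0] and [v l 1 - v l c]: together one total
   increment, not two. *)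
- move=> j jk; rewrite -sumrB; apply: ler_sum => l _.
  rewrite -mulrBr ler_wpM2l//.
  have [_ h0] := branch_inv_variation B0 (vm l (lk j l jk)).
  have [_ h1] := branch_inv_variation B1 (vm l (lk j l jk)).
  by have := h0 0 1; have := h1 0 1; rewrite -/psi0 -/psi1; lra.
Qed.

End contraction.

Section iterated_contraction.
Context {R : realType}.
Variables (f : R -> R) (c s0 s1 lam L : R) (k : nat).
Variables (rho Pr : nat -> R -> R) (Gam : set R).
Implicit Types (x y z : R) (v : nat -> R -> R).

Local Notation df := (derive1 f).
Local Notation U := [set y | 0 < y < c \/ c < y < 1].
Local Notation G := (fun l y => rho l y - Pr l.+1 y).

Hypothesis Hf : expanding_unimodal f c s0 s1 lam L.
Hypothesis fU : smooth_on k.+1 U f.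
Hypothesis flam : forall y, U y -> lam <= `|df y|.
Hypothesis absf : smooth_on k U (fun y => `|df y|^-1).
Hypothesis Gam_itv : forall x, Gam x ->
  [/\ 0 < x < 1, x <> c, x <> f 0, x <> f c & x <> f 1].
Hypothesis Gam_preim : forall x y, Gam x -> 0 <= y <= 1 -> f y = x -> Gam y.
Hypothesis Gam_count : countable ([set x | 0 <= x <= 1] `\` Gam).
Hypothesis Pr_deriv : forall l x, (l <= k)%N -> Gam x -> is_derive x 1 (Pr l) (rho l x).
Hypothesis Pr_cont : forall l x, (l <= k)%N -> 0 < x < 1 -> {for x, continuous (Pr l)}.
Hypothesis rho_eq : forall j x, (j <= k)%N -> Gam x ->
  rho j x = pushed 0 c f s0 (coef_comb f rho j) x + pushed c 1 f s1 (coef_comb f rho j) x.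
Hypothesis G_majorant : forall l, (l < k)%N -> exists v : R -> R, nondecreasing_fun v /\
  forall y z, Gam y -> Gam z -> y <= z -> `|G l z - G l y| <= v z - v y.

Lemma unimodal_open : open U.
Proof.
rewrite (_ : U = `]0, c[%classic `|` `]c, 1[%classic).
  by apply: openU; exact: interval_open.
by apply/seteqP; split => y /=; rewrite !in_itv.
Qed.

(* The constants of [contraction_step] form a triangular array with diagonal
   [th0 < 1]; the weights [B ^+ l] make the off-diagonal terms negligible. *)
Lemma gap_contraction : exists d th M : R, [/\ 0 < d, 0 < th < 1, 0 < M &
  forall n l y z, (l < k)%N -> Gam y -> Gam z -> y <= z -> z - y <= d ->
    avoids f c n y z -> `|G l z - G l y| <= M * th ^+ n].
Proof.
have [_ _ lam1 _ _] := Hf.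
have lam0 : 0 < lam by exact: lt_trans lam1.
have [C C1 HC] := coef_bounds unimodal_open lam1 fU flam absf.
have ilam0 : 0 < lam^-1 by rewrite invr_gt0.
have ilam1 : lam^-1 < 1 by rewrite invf_lt1.
(* With this length [C * d] is half of [1 - lam^-1], and the diagonal constant [th0] stays below
   1. *)
pose d := (1 - lam^-1) / (2 * C).
have C0 : 0 < C by exact: lt_le_trans C1.
have d0 : 0 < d by rewrite divr_gt0 ?mulr_gt0// subr_gt0.
have Cd : C * d = (1 - lam^-1) / 2 by rewrite /d; field; rewrite !gt_eqF.
pose th0 := lam^-1 + C * d.
have th01 : th0 < 1 by rewrite /th0 Cd; lra.
have th00 : 0 < th0 by rewrite /th0 Cd; lra.
pose C2 := C + C * d.
have C20 : 0 <= C2 by rewrite /C2 Cd; lra.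
pose th := (1 + th0) / 2.
have th1 : th < 1 by rewrite /th; lra.
have tht : th0 < th by rewrite /th; lra.
(* An off-diagonal constant [C2] gets at least a factor [B^-1] from the weights; [B] is so large
   that [k] such terms add up to at most [th - th0]. *)
pose B := 1 + C2 * k%:R / (th - th0).
have B1 : 1 <= B by rewrite lerDl divr_ge0 ?mulr_ge0// subr_ge0 ltW.
have B0 : 0 < B by exact: lt_le_trans B1.
have CB : C2 * k%:R <= (th - th0) * B.
  rewrite /B mulrDr mulr1 mulrCA divff ?mulr1; last by rewrite subr_eq0 gt_eqF.
  by rewrite lerDr subr_ge0 ltW.
have [v0 Hv0] : exists v : nat -> R -> R, forall l, (l < k)%N ->
    nondecreasing_fun (v l) /\
    forall y z, Gam y -> Gam z -> y <= z -> `|G l z - G l y| <= v l z - v l y.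
  have := @choice nat (R -> R) (fun l (v : R -> R) => (l < k)%N -> nondecreasing_fun v /\
    forall y z, Gam y -> Gam z -> y <= z -> `|G l z - G l y| <= v z - v y).
  case=> [l|v Hv]; last by exists v.
  have [lk|lk] := boolP (l < k)%N; last by exists (fun=> 0).
  by have [v Hv] := G_majorant lk; exists v.
have [||M M1 HM] := @finite_common_bound R k (fun l M => v0 l 1 - v0 l 0 <= M).
- by move=> l M N MN h; exact: le_trans MN.
- by move=> l _; exists (v0 l 1 - v0 l 0).
have M0 : 0 < M by exact: lt_le_trans M1.
have key n : exists v, [/\ forall l, (l < k)%N -> nondecreasing_fun (v l),
    (forall l y z, (l < k)%N -> Gam y -> Gam z -> y <= z -> z - y <= d -> avoids f c n y z ->
    `|G l z - G l y| <= v l z - v l y) &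
    forall l, (l < k)%N -> v l 1 - v l 0 <= M * B ^+ l * th ^+ n].
  elim: n => [|n [v [vm vG vM]]].
    exists v0; split.
    - by move=> l /Hv0[].
    - by move=> l y z /Hv0[_ h] Gy Gz yz _ _; exact: h.
    - move=> l lk; rewrite expr0 mulr1; apply: le_trans (HM l lk) _.
      by rewrite ler_peMr ?(ltW M0)// exprn_ege1.
  have [v' [vm' vG' vM']] := contraction_step Hf fU flam absf Gam_itv Gam_preim Gam_count
    Pr_deriv Pr_cont rho_eq C1 d0 HC vm vG.
  exists v'; split => // j jk; apply: le_trans (vM' j jk) _.
  have thn : 0 <= th ^+ n by rewrite exprn_ge0//; lra.
  rewrite big_ord_recr/= eqxx -/th0.
  have h1 : th0 * (v j 1 - v j 0) <= th0 * (M * B ^+ j * th ^+ n).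
    by rewrite ler_pM2l// vM.
  have h2 : \sum_(l < j) ((if l == j :> nat then lam^-1 else C) + C * d) * (v l 1 - v l 0)
      <= (th - th0) * (M * B ^+ j * th ^+ n).
    apply: (@le_trans _ _ (\sum_(l < j) (C2 * B^-1) * (M * B ^+ j * th ^+ n))).
      apply: ler_sum => l _; rewrite (ltn_eqF (ltn_ord l)) -/C2.
      have lk : (l < k)%N by apply: ltn_trans jk.
      apply: (@le_trans _ _ (C2 * (M * B ^+ l * th ^+ n))).
        by rewrite ler_wpM2l// vM.
      rewrite -[leRHS]mulrA; apply: ler_wpM2l => //.
      rewrite mulrA; apply: ler_wpM2r => //.
      rewrite mulrCA; apply: ler_wpM2l; first exact: ltW.
      rewrite mulrC ler_pdivlMr// -exprSr.
      by rewrite ler_weXn2l.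
    rewrite sumr_const card_ord -mulr_natl mulrA; apply: ler_wpM2r.
      by rewrite !mulr_ge0 ?exprn_ge0 ?(ltW M0) ?(ltW B0)//; lra.
    rewrite mulrA ler_pdivrMr// (le_trans _ CB)// mulrC ler_wpM2l// ler_nat.
    exact: ltnW.
  by rewrite exprS; lra.
exists d, th, (M * B ^+ k); split => //; first by apply/andP; split; lra.
  by rewrite mulr_gt0// exprn_gt0.
move=> n l y z lk Gy Gz yz yzd av; have [v [vm vG vM]] := key n.
apply: le_trans (vG l y z lk Gy Gz yz yzd av) _.
have [/andP[y0 _] _ _ _ _] := Gam_itv Gy; have [/andP[_ z1] _ _ _ _] := Gam_itv Gz.
have h1 := vm l lk _ _ (ltW y0); have h2 := vm l lk _ _ (ltW z1).
apply: (@le_trans _ _ (v l 1 - v l 0)); first lra.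
apply: le_trans (vM l lk) _.
rewrite ler_wpM2r ?exprn_ge0//; first lra.
by rewrite ler_pM2l// ler_weXn2l// ltnW.
Qed.

End iterated_contraction.

(** * Null sets and their Lipschitz images *)

Section negligible.
Context {R : realType}.
Implicit Types (A N : set R) (a b x y z L : R).
Local Notation mu := (@lebesgue_measure R).

Lemma negligible_itv_avoid N a b : mu.-negligible N -> a < b ->
  exists2 z : R, a < z < b & ~ N z.
Proof.
move=> [B [mB B0 NB]] ab; apply: contrapT => H.
have sub : `]a, b[%classic `<=` B.
  move=> z /=; rewrite in_itv/= => zi; apply: NB; apply: contrapT => Nz.
  by apply: H; exists z.
have : (mu `]a, b[%classic <= mu B)%E by apply: le_measure; rewrite ?inE.
rewrite B0 lebesgue_measure_itv/= lte_fin ab -EFinB lee_fin subr_le0.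
by rewrite leNgt ab.
Qed.

(** Cover [N] by open intervals of total length below [e / (2 * L)]: the part of [[a, b]] in an
    interval of length [l] is mapped into a segment of length [2 * L * l] centred at the image of
    one of its points. *)
Lemma lipschitz_negligible (g : R -> R) N a b L : 0 < L ->
  (forall x y, a <= x <= b -> a <= y <= b -> `|g y - g x| <= L * `|y - x|) ->
  mu.-negligible N -> mu.-negligible (g @` (N `&` [set x | a <= x <= b])).
Proof.
move=> L0 gL /negligible_outer_measure N0; apply/negligible_outer_measure.
apply/eqP; rewrite eq_le outer_measure_ge0 andbT.
apply/lee_addgt0Pr => e e0; rewrite add0e.
have eL : 0 < e / (2 * L) by rewrite divr_gt0// mulr_gt0.
have [F [Fo NF] Fe] : exists2 F, open_itv_cover N F &
    (\sum_(0 <= i <oo) (@wlength R idfun) (F i) < (e / (2 * L))%:E)%E.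
  have fN : ((@wlength R idfun)^* N)%mu \is a fin_num by rewrite N0.
  move: fN; rewrite outer_measure_open_itv_cover => /lb_ereal_inf_adherent-/(_ _ eL)[_ [F NF <-]].
  by rewrite -outer_measure_open_itv_cover N0 add0e => h; exists F.
have sub : g @` (N `&` [set x | a <= x <= b]) `<=`
    \bigcup_i (g @` (F i `&` [set x | a <= x <= b])).
  by move=> _ [x [Nx xi] <-]; have [i _ Fx] := NF _ Nx; exists i => //; exists x.
apply: (@le_trans _ _ (\sum_(0 <= i <oo) (2 * L)%:E * (@wlength R idfun) (F i))%E); last first.
  rewrite nneseriesZl; last by move=> i _; exact: wlength_ge0.
  apply: (@le_trans _ _ ((2 * L)%:E * (e / (2 * L))%:E)%E).
    by rewrite lee_pmul2l ?lte_fin ?mulr_gt0// ltW.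
  by rewrite -EFinM lee_fin mulrC divfK// gt_eqF// mulr_gt0.
apply: (@le_trans _ _ ((@wlength R idfun)^* (\bigcup_i (g @` (F i `&` [set x | a <= x <= b])))%classic)%mu).
  exact: le_outer_measure.
apply: le_trans (outer_measure_sigma_subadditive _ _) _.
apply: lee_nneseries => // i _.
have [[u v]/= Fi] := Fo i; rewrite Fi.
pose S := `]u, v[%classic `&` [set x | a <= x <= b].
rewrite -/S; have [[t [/= tuv tab]]|/nonemptyPn ->] := pselect (S !=set0); last first.
  rewrite image_set0 outer_measure0; apply: mule_ge0; first by rewrite lee_fin mulr_ge0// ltW.
  exact: wlength_ge0.
rewrite in_itv/= in tuv; have /andP[ut tv] := tuv.
apply: (@le_trans _ _ (mu `[g t - L * (v - u), g t + L * (v - u)]%classic)).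
  apply: le_outer_measure => _ [x [/= + xab] <-]; rewrite !in_itv/= => /andP[ux xv].
  have := gL _ _ tab xab; have : L * `|x - t| <= L * (v - u).
    by rewrite ler_pM2l// ler_norml; apply/andP; split; clra.
  by move=> h1 h2; have := le_trans h2 h1; rewrite ler_norml => /andP[? ?]; apply/andP; split; clra.
rewrite lebesgue_measure_itv/= wlength_itv/= lte_fin.
have uv : u < v by clra.
rewrite lte_fin uv; case: ifP => _.
  by rewrite -!EFinB -EFinM lee_fin; clra.
by apply: mule_ge0; rewrite lee_fin ?mulr_ge0//; clra.
Qed.

End negligible.

Section inverse_branch_derivatives.
Context {R : realType}.
Implicit Types (p q s lam L x y : R) (f g : R -> R).

Lemma branch_inv_locally_constant p q f s lam L x :
  monotone_branch p q f s lam L -> x <> f p -> x <> f q -> ~ in_image p q f x ->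
  exists2 d : R, 0 < d &
    forall y, `|y - x| < d -> branch_inv p q f s y = branch_inv p q f s x.
Proof.
move=> Hb xp xq nJx; have [pq l0 Hs H] := Hb.
have [d d0 hd] := in_image_near Hb xp xq.
have [h _] := H p q (lexx _) (ltW pq) (lexx _).
have h0 : 0 < lam * (q - p) by rewrite mulr_gt0// subr_gt0.
exists (Num.min d (Num.min `|x - f p| `|x - f q|)).
  have /eqP xp' := xp; have /eqP xq' := xq.
  by rewrite !lt_min d0 !normr_gt0 !subr_eq0 xp' xq'.
move=> y; rewrite !lt_min => /and3P[/hd yJ yp yq].
have nJy : ~ in_image p q f y by move/yJ.
have aux a z : s * z < s * a -> `|y - z| < `|z - a| -> s * y < s * a.
  case: Hs => ->; rewrite ?mul1r ?mulN1r ?ltrN2 => za.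
    by rewrite (ltr0_norm (_ : z - a < 0)) ?subr_lt0// ltr_norml => /andP[? ?]; clra.
  by rewrite (gtr0_norm (_ : 0 < z - a)) ?subr_gt0// ltr_norml => /andP[? ?]; clra.
have aux' a z : s * a < s * z -> `|y - z| < `|z - a| -> s * a < s * y.
  case: Hs => ->; rewrite ?mul1r ?mulN1r ?ltrN2 => za.
    by rewrite (gtr0_norm (_ : 0 < z - a)) ?subr_gt0// ltr_norml => /andP[? ?]; clra.
  by rewrite (ltr0_norm (_ : z - a < 0)) ?subr_lt0// ltr_norml => /andP[? ?]; clra.
case: (branch_inv_trichotomy Hb x) => [[hx ->]|//|[hx ->]];
  case: (branch_inv_trichotomy Hb y) => [[hy ->]|//|[hy ->]] //.
  by have := aux _ _ hx yp; clra.
by have := aux' _ _ hx yq; clra.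
Qed.

(** Unlike [pushed], the composition is not cut off outside the image; but there the extended
    inverse is locally constant, so the derivative is 0 all the same. *)
Lemma branch_inv_comp_is_derive p q f s lam L (g g' f' : R -> R) x :
  monotone_branch p q f s lam L -> x <> f p -> x <> f q ->
  (in_image p q f x -> is_derive (branch_inv p q f s x) 1 g (g' (branch_inv p q f s x)) /\
     is_derive (branch_inv p q f s x) 1 f (f' (branch_inv p q f s x))) ->
  is_derive x 1 (fun y => g (branch_inv p q f s y))
    (pushed p q f s (fun y => g' y / f' y) x).
Proof.
move=> Hb xp xq dg; case: (pselect (in_image p q f x)) => Jx.
  have [d d0 hd] := in_image_near Hb xp xq.
  apply: (is_derive_local d0 _ (pushed_is_derive Hb xp xq dg)) => y /hd yJ.
  by rewrite pushedE//; apply/yJ.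
have [d d0 hd] := branch_inv_locally_constant Hb xp xq Jx.
rewrite [X in is_derive _ _ _ X]pushed_out//.
apply: (is_derive_local (F := cst (g (branch_inv p q f s x))) d0).
by move=> y /hd ->.
Qed.

Lemma is_derive_unique (F : R -> R) x a b :
  is_derive x 1 F a -> is_derive x 1 F b -> a = b.
Proof. by move=> /is_derive_derive1 <- /is_derive_derive1. Qed.

(** The two functions agree at [x] and at points accumulating at [x] from the right; difference
    quotients along these points determine both derivatives. *)
Lemma is_derive_unique_dense (F H : R -> R) (E : set R) x a b :
  is_derive x 1 F a -> is_derive x 1 H b -> F x = H x ->
  (forall d, 0 < d -> exists2 y, E y & x < y < x + d) ->
  (forall y, E y -> F y = H y) -> a = b.
Proof.
move=> /is_derive_epsP dF /is_derive_epsP dH FHx Ed FH.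
apply/eqP; rewrite -subr_eq0; apply/negPn/negP => ab.
have e0 : 0 < `|a - b| / 4 by rewrite divr_gt0// normr_gt0.
have [d1 d10 h1] := dF _ e0; have [d2 d20 h2] := dH _ e0.
have [y Ey /andP[xy yd]] := Ed (Num.min d1 d2) ltac:(by rewrite lt_min d10).
have yx0 : 0 < y - x by rewrite subr_gt0.
have ymin : y - x < Num.min d1 d2 by clra.
have /andP[y1 y2] : (y - x < d1) && (y - x < d2) by rewrite -lt_min.
have := h1 y; have := h2 y; rewrite (gtr0_norm yx0) => /(_ y2) k2 /(_ y1) k1.
have : `|(a - b) * (y - x)| <= `|a - b| / 4 * (y - x) + `|a - b| / 4 * (y - x).
  have -> : (a - b) * (y - x) = (H y - H x - b * (y - x)) - (F y - F x - a * (y - x)).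
    by rewrite (FH y Ey) FHx; ring.
  by apply: le_trans (ler_normB _ _) _; exact: lerD.
rewrite normrM (gtr0_norm yx0) -mulrDl ler_pM2r//.
by rewrite leNgt; clra.
Qed.

End inverse_branch_derivatives.

Lemma countable_negligible {R : realType} (A : set R) : countable A ->
  (@lebesgue_measure R).-negligible A.
Proof.
move=> cA; exists A; split => //; last exact: countable_lebesgue_measure0.
by apply: countable_measurable => // x; exact: measurable_set1.
Qed.

(** * The fixed point equations for the successive derivatives *)

Section functional_equation.
Context {R : realType}.
Variables (f : R -> R) (c s0 s1 lam L : R) (k : nat).
Variables (rho : nat -> R -> R) (P0 : R -> R) (K0 : R) (Gam : set R).
Implicit Types (x y z : R).

Local Notation df := (derive1 f).
Local Notation U := [set y | 0 < y < c \/ c < y < 1].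
Local Notation psi0 := (branch_inv 0 c f s0).
Local Notation psi1 := (branch_inv c 1 f s1).

Hypothesis Hf : expanding_unimodal f c s0 s1 lam L.
Hypothesis fU : smooth_on k.+1 U f.
Hypothesis flam : forall y, U y -> lam <= `|df y|.
Hypothesis absf : smooth_on k U (fun y => `|df y|^-1).
Hypothesis sgn0 : forall y, 0 < y < c -> 0 < s0 * df y.
Hypothesis sgn1 : forall y, c < y < 1 -> 0 < s1 * df y.
Hypothesis Gam_itv : forall x, Gam x ->
  [/\ 0 < x < 1, x <> c, x <> f 0, x <> f c & x <> f 1].
Hypothesis Gam_preim : forall x y, Gam x -> 0 <= y <= 1 -> f y = x -> Gam y.
Hypothesis Gam_count : countable ([set x | 0 <= x <= 1] `\` Gam).
Hypothesis Gam_cont : forall l x, (l <= k)%N -> Gam x -> {for x, continuous (rho l)}.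
Hypothesis P0_deriv : forall x, Gam x -> is_derive x 1 P0 (rho 0%N x).
Hypothesis P0_eq : forall x, 0 < x < 1 ->
  P0 x = K0 + (s0 * P0 (psi0 x) + s1 * P0 (psi1 x)).
Hypothesis rho_ae : forall j, (j < k)%N -> (@lebesgue_measure R).-negligible
  [set x : R | 0 < x < 1 /\ ~ is_derive x 1 (rho j) (rho j.+1 x)].

Lemma Gam_dense a b : 0 <= a -> a < b -> b <= 1 -> exists2 z, a < z < b & Gam z.
Proof.
move=> a0 ab b1; apply: contrapT => H; apply: (uncountable_itvoo ab).
apply: sub_countable Gam_count; apply: subset_card_le => z /=.
rewrite in_itv/= => /andP[az zb]; split; first by apply/andP; split; lra.
by move=> Gz; apply: H; exists z => //; rewrite az.
Qed.

Let oU : open U. Proof. exact: unimodal_open. Qed.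
Let lam1 : 1 < lam. Proof. by case: Hf. Qed.

Let df_is_derive y : U y -> is_derive y 1 f (df y).
Proof. by move=> Uy; apply: derive1_is_derive; exact: fU.2.1. Qed.

Let Gam0 x : Gam x -> in_image 0 c f x -> Gam (psi0 x) /\ 0 < psi0 x < c.
Proof.
move=> Gx Jx; have [/andP[c0 c1] _ _ B0 _] := Hf.
have [/andP[x0 x1] _ xf0 xfc _] := Gam_itv Gx; split.
  apply: Gam_preim Gx _ (branch_invK s0 Jx).
  by have /andP[? ?] := branch_inv_itv B0 x; apply/andP; split; lra.
exact: (interior_branch_inv B0).
Qed.

Let Gam1 x : Gam x -> in_image c 1 f x -> Gam (psi1 x) /\ c < psi1 x < 1.
Proof.
move=> Gx Jx; have [/andP[c0 c1] _ _ _ B1] := Hf.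
have [/andP[x0 x1] _ _ xfc xf1] := Gam_itv Gx; split.
  apply: Gam_preim Gx _ (branch_invK s1 Jx).
  by have /andP[? ?] := branch_inv_itv B1 x; apply/andP; split; lra.
exact: (interior_branch_inv B1).
Qed.

(** This is the derivative of the equation for the primitive; the sign of each branch turns [1 / df]
    into [1 / |df|]. *)
Lemma invariance_equation0 x : Gam x ->
  rho 0%N x = pushed 0 c f s0 (coef_comb f rho 0) x + pushed c 1 f s1 (coef_comb f rho 0) x.
Proof.
move=> Gx; have [/andP[c0 c1] _ _ B0 B1] := Hf.
have [/andP[x0 x1] _ xf0 xfc xf1] := Gam_itv Gx.
have d0 : is_derive x 1 (fun y => P0 (psi0 y))
    (pushed 0 c f s0 (fun y => rho 0%N y / df y) x).
  apply: (branch_inv_comp_is_derive B0) => // Jx; have [G0 i0] := Gam0 Gx Jx.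
  by split; [exact: P0_deriv|apply: df_is_derive; left].
have d1 : is_derive x 1 (fun y => P0 (psi1 y))
    (pushed c 1 f s1 (fun y => rho 0%N y / df y) x).
  apply: (branch_inv_comp_is_derive B1) => // Jx; have [G1 i1] := Gam1 Gx Jx.
  by split; [exact: P0_deriv|apply: df_is_derive; right].
have e0 : s0 * pushed 0 c f s0 (fun y => rho 0%N y / df y) x =
    pushed 0 c f s0 (coef_comb f rho 0) x.
  case: (pselect (in_image 0 c f x)) => Jx; last by rewrite !pushed_out// mulr0.
  have [_ i0] := Gam0 Gx Jx; have [_ _ Hs _] := B0; have := sgn0 i0.
  rewrite !pushedE// /coef_comb big_ord_recl big_ord0 addr0/=.
  case: Hs => sE; subst s0; rewrite ?mul1r ?mulN1r => h.
    by rewrite (gtr0_norm h) mulrC.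
  by rewrite (ltr0_norm (_ : df _ < 0)) -?oppr_gt0// invrN mulNr mulrC.
have e1 : s1 * pushed c 1 f s1 (fun y => rho 0%N y / df y) x =
    pushed c 1 f s1 (coef_comb f rho 0) x.
  case: (pselect (in_image c 1 f x)) => Jx; last by rewrite !pushed_out// mulr0.
  have [_ i1] := Gam1 Gx Jx; have [_ _ Hs _] := B1; have := sgn1 i1.
  rewrite !pushedE// /coef_comb big_ord_recl big_ord0 addr0/=.
  case: Hs => sE; subst s1; rewrite ?mul1r ?mulN1r => h.
    by rewrite (gtr0_norm h) mulrC.
  by rewrite (ltr0_norm (_ : df _ < 0)) -?oppr_gt0// invrN mulNr mulrC.
apply: (is_derive_unique (P0_deriv Gx)); rewrite -e0 -e1.
have d : is_derive x 1 (fun y => K0 + (s0 * P0 (psi0 y) + s1 * P0 (psi1 y)))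
    (0 + (s0 * pushed 0 c f s0 (fun y => rho 0%N y / df y) x +
          s1 * pushed c 1 f s1 (fun y => rho 0%N y / df y) x)).
  exact: is_deriveD.
move: d; rewrite add0r; apply: (@is_derive_local _ _ _ _ _ (Num.min x (1 - x))).
  by rewrite lt_min x0 subr_gt0.
move=> y; rewrite lt_min !ltr_norml => /andP[/andP[? ?] /andP[? ?]].
by rewrite -P0_eq//; apply/andP; split; lra.
Qed.

Lemma coef_comb_continuous j y : (j <= k)%N -> Gam y ->
  {for y, continuous (coef_comb f rho j)}.
Proof.
move=> jk Gy; apply: (@continuous_sum _ _ (fun l y => coef f j l y * rho l y)) => l lj.
have [/andP[y0 y1] /eqP yc _ _ _] := Gam_itv Gy.
have Uy : U y.
  by move: yc; rewrite neq_lt => /orP[?|?]; [left|right]; apply/andP.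
apply: cvgM; last by apply: Gam_cont => //; apply: leq_trans jk; rewrite -ltnS.
exact: (smooth_on_bounded_continuous (coef_smooth oU lam1 fU flam absf l jk)).2.
Qed.

Lemma coef_comb_is_derive j y : (j < k)%N -> Gam y ->
  (forall l, (l < k)%N -> is_derive y 1 (rho l) (rho l.+1 y)) ->
  is_derive y 1 (coef_comb f rho j)
    (\sum_(l < j.+1) (derive1 (coef f j l) y * rho l y + coef f j l y * rho l.+1 y)).
Proof.
move=> jk Gy dr; apply: (@is_derive_sum_fun _ _ (fun l y => coef f j l y * rho l y)
  (fun l y => derive1 (coef f j l) y * rho l y + coef f j l y * rho l.+1 y)) => l lj.
have [/andP[y0 y1] /eqP yc _ _ _] := Gam_itv Gy.
have Uy : U y.
  by move: yc; rewrite neq_lt => /orP[?|?]; [left|right]; apply/andP.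
have -> : derive1 (coef f j l) y * rho l y + coef f j l y * rho l.+1 y =
  coef f j l y * rho l.+1 y + rho l y * derive1 (coef f j l) y by ring.
apply: is_deriveM; last by apply: dr; exact: leq_trans lj jk.
exact: (coef_is_derive Hf fU flam absf).
Qed.

(** Induction on [j] by differentiation, which is licit only almost everywhere. The defect [h] of
    the next equation is continuous at [x], so a nonzero value would persist nearby; yet every
    interval contains a point of [Gam] at which, and at whose preimages, all the [rho l] with
    [l < k] are differentiable, and there the defect is 0. *)
Lemma invariance_equation j x : (j <= k)%N -> Gam x ->
  rho j x = pushed 0 c f s0 (coef_comb f rho j) x + pushed c 1 f s1 (coef_comb f rho j) x.
Proof.
have [/andP[c0 c1] f01 _ B0 B1] := Hf.
elim: j x => [|j IH] x jk Gx; first exact: invariance_equation0.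
have [/andP[x0 x1] xc xf0 xfc xf1] := Gam_itv Gx.
pose T u y := pushed 0 c f s0 u y + pushed c 1 f s1 u y.
pose h y := rho j.+1 y - T (coef_comb f rho j.+1) y.
apply/eqP; rewrite -subr_eq0 -/(T _ x) -/(h x); apply/negPn/negP => hx.
have ch : {for x, continuous h}.
  apply: cvgB; first exact: Gam_cont.
  apply: cvgD; [apply: (pushed_continuous B0)|apply: (pushed_continuous B1)] => // Jx;
    apply: coef_comb_continuous => //.
    exact: (Gam0 Gx Jx).1.
  exact: (Gam1 Gx Jx).1.
have hx0 : 0 < `|h x| by rewrite normr_gt0.
have /continuous_epsP/(_ _ hx0)[d d0 hd] := ch.
pose N1 := [set y : R | exists2 l, (l < k)%N & 0 < y < 1 /\ ~ is_derive y 1 (rho l) (rho l.+1 y)].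
have N1n : (@lebesgue_measure R).-negligible N1.
  have sub : N1 `<=` \bigcup_l (if (l < k)%N then
    [set y : R | 0 < y < 1 /\ ~ is_derive y 1 (rho l) (rho l.+1 y)] else set0).
    by move=> y [l lk Hy]; exists l => //; rewrite lk.
  apply: (@negligibleS _ _ _ (@lebesgue_measure R) _ _ sub).
  apply: negligible_bigcup => l; case: ifP => lk; last exact: negligible_set0.
  exact: rho_ae.
have [_ L0 _ _] := B0.
have L0' : 0 < L + 1.
  have [_ l0 _ H] := B0; have [h1 h2] := H 0 c (lexx _) (ltW c0) (lexx _).
  have : 0 < L * (c - 0).
    by apply: lt_le_trans (le_trans h1 h2); rewrite mulr_gt0 ?subr_gt0.
  by rewrite pmulr_lgt0 ?subr_gt0// => ?; rewrite addr_gt0.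
have lipb (p q s : R) : monotone_branch p q f s lam L ->
    forall y z, p <= y <= q -> p <= z <= q -> `|f z - f y| <= (L + 1) * `|z - y|.
  move=> Hb y z yi zi; have [_ h1] := branch_lipschitz Hb yi zi; apply: le_trans h1 _.
  by rewrite ler_wpM2r// lerDl.
(* Points with a bad preimage lie in the image of a null set under a Lipschitz branch. *)
have N2n := negligibleU (lipschitz_negligible L0' (lipb _ _ _ B0) N1n)
  (lipschitz_negligible L0' (lipb _ _ _ B1) N1n).
have ab : Num.max 0 (x - d) < Num.min 1 (x + d).
  by rewrite gt_max !lt_min; apply/andP; split; apply/andP; split; lra.
have [z] := negligible_itv_avoid (negligibleU (negligibleU N1n N2n)
  (countable_negligible Gam_count)) ab.
rewrite gt_max lt_min => /andP[/andP[z0 xz] /andP[z1 zx]] Nz.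
have Gz : Gam z.
  apply: contrapT => nG; apply: Nz; right; split => //=.
  by apply/andP; split; lra.
have dz l : (l < k)%N -> is_derive z 1 (rho l) (rho l.+1 z).
  move=> lk; apply: contrapT => nd; apply: Nz; left; left; exists l => //.
  by rewrite z0 z1.
have dy0 (Jz : in_image 0 c f z) l : (l < k)%N -> is_derive (psi0 z) 1 (rho l) (rho l.+1 (psi0 z)).
  move=> lk; apply: contrapT => nd; apply: Nz; left; right; left.
  have [_ /andP[i1 i2]] := Gam0 Gz Jz.
  exists (psi0 z); last exact: branch_invK.
  split; last by rewrite /= !ltW.
  by exists l => //; split => //; apply/andP; split; lra.
have dy1 (Jz : in_image c 1 f z) l : (l < k)%N -> is_derive (psi1 z) 1 (rho l) (rho l.+1 (psi1 z)).
  move=> lk; apply: contrapT => nd; apply: Nz; left; right; right.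
  have [_ /andP[i1 i2]] := Gam1 Gz Jz.
  exists (psi1 z); last exact: branch_invK.
  split; last by rewrite /= !ltW.
  by exists l => //; split => //; apply/andP; split; lra.
have [_ _ zf0 zfc zf1] := Gam_itv Gz.
have hz : h z = 0.
  apply/eqP; rewrite subr_eq0; apply/eqP.
  pose D y := (\sum_(l < j.+1) (derive1 (coef f j l) y * rho l y +
    coef f j l y * rho l.+1 y)).
  have eD (p q s : R) : pushed p q f s (coef_comb f rho j.+1) z =
      pushed p q f s (fun y => D y / df y) z.
    by apply: eq_pushed => y; rewrite /D coef_recursion.
  have dT : is_derive z 1 (T (coef_comb f rho j)) (T (coef_comb f rho j.+1) z).
    rewrite /T !eD; apply: is_deriveD.
      apply: (pushed_is_derive B0) => // Jz; have [G0 i0] := Gam0 Gz Jz.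
      split; last by apply: df_is_derive; left.
      by apply: coef_comb_is_derive => // l; exact: dy0.
    apply: (pushed_is_derive B1) => // Jz; have [G1 i1] := Gam1 Gz Jz.
    split; last by apply: df_is_derive; right.
    by apply: coef_comb_is_derive => // l; exact: dy1.
  (* The equation for [j] is known on [Gam] only, so the two derivatives at [z] are compared along
     this dense set. *)
  apply: (is_derive_unique_dense (E := Gam) (dz j jk) dT).
  - exact: IH (ltnW jk) Gz.
  - move=> e e0; have [|||y /andP[zy ye] Gy] := @Gam_dense z (Num.min 1 (z + e)).
    + exact: ltW.
    + by rewrite lt_min z1 ltrDl.
    + by rewrite ge_min lexx.
    + by exists y => //; rewrite zy (lt_le_trans ye)// ge_min lexx orbT.
  - by move=> y Gy; exact: IH (ltnW jk) Gy.
have := hd z; rewrite hz sub0r normrN ltxx => h'; have // : false.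
by apply: h'; rewrite ltr_norml; apply/andP; split; lra.
Qed.

End functional_equation.

(** * Hausdorff dimension *)

Section hausdorff.
Context {R : realType}.
Implicit Types (A E : set R) (x t r q e : R).

Lemma geometric_lt q e : 0 <= q < 1 -> 0 < e ->
  exists n0, forall n, (n0 <= n)%N -> q ^+ n < e.
Proof.
move=> /andP[q0 q1] e0.
have /cvg_expr/cvgrPdist_lt/(_ e e0)[n0 _ h] : `|q| < 1 by rewrite ger0_norm.
exists n0 => n n0n; have := h n n0n.
by rewrite sub0r normrN ger0_norm// exprn_ge0.
Qed.

Lemma geometric_sum_le q n : 0 <= q < 1 ->
  \sum_(0 <= i < n) q ^+ i <= (1 - q)^-1.
Proof.
move=> /andP[q0 q1]; have q10 : 0 < 1 - q by rewrite subr_gt0.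
rewrite -[leRHS]mul1r ler_pdivlMr//.
have -> : (\sum_(0 <= i < n) q ^+ i) * (1 - q) = 1 - q ^+ n.
  elim: n => [|n IH]; first by rewrite big_geq// mul0r expr0 subrr.
  by rewrite big_nat_recr//= mulrDl IH exprS; ring.
by rewrite lerBlDr lerDl exprn_ge0.
Qed.

(** The 2-adic valuation takes every value infinitely often, so indexing by it lists each point
    infinitely often. A limsup of balls centred at the listed points then contains all of [E]. *)
Lemma countable_enumeration E : countable E ->
  exists z : nat -> R, forall x, E x -> forall n, exists2 i, (n <= i)%N & z i = x.
Proof.
move=> /countable_injP[g ginj].
exists (fun i => xget 0 [set x | E x /\ g x = logn 2 i]) => x Ex n.
(* The odd cofactor keeps the valuation equal to [g x] and makes the index at least [n]. *)
exists (2 ^ g x * n.*2.+1)%N.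
  have : (0 < 2 ^ g x)%N by rewrite expn_gt0.
  by rewrite -addnn; nia.
have e : logn 2 (2 ^ g x * n.*2.+1) = g x.
  rewrite lognM ?expn_gt0// pfactorK// logn_coprime ?addn0//.
  by rewrite coprime2n/= odd_double.
rewrite e; case: xgetP => [y _ [Ey gy]|/(_ x)]; last by case.
by apply: ginj; rewrite ?inE.
Qed.

Lemma diam_ge0 A : (0 <= diam A)%E.
Proof. by rewrite /diam le_max lexx. Qed.

Lemma diam_le A e : 0 <= e -> (forall x y, A x -> A y -> `|x - y| <= e) ->
  (diam A <= e%:E)%E.
Proof.
move=> e0 H; rewrite /diam ge_max lee_fin e0/=.
by apply: ge_ereal_sup => _ [x Ax [y Ay <-]]; rewrite lee_fin H.
Qed.

Lemma hausdorff_dim_eq0 A :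
  (forall t, 0 < t -> hausdorff_measure t A = 0%E) -> hausdorff_dim A = 0%E.
Proof.
move=> H; apply/eqP; rewrite eq_le; apply/andP; split.
  apply/lee_addgt0Pr => e e0; rewrite add0e.
  by apply: ereal_inf_lbound; exists e => //; split => //; exact: H.
by apply: le_ereal_inf_tmp => _ [t [t0 _] <-]; rewrite lee_fin ltW.
Qed.

Lemma hausdorff_measure_eq0 t A :
  (forall d e, 0 < d -> 0 < e -> exists U : nat -> set R,
    [/\ A `<=` \bigcup_i U i, forall i, (diam (U i) <= d%:E)%E &
     (\sum_(0 <= i <oo) (diam (U i) `^ t) <= e%:E)%E]) ->
  hausdorff_measure t A = 0%E.
Proof.
move=> H; have pre0 d : 0 < d -> hausdorff_premeasure t d A = 0%E.
  move=> d0; apply/eqP; rewrite eq_le; apply/andP; split.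
    apply/lee_addgt0Pr => e e0; rewrite add0e.
    have [U [AU Ud Ue]] := H d e d0 e0.
    by apply: le_trans Ue; apply: ereal_inf_lbound; exists U.
  apply: le_ereal_inf_tmp => _ [U [AU Ud] <-].
  by apply: nneseries_ge0 => i _ _; exact: poweR_ge0.
apply/eqP; rewrite eq_le; apply/andP; split.
  by apply: ge_ereal_sup => _ [d d0 <-]; rewrite pre0.
by apply: ereal_sup_ubound; exists 1 => //=; rewrite pre0.
Qed.

Definition limsup_balls (z : nat -> R) r :=
  [set x | forall n, exists2 i, (n <= i)%N & `|x - z i| < r ^+ i].

(** For each [t > 0] the costs [(2 * r ^ i) ^ t] form a geometric series of ratio [r ^ t < 1], whose
    tails give covers of arbitrarily small cost. *)
Lemma limsup_balls_dim0 (z : nat -> R) r A : 0 < r < 1 ->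
  A `<=` limsup_balls z r -> hausdorff_dim A = 0%E.
Proof.
move=> /andP[r0 r1] Az; apply: hausdorff_dim_eq0 => t t0.
apply: hausdorff_measure_eq0 => d e d0 e0.
pose q := r `^ t.
have q0 : 0 < q by exact: powR_gt0.
have q1 : q < 1.
  have <- : 1 `^ t = 1 :> R by rewrite powR1.
  by apply: gt0_ltr_powR; rewrite ?nnegrE ?ler01// ltW.
have rX n : (r ^+ n) `^ t = q ^+ n.
  elim: n => [|n IH]; first by rewrite !expr0 powR1.
  by rewrite !exprS powRM ?IH ?exprn_ge0// ltW.
have qi : 0 <= q < 1 by rewrite ltW.
have ri : 0 <= r < 1 by rewrite ltW.
have [n1 h1] := @geometric_lt r (d / 2) ri ltac:(by rewrite divr_gt0).
have q10 : 0 < 1 - q by rewrite subr_gt0.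
have p2 : 0 < 2 `^ t :> R by apply: powR_gt0.
have [n2 h2] := @geometric_lt q (e * (1 - q) / 2 `^ t) qi
  ltac:(by rewrite divr_gt0// mulr_gt0).
(* [n1] makes the diameters at most [d]; [n2] makes the geometric tail, bounded by
   [2 ^ t * q ^ n / (1 - q)], at most [e]. *)
pose n := maxn n1 n2.
have {}h1 := h1 n (leq_maxl _ _); have {}h2 := h2 n (leq_maxr _ _).
pose U i := [set x | `|x - z (n + i)%N| < r ^+ (n + i)].
have dU i : (diam (U i) <= (2 * r ^+ n * r ^+ i)%:E)%E.
  apply: diam_le => [|x y Ux Uy]; first by rewrite !mulr_ge0// exprn_ge0// ltW.
  have -> : x - y = (x - z (n + i)%N) - (y - z (n + i)%N) by ring.
  apply: le_trans (ler_normB _ _) _; rewrite -mulrA -exprD mulr_natl mulr2n.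
  by apply: lerD; exact: ltW.
exists U; split.
- move=> x /Az/(_ n)[i ni xi]; exists (i - n)%N => //=.
  by rewrite /U/= subnKC.
- move=> i; apply: le_trans (dU i) _; rewrite lee_fin.
  apply: (@le_trans _ _ (2 * r ^+ n * 1)); last by rewrite mulr1; clra.
  by rewrite ler_wpM2l ?mulr_ge0 ?exprn_ge0 ?exprn_ile1// ltW.
- apply: lime_le.
    by apply: is_cvg_nneseries => i _ _; exact: poweR_ge0.
  apply: nearW => N.
  apply: (@le_trans _ _ (\sum_(0 <= i < N) (2 `^ t * q ^+ n * q ^+ i)%:E)%E).
    apply: lee_sum => i _.
    apply: (@le_trans _ _ ((2 * r ^+ n * r ^+ i)%:E `^ t)%E).
      apply: (gt0_ler_poweR (ltW t0)); last exact: dU.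
        by rewrite in_itv/= leey andbT diam_ge0.
      by rewrite in_itv/= leey andbT (le_trans (diam_ge0 _) (dU i)).
    by rewrite poweR_EFin lee_fin !powRM ?rX ?mulr_ge0 ?exprn_ge0 ?(ltW r0).
  rewrite sumEFin lee_fin -mulr_sumr.
  apply: (@le_trans _ _ (2 `^ t * q ^+ n * (1 - q)^-1)).
    rewrite ler_wpM2l ?geometric_sum_le// mulr_ge0// ?exprn_ge0 ?ltW//.
  by rewrite ler_pdivrMr// mulrC -ler_pdivlMr// ltW.
Qed.

End hausdorff.

(** * Taylor expansions by repeated integration *)

Lemma is_derive_power (R : realType) (a y : R) m :
  is_derive y 1 (fun y => (y - a) ^+ m.+1) (m.+1%:R * (y - a) ^+ m).
Proof.
have d1 : is_derive y 1 (fun y => y - a) 1.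
  have := is_deriveB (is_derive_id y 1) (is_derive_cst a y 1).
  by rewrite subr0.
elim: m => [|m IH].
  by rewrite expr0 mulr1; apply: (is_derive_ext openT _ _ d1).
have -> : m.+2%:R * (y - a) ^+ m.+1 =
  (y - a) * (m.+1%:R * (y - a) ^+ m) + (y - a) ^+ m.+1 * 1.
  by rewrite -[m.+2]addn1 natrD exprS; ring.
have -> : (fun y => (y - a) ^+ m.+2) = (fun y => (y - a) * (y - a) ^+ m.+1).
  by apply/funext => z; rewrite exprS.
exact: is_deriveM.
Qed.

Section taylor.
Context {R : realType}.
Variables (k : nat) (rho Pr : nat -> R -> R) (Gam : set R) (a : R).
Implicit Types (x y e d : R).

Local Notation G := (fun l y => rho l y - Pr l.+1 y).

Hypothesis Ga : Gam a.
Hypothesis Gam01 : forall x, Gam x -> 0 < x < 1.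
Hypothesis Gam_count : countable ([set x | 0 <= x <= 1] `\` Gam).
Hypothesis rho_cont : {for a, continuous (rho k)}.
Hypothesis Pr_deriv : forall l x, (l <= k)%N -> Gam x -> is_derive x 1 (Pr l) (rho l x).
Hypothesis Pr_cont : forall l x, (l <= k)%N -> 0 < x < 1 -> {for x, continuous (Pr l)}.
Hypothesis G_small : forall l e, (l < k)%N -> 0 < e -> exists2 d : R, 0 < d &
  forall y, Gam y -> `|y - a| < d -> `|G l y - G l a| <= e * `|y - a| ^+ k.

(** The polynomial of degree [i] belongs to [rho (k - i)], so that the induction on [i] starts from
    the top function [rho k]. *)
Definition taylor_poly (i : nat) y :=
  \sum_(m < i.+1) rho (k - i + m)%N a / (m`!)%:R * (y - a) ^+ m.

Lemma taylor_expansion i : (i <= k)%N -> forall e, 0 < e ->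
  exists2 d : R, 0 < d & forall y, Gam y -> `|y - a| < d ->
    `|rho (k - i)%N y - taylor_poly i y| <= e * `|y - a| ^+ i.
Proof.
elim: i => [|i IH] ik e e0.
  have /continuous_epsP/(_ e e0)[d d0 hd] := rho_cont.
  exists d => // y Gy yd; rewrite /taylor_poly big_ord_recl big_ord0 addr0 subn0 addn0.
  by rewrite fact0 divr1 !expr0 !mulr1 ltW// hd.
have e20 : 0 < e / 2 by rewrite divr_gt0.
have [d1 d10 h1] := IH (ltnW ik) _ e20.
have jk : (k - i.+1 < k)%N by rewrite ltn_subrL (leq_trans _ ik).
have ej : (k - i.+1).+1 = (k - i)%N by rewrite -subSn// subSS.
have [d2 d20 h2] := G_small jk e20.
(* When [|y - a| < 1], the error [|y - a| ^ k] of the singular part is at most [|y - a| ^ i.+1]. *)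
exists (Num.min 1 (Num.min d1 d2)); first by rewrite !lt_min ltr01 d10.
move=> y Gy; rewrite !lt_min => /and3P[ya1 yd1 yd2].
(* The primitive minus the integrated polynomial. On [Gam] its derivative is the remainder of the
   previous order, so the mean value inequality gains one power of [|y - a|]. *)
pose A x := Pr (k - i)%N x -
  \sum_(m < i.+1) rho (k - i + m)%N a / (m.+1`!)%:R * (x - a) ^+ m.+1.
have dA x : Gam x -> is_derive x 1 A (rho (k - i)%N x - taylor_poly i x).
  move=> Gx; apply: is_deriveB; first by apply: Pr_deriv => //; exact: leq_subr.
  apply: (@is_derive_sum_fun _ _
    (fun m x => rho (k - i + m)%N a / (m.+1`!)%:R * (x - a) ^+ m.+1)
    (fun m x => rho (k - i + m)%N a / (m`!)%:R * (x - a) ^+ m)) => m _.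
  have -> : rho (k - i + m)%N a / m`!%:R * (x - a) ^+ m =
    rho (k - i + m)%N a / (m.+1`!)%:R * (m.+1%:R * (x - a) ^+ m).
    have : (m`!)%:R != 0 :> R by rewrite pnatr_eq0 -lt0n fact_gt0.
    have : m.+1%:R != 0 :> R by rewrite pnatr_eq0.
    rewrite factS natrM; move: (m.+1%:R) (m`!%:R) => u v u0 v0.
    by field; rewrite u0 v0.
  by apply: is_deriveZ; exact: is_derive_power.
have cA x : 0 < x < 1 -> {for x, continuous A}.
  move=> x01; apply: cvgB; first by apply: Pr_cont => //; exact: leq_subr.
  apply: (@continuous_sum _ _
    (fun m x => rho (k - i + m)%N a / (m.+1`!)%:R * (x - a) ^+ m.+1)) => m _.
  apply: cvgM; first exact: cvg_cst.
  exact: is_derive_continuous (is_derive_power _ _ _).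
have Ay : `|A y - A a| <= e / 2 * `|y - a| ^+ i.+1.
  have bound lo hi : 0 < lo -> hi < 1 -> lo <= hi ->
      (forall x, lo < x < hi -> `|x - a| <= `|y - a|) ->
      `|A hi - A lo| <= e / 2 * `|y - a| ^+ i * (hi - lo).
    move=> lo0 hi1 lohi H; apply: (mean_value_countable_norm lohi Gam_count).
      by move=> x /andP[? ?]; apply: cA; apply/andP; split; lra.
    move=> x xi nGx; have /andP[? ?] := xi.
    have Gx : Gam x.
      by apply: contrapT => nG; apply: nGx; split => //=; apply/andP; split; lra.
    exists (rho (k - i)%N x - taylor_poly i x); first exact: dA.
    have xy := H x xi; apply: le_trans (h1 x Gx (le_lt_trans xy yd1)) _.
    by rewrite ler_wpM2l ?(ltW e20)// lerXn2r ?nnegrE.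
  have /andP[a0 a1] := Gam01 Ga; have /andP[y0 y1] := Gam01 Gy.
  rewrite exprSr mulrA; case: (leP a y) => ay.
    rewrite {2}(ger0_norm (_ : 0 <= y - a)) ?subr_ge0//; apply: bound => // x /andP[? ?].
    by rewrite !ger0_norm; lra.
  rewrite distrC [X in _ <= _ * X](_ : _ = a - y); last first.
    by rewrite ltr0_norm ?subr_lt0// opprB.
  apply: bound => //.
    exact: ltW.
  by move=> x /andP[? ?]; rewrite !ler0_norm; lra.
have GE : rho (k - i.+1)%N y - taylor_poly i.+1 y =
    (G (k - i.+1)%N y - G (k - i.+1)%N a) + (A y - A a).
  have Aa : A a = Pr (k - i)%N a.
    rewrite /A big1 ?subr0// => m _; rewrite subrr expr0n/= mulr0//.
  rewrite Aa /taylor_poly big_ord_recl /= expr0 fact0 divr1 mulr1 addn0 /A ej.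
  have -> : \sum_(m < i.+1) rho (k - i.+1 + bump 0 m)%N a / (bump 0 m)`!%:R * (y - a) ^+ bump 0 m
    = \sum_(m < i.+1) rho (k - i + m)%N a / (m.+1`!)%:R * (y - a) ^+ m.+1.
    by apply: eq_bigr => m _; rewrite /bump/= add1n -ej addSnnS.
  by ring.
rewrite GE; apply: le_trans (ler_normD _ _) _.
have h3 := h2 y Gy yd2.
have h4 : e / 2 * `|y - a| ^+ k <= e / 2 * `|y - a| ^+ i.+1.
  by rewrite ler_wpM2l ?(ltW e20)// ler_wiXn2l// ltW.
have -> : e * `|y - a| ^+ i.+1 = e / 2 * `|y - a| ^+ i.+1 + e / 2 * `|y - a| ^+ i.+1.
  by field.
by apply: lerD => //; exact: le_trans h3 h4.
Qed.

End taylor.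

(** * The primitive of an invariant density *)

Section invariant_density.
Context {R : realType}.
Variables (mu : probability (measurableTypeR R) R) (f rho : R -> R).
Implicit Types (x y a b p q s : R).

Hypothesis mu_rho : density mu rho.
Hypothesis mu_ac : mu `<< @lebesgue_measure R.
Hypothesis rho_bv : bounded_variation 0 1 rho.

Local Notation P x := (\int[lebesgue_measure]_(t in `[0, x]) rho t)%R.

Lemma density_itv a b : 0 <= a -> a <= b -> b <= 1 ->
  mu `[a, b]%classic = (P b - P a)%:E.
Proof.
move=> a0 ab b1; have irho := bounded_variation_integrable rho_bv.
have sub (u v : itv_bound R) : (BLeft 0%R <= u)%O -> (v <= BRight 1%R)%O ->
    (@lebesgue_measure R).-integrable [set` Interval u v] (EFin \o rho).
  by move=> u0 v1; apply: integrableS irho => //; exact: subset_itv.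
have iab : (@lebesgue_measure R).-integrable `[a, b] (EFin \o rho).
  by apply: sub; rewrite ?bnd_simp.
have -> : P b - P a = (\int[lebesgue_measure]_(t in `[a, b]) rho t)%R.
  rewrite Rintegral_itvB ?bnd_simp//; last by apply: sub; rewrite ?bnd_simp.
  by rewrite Rintegral_itv_obnd_cbnd//; apply: sub; rewrite ?bnd_simp.
rewrite mu_rho//; rewrite (_ : `[a, b]%classic `&` `[0, 1]%classic = `[a, b]%classic).
  by rewrite /Rintegral fineK//; exact: integrable_fin_num.
apply/setIidPl => x /=; rewrite !in_itv/= => /andP[? ?].
by apply/andP; split; clra.
Qed.

Lemma density_set1 x : mu [set x] = 0%E.
Proof.
have /null_content_dominatesP h := mu_ac.
by apply: h => //; exact: lebesgue_measure_set1.
Qed.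

Lemma density_total : mu `[0%R, 1%R]%classic = 1%E -> P 1 - P 0 = 1.
Proof. by rewrite density_itv// => -[]. Qed.

Lemma primitive_le a b : 0 <= a -> a <= b -> b <= 1 -> P a <= P b.
Proof.
move=> a0 ab b1; by rewrite -subr_ge0 -lee_fin -density_itv.
Qed.

(** In a monotone branch the set [f <= x] is a segment with one moving end, the inverse image of
    [x]. The clamped inverse keeps the formula valid, with the same constant, when this set is empty
    or the whole branch. *)
Lemma branch_sublevel p q s (lam L : R) : monotone_branch p q f s lam L ->
  0 <= p -> q <= 1 -> exists C : R, forall x,
    measurable [set y : measurableTypeR R | p <= y <= q /\ f y <= x] /\
    mu [set y : measurableTypeR R | p <= y <= q /\ f y <= x] = (C + s * P (branch_inv p q f s x))%:E.
Proof.
move=> Hb p0 q1; have [pq l0 Hs H] := Hb.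
have full x : s * x < s * f p \/ s * f q < s * x ->
    (forall y, p <= y <= q -> f y <= x) \/ (forall y, p <= y <= q -> ~ (f y <= x)).
  move=> hx; have aux y : p <= y <= q -> s * f p <= s * f y <= s * f q.
    by move=> yi; apply/(in_imageP Hb); exists y.
  by case: Hs hx aux => -> [] hx aux; [right|left|left|right] => y /aux /andP[? ?]; clra.
have nul (x y : R) : (forall z, p <= z <= q -> ~ (f z <= x)) ->
    measurable [set y : measurableTypeR R | p <= y <= q /\ f y <= x] /\
    mu [set y : measurableTypeR R | p <= y <= q /\ f y <= x] = (P y - P y)%:E.
  move=> h; rewrite (_ : [set _ | _] = set0) ?subrr ?measure0//.
  by apply/seteqP; split => // z [zi]; exact: h.
have itv (x a b : R) : p <= a -> a <= b -> b <= q ->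
    (forall z, p <= z <= q -> (f z <= x) = (a <= z <= b)) ->
    measurable [set y : measurableTypeR R | p <= y <= q /\ f y <= x] /\
    mu [set y : measurableTypeR R | p <= y <= q /\ f y <= x] = (P b - P a)%:E.
  move=> pa ab bq h; rewrite (_ : [set _ | _] = `[a, b]%classic).
    by rewrite density_itv//; clra.
  apply/seteqP; split => z /=; rewrite in_itv/=; first by move=> [zi]; rewrite h.
  move=> /andP[az zb]; have zi : p <= z <= q by apply/andP; split; clra.
  by rewrite h// az zb.
have Jcase x y : in_image p q f x -> p <= y <= q ->
    (s * f y <= s * x) = (y <= branch_inv p q f s x) /\
    (s * x <= s * f y) = (branch_inv p q f s x <= y).
  move=> Jx yi; have e := branch_invK s Jx; rewrite -{1 3}e.
  have zi := branch_inv_itv Hb x; set z := branch_inv p q f s x in zi *.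
  have mono u v : p <= u -> v <= q -> u < v -> s * f u < s * f v.
    move=> pu vq uv; have [+ _] := H u v pu (ltW uv) vq.
    have : 0 < lam * (v - u) by rewrite mulr_gt0 ?subr_gt0.
    by rewrite mulrBr; clra.
  move: zi yi => /andP[? ?] /andP[? ?].
  case: (ltgtP y z) => [yz|zy|->]; last by rewrite !lexx.
    by have := mono _ _ _ _ yz => h; have {}h := h ltac:(clra) ltac:(clra); split; apply/idP/idP; clra.
  by have := mono _ _ _ _ zy => h; have {}h := h ltac:(clra) ltac:(clra); split; apply/idP/idP; clra.
have /andP[pp pq'] : p <= p <= q by rewrite lexx ltW.
case: Hs => sE; subst s.
- exists (- P p) => x; rewrite mul1r addrC.
  case: (branch_inv_trichotomy Hb x) => [[hx e]|Jx|[hx e]].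
  + rewrite e; apply: nul; case: (full x (or_introl hx)) => // h.
    by have := h p ltac:(by rewrite lexx); clra.
  + have /andP[? ?] := branch_inv_itv Hb x.
    apply: itv => // z zi; have [h _] := Jcase x z Jx zi.
    by rewrite !mul1r in h; rewrite h; move: zi => /andP[-> _].
  + rewrite e; apply: itv => // z zi; rewrite zi.
    case: (full x (or_intror hx)) => [->//|h].
    by have := h q ltac:(by rewrite lexx andbT ltW); clra.
- exists (P q) => x; rewrite mulN1r.
  case: (branch_inv_trichotomy Hb x) => [[hx e]|Jx|[hx e]].
  + rewrite e; apply: itv => // z zi; rewrite zi.
    case: (full x (or_introl hx)) => [->//|h].
    by have := h p ltac:(by rewrite lexx); clra.
  + have /andP[? ?] := branch_inv_itv Hb x.
    apply: itv => // z zi; have [_ h] := Jcase x z Jx zi.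
    by rewrite !mulN1r lerN2 in h; rewrite h; move: zi => /andP[_ ->]; rewrite andbT.
  + rewrite e; apply: nul; case: (full x (or_intror hx)) => // h.
    by have := h q ltac:(by rewrite lexx andbT ltW); clra.
Qed.

(** Invariance is applied to [[0, x]]: its preimage is the union of the two branch sublevel sets,
    which meet at most in [c], a null set by absolute continuity. *)
Lemma invariant_primitive (c s0 s1 lam L : R) :
  0 < c < 1 -> (forall x, 0 <= x <= 1 -> 0 <= f x <= 1) ->
  monotone_branch 0 c f s0 lam L -> monotone_branch c 1 f s1 lam L ->
  (forall A : set (measurableTypeR R), measurable A ->
     mu (`[0%R, 1%R]%classic `&` f @^-1` A) = mu A) ->
  exists K : R, forall x, 0 < x < 1 ->
    P x = K + (s0 * P (branch_inv 0 c f s0 x) + s1 * P (branch_inv c 1 f s1 x)).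
Proof.
move=> /andP[c0 c1] f01 B0 B1 inv.
have [C0 H0] := branch_sublevel B0 (lexx _) (ltW c1).
have [C1 H1] := branch_sublevel B1 (ltW c0) (lexx _).
exists (P 0 + C0 + C1) => x /andP[x0 x1].
pose S0 := [set y : measurableTypeR R | 0 <= y <= c /\ f y <= x].
pose S1 := [set y : measurableTypeR R | c <= y <= 1 /\ f y <= x].
have [m0 e0] : measurable S0 /\ mu S0 = (C0 + s0 * P (branch_inv 0 c f s0 x))%:E by exact: H0.
have [m1 e1] : measurable S1 /\ mu S1 = (C1 + s1 * P (branch_inv c 1 f s1 x))%:E by exact: H1.
have := inv `[0, x]%classic (measurable_itv _).
rewrite (density_itv (lexx _) (ltW x0) (ltW x1)).
rewrite (_ : _ `&` _ = S0 `|` S1); last first.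
  apply/seteqP; split => y /=; rewrite !in_itv/=.
    move=> [/andP[y0 y1] /andP[_ fy]]; case: (leP y c) => yc; [left|right]; split => //.
      by rewrite y0.
    by rewrite y1 ltW.
  move=> [[/andP[? ?] fy]|[/andP[? ?] fy]]; rewrite fy andbT;
   (have yi : 0 <= y <= 1 by apply/andP; split; clra); split => //;
   by have /andP[] := f01 y yi.
move=> E; have lt0 : (mu S0 < +oo)%E by rewrite e0 ltry.
have : (P x - P 0)%:E = (mu S0 + mu S1 - mu (S0 `&` S1))%E.
  by rewrite -E; exact: (measureUfinl m0 m1 lt0).
have -> : mu (S0 `&` S1) = 0%E.
  apply: (subset_measure0 _ _ _ (density_set1 c)) => //; first exact: measurableI.
  by move=> y [[/andP[_ yc] _] [/andP[cy _] _]]; apply/eqP; rewrite eq_le yc.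
by rewrite e0 e1 sube0 -EFinD => -[] h; clra.
Qed.

End invariant_density.

(** * Dense critical orbits *)

Section dense_discontinuities.
Context {R : realType}.
Implicit Types (x y z e d : R).

Lemma dense_setD1 (S : set R) e : open S -> dense S ->
  open (S `\ e) /\ dense (S `\ e).
Proof.
move=> oS dS; split.
  rewrite setDE; apply: openI => //; apply: closed_openC.
  exact: closed_eq.
move=> O O0 oO; have [x [Ox Sx]] := dS O O0 oO.
have /open_epsP/(_ x (conj Ox Sx))[d d0 hd] : open (O `&` S) by exact: openI.
have [ex|ex] := eqVneq x e; last by exists x; split => //; split => //; apply/eqP.
have xd : `|x + d / 2 - x| < d by rewrite addrC addKr gtr0_norm; clra.
have [? ?] := hd _ xd; exists (x + d / 2); split => //; split => //=.
by rewrite -ex => /eqP; rewrite -subr_eq0 addrC addKr gt_eqF// divr_gt0.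
Qed.

(* By Baire, the points at which the difference quotients are unbounded form
   a residual set. *)
Lemma dense_discontinuities_nondiff_uncountable (rho : R -> R) :
  (forall a b, 0 <= a -> a < b -> b <= 1 ->
    exists2 p : R, a < p < b & ~ {for p, continuous rho}) ->
  ~ countable (nondiff_set rho).
Proof.
move=> Hd cN; have [z hz] := countable_enumeration cN.
pose W (M : nat) := [set x : R | exists y : R, [/\ 0 <= y <= 1, `|y - x| < M.+1%:R^-1 &
  M.+1%:R * `|y - x| < `|rho y - rho x|]].
(* [W M] collects the points with a difference quotient above [M + 1] at a distance below
   [1 / (M + 1)]. The complement of [[0, 1]] is added to get density in the line, and removing [z M]
   keeps the intersection off the set supposed countable. *)
pose F M := ((W M)^° `|` ~` `[0, 1]%classic) `\ z M.
have oF M : open ((W M)^° `|` ~` `[0, 1]%classic).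
  apply: openU; first exact: open_interior.
  by apply: closed_openC; exact: interval_closed.
have dF M : dense ((W M)^° `|` ~` `[0, 1]%classic).
  move=> O [x Ox] oO; have [x01|] := boolP (0 <= x <= 1); last first.
    by move=> x01; exists x; split => //; right; rewrite /= in_itv/=; apply/negP.
  have /andP[x0 x1] := x01.
  have /open_epsP/(_ x Ox)[d d0 hd] := oO.
  have [||| p /andP[ap pb] ncp] := Hd (Num.max 0 (x - d)) (Num.min 1 (x + d)).
  - by rewrite le_max lexx.
  - by rewrite gt_max !lt_min; apply/andP; split; apply/andP; split; clra.
  - by rewrite ge_min lexx.
  move: ap pb; rewrite gt_max lt_min => /andP[p0 px] /andP[p1 px'].
  exists p; split; first by apply: hd; rewrite ltr_norml; apply/andP; split; clra.
  left.
  have [e e0 he] : exists2 e : R, 0 < e & forall d : R, 0 < d ->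
      exists2 y, `|y - p| < d & e <= `|rho y - rho p|.
    apply: contrapT => H; apply: ncp; apply/continuous_epsP => e e0.
    apply: contrapT => H2; apply: H; exists e => // d' d'0.
    apply: contrapT => H3; apply: H2; exists d' => // y yd.
    by rewrite ltNge; apply/negP => h; apply: H3; exists y.
  have [m mE] : exists m : R, m = M.+1%:R by eexists.
  have M0 : 0 < m by rewrite mE ltr0n.
  have iM0 : 0 < m^-1 by rewrite invr_gt0.
  pose t := Num.min (Num.min p (1 - p)) (Num.min (m^-1 / 2) (e / 4 / m)).
  have t0 : 0 < t.
    by rewrite !lt_min p0 subr_gt0 p1 !divr_gt0.
  have /and4P[tp tp1 tM te] : [&& t <= p, t <= 1 - p, t <= m^-1 / 2 & t <= e / 4 / m].
    by rewrite /t !ge_min !lexx ?orbT.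
  have Mte : m * t <= e / 4 by rewrite mulrC -ler_pdivlMr.
  suff near_p (x' : R) : `|x' - p| < t -> W M x'.
    rewrite /interior; apply/nbhs_ballP; exists t => // x'.
    by rewrite /ball/= distrC; exact: near_p.
  move=> x'p; rewrite /W/= -mE.
  have Mx : m * `|x' - p| <= e / 4.
    by apply: le_trans Mte; rewrite ler_pM2l// ltW.
  (* [x'] is compared with [p] if their values differ by at least [e / 2]; otherwise with a point
     [y] near [p] whose value is at least [e] away from [rho p]. *)
  have [h|h] := leP (e / 2) `|rho x' - rho p|.
    exists p; split; first by apply/andP; split; clra.
      by rewrite distrC; clra.
    by rewrite distrC (distrC (rho p)); clra.
  have [y yp hy] := he t t0.
  exists y; split.
  - by move: yp; rewrite ltr_norml => /andP[? ?]; apply/andP; split; clra.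
  - have -> : y - x' = (y - p) - (x' - p) by ring.
    by apply: le_lt_trans (ler_normB _ _) _; clra.
  - have h1 : m * `|y - x'| <= e / 4 + e / 4.
      have -> : y - x' = (y - p) - (x' - p) by ring.
      apply: (@le_trans _ _ (m * (`|y - p| + `|x' - p|))).
        by rewrite ler_pM2l// ler_normB.
      rewrite mulrDr lerD//; apply: le_trans Mte.
      by rewrite ler_pM2l// ltW.
    have : `|rho y - rho p| <= `|rho y - rho x'| + `|rho x' - rho p|.
      have -> : rho y - rho p = (rho y - rho x') + (rho x' - rho p) by ring.
      exact: ler_normD.
    clra.
have dI : dense (\bigcap_M F M).
  by apply: (@Baire R R) => M; have [? ?] := dense_setD1 (z M) (oF M) (dF M).
have o01 : open (`]0, 1[%classic : set R) by exact: interval_open.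
have [|x [/= x01 xF]] := dI `]0, 1[%classic _ o01.
  by exists (1 / 2); rewrite /= in_itv/=; apply/andP; split; clra.
rewrite in_itv/= in x01; have /andP[x0 x1] := x01.
have xi : x \in `[0, 1] by rewrite in_itv/= !ltW.
have Nx : ~ nondiff_set rho x.
  by move=> /hz/(_ 0%N)[i _ zi]; have [_ /=] := xF i I; rewrite zi; apply.
have xW M : W M x.
  by have [[|]] := xF M I; [move/interior_subset|rewrite /= in_itv/= !ltW].
apply: Nx; split => // D.
set l := lim (diff_quotient rho x y @[y --> within `[0, 1] x^']) in D.
move/cvgrPdist_le : D => /(_ 1 ltr01).
rewrite /within/= near_withinE => /nbhs_ballP[d /= d0 hd].
(* [|l| + 1] bounds the quotients at distance below [d], and [d^-1] forces the scale of [W] below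
   [d]. *)
pose B := `|l| + 1 + d^-1.
have B0 : 0 <= B by rewrite !addr_ge0// invr_ge0 ltW.
have BM : B < (Num.bound B).+1%:R.
  by apply: lt_le_trans (archi_boundP B0) _; rewrite ler_nat.
have [y [y01 yx ry]] := xW (Num.bound B).
have yx0 : y != x.
  by apply: contraTneq ry => ->; rewrite !subrr normr0 mulr0 ltxx.
have yx1 : 0 < `|y - x| by rewrite normr_gt0 subr_eq0.
have id0 : 0 < d^-1 by rewrite invr_gt0.
have yd : `|y - x| < d.
  apply: lt_trans yx _; rewrite -[ltRHS]invrK ltf_pV2 ?posrE ?ltr0n//.
  by have := normr_ge0 l; rewrite /B in BM; clra.
have := hd y; rewrite /ball/= distrC => /(_ yd yx0).
rewrite in_itv/= => /(_ y01) h.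
have : `|diff_quotient rho x y| <= `|l| + 1.
  have -> : diff_quotient rho x y = l - (l - diff_quotient rho x y) by ring.
  by apply: le_trans (ler_normB _ _) _; rewrite lerD2l.
rewrite /diff_quotient normrM normfV ler_pdivrMr// leNgt => /negP; apply.
apply: le_lt_trans ry; rewrite ler_pM2r//.
by rewrite /B in BM; clra.
Qed.

End dense_discontinuities.

Section dense_critical_orbit.
Context {R : realType}.
Variables (f : R -> R) (c s0 s1 lam L : R).
Implicit Types (x y z e d w p q s a b u v t : R).

Hypothesis Hf : expanding_unimodal f c s0 s1 lam L.

Let c01 : 0 < c < 1. Proof. by case: Hf. Qed.
Let lam1 : 1 < lam. Proof. by case: Hf. Qed.
Let B0 : monotone_branch 0 c f s0 lam L. Proof. by case: Hf. Qed.
Let B1 : monotone_branch c 1 f s1 lam L. Proof. by case: Hf. Qed.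

Lemma expansion_le : lam <= L.
Proof.
have [pq l0 _ H] := B0; have [h1 h2] := H 0 c (lexx _) (ltW pq) (lexx _).
by have := le_trans h1 h2; rewrite ler_pM2r// subr_gt0.
Qed.

Let lam0 : 0 < lam. Proof. exact: lt_trans lam1. Qed.

Lemma expansion_gt0 : 0 < L.
Proof. exact: lt_le_trans expansion_le. Qed.

Lemma unimodal_lipschitz x y : 0 <= x <= 1 -> 0 <= y <= 1 ->
  `|f y - f x| <= L * `|y - x|.
Proof.
wlog xy : x y / x <= y => [W|].
  by case: (leP x y) => xy; [exact: W|move=> *; rewrite distrC (distrC y) W// ltW].
move=> /andP[x0 x1] /andP[y0 y1].
case: (leP y c) => yc.
  by apply: (branch_lipschitz B0 _ _).2; apply/andP; split; clra.
case: (leP c x) => cx.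
  by apply: (branch_lipschitz B1 _ _).2; apply/andP; split; clra.
have /andP[c0 c1] := c01.
have [_ h1] : lam * `|c - x| <= `|f c - f x| /\ `|f c - f x| <= L * `|c - x|.
  by apply: (branch_lipschitz B0); apply/andP; split; clra.
have [_ h2] : lam * `|y - c| <= `|f y - f c| /\ `|f y - f c| <= L * `|y - c|.
  by apply: (branch_lipschitz B1); apply/andP; split; clra.
have -> : f y - f x = (f y - f c) + (f c - f x) by ring.
apply: le_trans (ler_normD _ _) _; apply: le_trans (lerD h2 h1) _.
rewrite -mulrDr ler_wpM2l//; first exact: ltW expansion_gt0.
by rewrite !ger0_norm; clra.
Qed.

(** As long as the images of a segment miss [c], each lies in one branch and is stretched by at
    least [lam]; this cannot go on inside [[0, 1]]. *)
Lemma critical_preimages_dense a b : 0 <= a -> a < b -> b <= 1 ->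
  exists y n, a <= y <= b /\ iter n f y = c.
Proof.
have [_ f01 _ _ _] := Hf.
move=> a0 ab b1; apply: contrapT => H.
have key n : exists u v, [/\ 0 <= u, v <= 1, lam ^+ n * (b - a) <= v - u &
    forall x, u <= x <= v -> exists2 y, a <= y <= b & iter n f y = x].
  elim: n => [|n [u [v [u0 v1 uv Huv]]]].
    by exists a, b; rewrite expr0 mul1r; split => // x xi; exists x.
  have ba : 0 < lam ^+ n * (b - a) by rewrite mulr_gt0 ?subr_gt0// exprn_gt0.
  have ltuv : u < v by clra.
  have nc : ~ (u <= c <= v).
    by move=> /Huv[y yi yc]; apply: H; exists y, n.
  have [p [q [s [Hb pu vq p0 q1]]]] : exists p q s, [/\ monotone_branch p q f s lam L,
      p <= u, v <= q, 0 <= p & q <= 1].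
    have /andP[c0 c1] := c01; case: (leP v c) => vc.
      by exists 0, c, s0; split => //; clra.
    case: (leP c u) => cu; first by exists c, 1, s1; split => //; clra.
    by exfalso; apply: nc; rewrite !ltW.
  have Huv' : monotone_branch u v f s lam L.
    have [_ l0 Hs h] := Hb; split => // x y ux xy yv; apply: h => //; clra.
  have [_ l0 Hs h] := Huv'; have [h1 _] := h u v (lexx _) (ltW ltuv) (lexx _).
  have h2 : lam * (lam ^+ n * (b - a)) <= lam * (v - u) by rewrite ler_pM2l.
  have fu : 0 <= f u <= 1 by apply: f01; apply/andP; split; clra.
  have fv : 0 <= f v <= 1 by apply: f01; apply/andP; split; clra.
  have img x : s * f u <= s * x <= s * f v -> exists2 y, a <= y <= b & iter n.+1 f y = x.
    move=> /(in_imageP Huv') [t [/Huv[y yi <-] <-]].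
    by exists y.
  rewrite exprS -mulrA.
  case: Hs h1 img => -> h1 img.
    exists (f u), (f v); split; [clra|clra|clra|].
    by move=> x xi; apply: img; rewrite !mul1r.
  exists (f v), (f u); split; [clra|clra|clra|].
  by move=> x /andP[? ?]; apply: img; rewrite !mulN1r !lerN2; apply/andP.
have [n0 /(_ n0 (leqnn _))] := @geometric_lt R lam^-1 (b - a)
  ltac:(by rewrite invr_ge0 ltW//= invf_lt1) ltac:(by rewrite subr_gt0).
have [u [v [u0 v1 uv _]]] := key n0.
have ln : 0 < lam ^+ n0 by rewrite exprn_gt0.
by rewrite exprVn -[_^-1]mul1r ltr_pdivrMr// mulrC; clra.
Qed.

Hypothesis orbit_dense : `[0, 1]%classic `<=` closure (critical_orbit f c).

Local Notation cn n := (iter n f c).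

Lemma orbit_near x d : 0 <= x <= 1 -> 0 < d -> exists2 n, (0 < n)%N & `|cn n - x| < d.
Proof.
move=> xi d0; have /orbit_dense : `[0, 1]%classic x by rewrite /= in_itv.
move=> /(_ _ (nbhsx_ballx x d d0))[_ [[n n1 <-]]].
by rewrite /ball/= distrC => h; exists n.
Qed.

(** A repetition would make the critical orbit finite, hence closed, and it could not be dense in
    [[0, 1]]. *)
Lemma orbit_injective m n : (0 < m)%N -> (m < n)%N -> cn m <> cn n.
Proof.
move=> m0 mn e.
have key i : exists2 j, (j < n)%N & cn i = cn j.
  elim/ltn_ind: i => i IH; have [lin|nli] := ltnP i n; first by exists i.
  have [|j jn ej] := IH (i - n + m)%N.
    by rewrite -{2}(subnK nli) ltn_add2l.
  by exists j => //; rewrite -ej -{1}(subnK nli) !iterD e.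
have fin : finite_set [set cn j | j in `I_n] by apply: finite_image; exact: finite_II.
have cl : closed [set cn j | j in `I_n].
  exact: (accessible_finite_set_closed.1 (hausdorff_accessible (@Rhausdorff R))).
have sub : `]0%R, 1%R[%classic `<=` [set cn j | j in `I_n].
  move=> x; rewrite /= in_itv/= => /andP[x0 x1].
  have : closure (critical_orbit f c) x by apply: orbit_dense; rewrite /= in_itv/= !ltW.
  have S : critical_orbit f c `<=` [set cn j | j in `I_n].
    by move=> _ [i _ <-]; have [j jn ->] := key i; exists j.
  by move=> cx; exact: cl (closureS S cx).
apply: (@uncountable_itvoo R 0 1 ltr01).
exact: sub_countable (subset_card_le sub) (finite_set_countable fin).
Qed.

Lemma orbit_neq_critical n : (0 < n)%N -> cn n <> c.
Proof.
move=> n0 e; apply: (@orbit_injective 1 n.+1) => //.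
by rewrite (_ : iter 1 f c = f c)//= e.
Qed.

Lemma orbit_itv n : 0 <= cn n <= 1.
Proof.
have [_ f01 _ _ _] := Hf.
elim: n => [|n IH]; last exact: f01.
by have /andP[/ltW -> /ltW ->] := c01.
Qed.

(** [f c] is the extremum of [f], and density pushes it to 1 or 0. Say [f c = 1]. If [f 1 > 0], then
    [f 0 = 0], as otherwise the orbit stays above the minimum of [f 0] and [f 1]; but then
    [f z >= z] on the left and [f z >= f 1] on the right keep the orbit above [f 1]. The strict
    bounds come from injectivity of the orbit. *)
Lemma orbit_start : [\/ [/\ f c = 1, f 1 = 0 & 0 < f 0 < 1] |
  [/\ f c = 0, f 0 = 1 & 0 < f 1 < 1]].
Proof.
have [_ f01 _ _ _] := Hf; have /andP[c0 c1] := c01.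
have [_ _ Hs0 H0] := B0; have [_ _ Hs1 H1] := B1.
have growth z : 0 <= z <= 1 -> (z <= s0 * (f z - f 0) /\ 0 <= s0 * (f c - f z)) \/
    (1 - z <= s1 * (f 1 - f z) /\ 0 <= s1 * (f z - f c)).
  move=> /andP[z0 z1]; have [zc|/ltW cz] := leP z c; [left|right].
    have [h1 _] := H0 0 z (lexx _) z0 zc; have [h2 _] := H0 z c z0 zc (lexx _).
    rewrite (le_trans _ h2) ?mulr_ge0 ?subr_ge0 ?(ltW lam0)//; split => //.
    by apply: le_trans h1; rewrite subr0 ler_peMl// ltW.
  have [h1 _] := H1 z 1 cz z1 (lexx _); have [h2 _] := H1 c z (lexx _) cz z1.
  rewrite (le_trans _ h2) ?mulr_ge0 ?subr_ge0 ?(ltW lam0)//; split => //.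
  by apply: le_trans h1; rewrite ler_peMl ?subr_ge0// ltW.
have [h0 _] := H0 0 c (lexx _) (ltW c0) (lexx _).
have [h1 _] := H1 c 1 (lexx _) (ltW c1) (lexx _).
have i0 : 0 <= (0 : R) <= 1 by rewrite lexx ler01.
have i1 : 0 <= (1 : R) <= 1 by rewrite lexx ler01.
have /andP[f00 f01'] := f01 _ i0; have /andP[f10 f11'] := f01 _ i1.
have /andP[fc0 fc1] : 0 <= f c <= 1 by apply: f01; rewrite !ltW.
have lc0 : c < lam * (c - 0) by rewrite subr0 ltr_pMl.
have lc1 : 1 - c < lam * (1 - c) by rewrite ltr_pMl// subr_gt0.
have n2 : cn 2 = f (f c) by [].
have n3 : cn 3 = f (f (f c)) by [].
clear H0 H1; case: Hs0 Hs1 => s0E [] s1E; rewrite s0E in growth h0; rewrite s1E in growth h1.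
(* Branches of equal orientation would put [f 0] and [f 1] at distance at least [lam > 1]. *)
- by exfalso; clra.
- left; have up z : 0 <= z <= 1 -> f z <= f c by case/growth => -[? ?]; clra.
  have low z : 0 <= z <= 1 -> f 0 + z <= f z \/ f 1 + (1 - z) <= f z.
    by case/growth => -[? ?]; [left|right]; clra.
  have fc : f c = 1.
    apply/eqP; rewrite eq_le fc1/= leNgt; apply/negP => fcl.
    have [|[|n] n0] := orbit_near i1 (_ : 0 < 1 - f c) => //; first by rewrite subr_gt0.
    by rewrite ltr_norml => /andP[+ _]; have := up _ (orbit_itv n); rewrite iterS; clra.
  have f1 : f 1 = 0.
    apply/eqP; rewrite eq_le f10 andbT leNgt; apply/negP => f1.
    have f0 : f 0 = 0.
      apply/eqP; rewrite eq_le f00 andbT leNgt; apply/negP => f0.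
      have [|[|n] n0] := orbit_near i0 (_ : 0 < Num.min (f 0) (f 1)) => //; first by rewrite lt_min f0.
      rewrite lt_min !ltr_norml iterS => /andP[/andP[_ h] /andP[_ h']].
      by have /andP[? ?] := orbit_itv n; case: (low _ (orbit_itv n)); clra.
    have lown n : f 1 <= cn n.+1.
      elim: n => [|n IH]; first by rewrite /= fc.
      have /andP[? ?] := orbit_itv n.+1; rewrite iterS.
      by case: (low _ (orbit_itv n.+1)) => ?; clra.
    have [[|n] n0] := orbit_near i0 f1 => //.
    by rewrite ltr_norml => /andP[_]; have := lown n; clra.
  split => //; apply/andP; split; rewrite lt_neqAle ?f00 ?f01' andbT; apply/eqP => E.
    by apply: (@orbit_injective 2 3) => //; rewrite n3 n2 fc f1 -E.
  by apply: (@orbit_injective 1 3) => //; rewrite n3 /= fc f1 E.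
- right; have low z : 0 <= z <= 1 -> f c <= f z by case/growth => -[? ?]; clra.
  have up z : 0 <= z <= 1 -> f z <= f 0 - z \/ f z <= f 1 - (1 - z).
    by case/growth => -[? ?]; [left|right]; clra.
  have fc : f c = 0.
    apply/eqP; rewrite eq_le fc0 andbT leNgt; apply/negP => fcl.
    have [[|n] n0] := orbit_near i0 fcl => //.
    by rewrite ltr_norml => /andP[_]; have := low _ (orbit_itv n); rewrite iterS; clra.
  have f0 : f 0 = 1.
    apply/eqP; rewrite eq_le f01'/= leNgt; apply/negP => f0.
    have f1 : f 1 = 1.
      apply/eqP; rewrite eq_le f11'/= leNgt; apply/negP => f1.
      have [|[|n] n0] := orbit_near i1 (_ : 0 < Num.min (1 - f 0) (1 - f 1)) => //.
        by rewrite lt_min !subr_gt0 f0.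
      rewrite lt_min !ltr_norml iterS => /andP[/andP[h _] /andP[h' _]].
      by have /andP[? ?] := orbit_itv n; case: (up _ (orbit_itv n)); clra.
    have upn n : cn n.+1 <= f 0.
      elim: n => [|n IH]; first by rewrite /= fc.
      have /andP[? ?] := orbit_itv n.+1; rewrite iterS.
      by case: (up _ (orbit_itv n.+1)) => ?; clra.
    have [|[|n] n0] := orbit_near i1 (_ : 0 < 1 - f 0) => //; first by rewrite subr_gt0.
    by rewrite ltr_norml => /andP[+ _]; have := upn n; clra.
  split => //; apply/andP; split; rewrite lt_neqAle ?f10 ?f11' andbT; apply/eqP => E.
    by apply: (@orbit_injective 1 3) => //; rewrite n3 /= fc f0 -E.
  by apply: (@orbit_injective 2 3) => //; rewrite n3 n2 fc f0 E.
- by exfalso; clra.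
Qed.

Lemma endpoint_orbit : cn 1 = 1 /\ cn 2 = 0 \/ cn 1 = 0 /\ cn 2 = 1.
Proof. by case: orbit_start => -[/= -> -> _]; [left|right]. Qed.

Lemma orbit_of_endpoints z : [\/ z = 0, z = c | z = 1] ->
  exists2 i, (i <= 2)%N & z = cn i.
Proof.
case => ->; case: endpoint_orbit => -[e1 e2];
  by [exists 0%N|exists 1%N|exists 2%N].
Qed.

Lemma orbit_interior n : (2 < n)%N -> 0 < cn n < 1.
Proof.
move=> n2; have /andP[u v] := orbit_itv n.
have h1 : cn 1 <> cn n by apply: orbit_injective => //; exact: ltn_trans n2.
have h2 : cn 2 <> cn n by exact: orbit_injective.
rewrite !lt_neqAle u v !andbT; apply/andP; split; apply/eqP => E.
  by case: endpoint_orbit => -[e1 e2]; [apply: h2; rewrite e2|apply: h1; rewrite e1].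
by case: endpoint_orbit => -[e1 e2]; [apply: h1; rewrite e1|apply: h2; rewrite e2].
Qed.

End dense_critical_orbit.

(** * Limits of the density along a dense critical orbit *)

Section dense_orbit.
Context {R : realType}.
Variables (f : R -> R) (c s0 s1 lam L L1 : R) (rho g : R -> R) (Gam : set R).
Implicit Types (x y z e d w p q s a b u v t : R).

Local Notation U := [set y | 0 < y < c \/ c < y < 1].
Local Notation psi0 := (branch_inv 0 c f s0).
Local Notation psi1 := (branch_inv c 1 f s1).

Hypothesis Hf : expanding_unimodal f c s0 s1 lam L.
Hypothesis Gam_itv : forall x, Gam x ->
  [/\ 0 < x < 1, x <> c, x <> f 0, x <> f c & x <> f 1].
Hypothesis Gam_preim : forall x y, Gam x -> 0 <= y <= 1 -> f y = x -> Gam y.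
Hypothesis Gam_image : forall x, Gam x -> Gam (f x).
Hypothesis Gam_count : countable ([set x | 0 <= x <= 1] `\` Gam).
Hypothesis Gam_cont : forall x, Gam x -> {for x, continuous rho}.
Hypothesis L10 : 0 < L1.
Hypothesis g_bounds : forall y, U y -> 0 < g y /\ 1 <= L1 * g y.
Hypothesis g_cont : forall y, U y -> {for y, continuous g}.
Hypothesis rho_ge0 : forall x, Gam x -> 0 <= rho x.
Hypothesis rho_neq0 : exists2 x, Gam x & rho x != 0.
Hypothesis rho_eq : forall x, Gam x ->
  rho x = pushed 0 c f s0 (fun y => g y * rho y) x + pushed c 1 f s1 (fun y => g y * rho y) x.
Hypothesis rho_lim : forall w, 0 < w < 1 ->
  (forall m p, (0 < m)%N -> [\/ p = 0, p = c | p = 1] -> iter m f p <> w) ->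
  cvg (rho y @[y --> within Gam (nbhs w)]).

(** As [rho] is nonnegative on [Gam], this is convergence to 0 along [Gam]. *)
Definition vanishing w := forall e, 0 < e -> exists2 d : R, 0 < d &
  forall y, Gam y -> `|y - w| < d -> rho y < e.

Let c01 : 0 < c < 1. Proof. by case: Hf. Qed.
Let f01 x : 0 <= x <= 1 -> 0 <= f x <= 1. Proof. by case: Hf => _ + _ _ _; apply. Qed.
Let lam1 : 1 < lam. Proof. by case: Hf. Qed.
Let B0 : monotone_branch 0 c f s0 lam L. Proof. by case: Hf. Qed.
Let B1 : monotone_branch c 1 f s1 lam L. Proof. by case: Hf. Qed.
Let lam0 : 0 < lam. Proof. exact: lt_trans lam1. Qed.

Lemma within_cvgP (D E : set R) (h : R -> R) x y (C : R) : 0 < C ->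
  (exists2 d : R, 0 < d & forall z, D z -> `|z - x| < d -> E (h z) /\ `|h z - y| <= C * `|z - x|) ->
  h z @[z --> within D (nbhs x)] --> within E (nbhs y).
Proof.
move=> C0 [d d0 H] A /nbhs_ballP[e /= e0 he].
apply/nbhs_ballP; exists (Num.min d (e / C)); first by rewrite /= lt_min d0 divr_gt0.
move=> z; rewrite /ball/= distrC lt_min => /andP[zd ze] Dz.
have [Ez hz] := H z Dz zd; apply: he => //.
by rewrite /ball/= distrC (le_lt_trans hz)// mulrC -ltr_pdivlMr.
Qed.

Lemma within_imageP y0 : 0 <= y0 <= 1 ->
  f y @[y --> within Gam (nbhs y0)] --> within Gam (nbhs (f y0)).
Proof.
move=> y01; apply: (@within_cvgP _ _ _ _ _ L).
  exact: (expansion_gt0 Hf).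
exists 1 => // z Gz _; split; first exact: Gam_image.
by apply: (unimodal_lipschitz Hf) => //; have [/andP[/ltW -> /ltW ->]] := Gam_itv Gz.
Qed.

Lemma within_Gam_proper w : 0 <= w <= 1 -> ProperFilter (within Gam (nbhs w)).
Proof.
move=> /andP[w0 w1]; apply: Build_ProperFilter => /nbhs_ballP[d /= d0 hd].
have [|||z /andP[z1 z2] Gz] := @Gam_dense _ Gam Gam_count (Num.max 0 (w - d)) (Num.min 1 (w + d)).
- by rewrite le_max lexx.
- by rewrite gt_max !lt_min; apply/andP; split; apply/andP; split; lra.
- by rewrite ge_min lexx.
move: z1 z2; rewrite gt_max lt_min => /andP[_ z1] /andP[_ z2].
have /hd : ball w d z; last by apply.
rewrite /ball/= distrC ltr_norml.
by apply/andP; split; lra.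
Qed.

Lemma pushed_ge0 p q s x : monotone_branch p q f s lam L -> 0 <= p -> q <= 1 ->
  (forall y, p < y < q -> U y) -> x <> f p -> x <> f q -> Gam x ->
  0 <= pushed p q f s (fun y => g y * rho y) x.
Proof.
move=> Hb p0 q1 pqU xp xq Gx; case: (pselect (in_image p q f x)) => Jx; last first.
  by rewrite pushed_out.
rewrite pushedE//; have Uy := pqU _ (interior_branch_inv Hb xp xq Jx).
have [gy _] := g_bounds Uy; rewrite mulr_ge0 ?(ltW gy)//; apply: rho_ge0.
apply: Gam_preim Gx _ (branch_invK s Jx).
by have /andP[? ?] := branch_inv_itv Hb x; apply/andP; split; lra.
Qed.

(** Both branch terms of the equation at [f y] are nonnegative, so the one coming from [y] is at
    most [rho (f y)]. *)
Lemma rho_preim_le y : Gam y -> rho y <= L1 * rho (f y).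
Proof.
move=> Gy; have Gfy := Gam_image Gy; have /andP[c0 c1] := c01.
have [_ _ f0 fc f1] := Gam_itv Gfy.
have [/andP[y0 y1] /eqP yc _ _ _] := Gam_itv Gy.
have ge00 : 0 <= pushed 0 c f s0 (fun y => g y * rho y) (f y).
  by apply: (pushed_ge0 B0) => //; [exact: ltW|move=> z; left].
have ge01 : 0 <= pushed c 1 f s1 (fun y => g y * rho y) (f y).
  by apply: (pushed_ge0 B1) => //; [exact: ltW|move=> z; right].
have main : g y * rho y <= rho (f y).
  rewrite (rho_eq Gfy); move: yc; rewrite neq_lt => /orP[yc|yc].
    have yi : 0 <= y <= c by rewrite !ltW.
    rewrite (pushedE s0 _ (_ : in_image 0 c f (f y))) ?(branch_fK B0)//; last by exists y.
    by rewrite lerDl.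
  have yi : c <= y <= 1 by rewrite !ltW.
  rewrite (pushedE s1 _ (_ : in_image c 1 f (f y))) ?(branch_fK B1)//; last by exists y.
  by rewrite lerDr.
have Uy : U y by move: yc; rewrite neq_lt => /orP[?|?]; [left|right]; apply/andP.
have [g0 g1] := g_bounds Uy; have r0 := rho_ge0 Gy.
apply: (@le_trans _ _ (L1 * (g y * rho y))); last by rewrite ler_pM2l.
by rewrite mulrA ler_peMl.
Qed.

Lemma vanishing_preim y : 0 <= y <= 1 -> vanishing (f y) -> vanishing y.
Proof.
move=> yi Zy e e0; have [d d0 hd] := Zy (e / L1) ltac:(by rewrite divr_gt0).
have L0 := expansion_gt0 Hf.
exists (d / L); first exact: divr_gt0.
move=> z Gz zd; apply: le_lt_trans (rho_preim_le Gz) _.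
rewrite mulrC -ltr_pdivlMr//; apply: hd; first exact: Gam_image.
have zi : 0 <= z <= 1 by have [/andP[/ltW -> /ltW ->]] := Gam_itv Gz.
apply: le_lt_trans (unimodal_lipschitz Hf yi zi) _.
by rewrite mulrC -ltr_pdivlMr.
Qed.

Lemma vanishing_iter n y : 0 <= y <= 1 -> vanishing (iter n f y) -> vanishing y.
Proof.
elim: n y => [//|n IH] y yi; rewrite iterSr => /IH h.
by apply: vanishing_preim => //; apply: h; exact: f01.
Qed.

Lemma not_vanishing_critical : ~ vanishing c.
Proof.
move=> Zc; have [x Gx rx] := rho_neq0.
have rx0 : 0 < rho x by rewrite lt_neqAle eq_sym rx rho_ge0.
have [/andP[x0 x1] _ _ _ _] := Gam_itv Gx.
have rx2 : 0 < rho x / 2 by rewrite divr_gt0.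
have /continuous_epsP/(_ _ rx2)[d d0 hd] := Gam_cont Gx.
pose t := Num.min (Num.min x (1 - x)) (d / 2).
have t0 : 0 < t by rewrite !lt_min x0 subr_gt0 x1 divr_gt0.
have /and3P[tx tx1 td] : [&& t <= x, t <= 1 - x & t <= d / 2].
  by rewrite /t !ge_min !lexx ?orbT.
have [|||y [n [/andP[y1 y2] yc]]] := @critical_preimages_dense _ _ _ _ _ _ _ Hf (x - t) (x + t); [lra|lra|lra|].
have Zy : vanishing y.
  by apply: (@vanishing_iter n); [apply/andP; split; lra|rewrite yc].
have [d1 d10 hd1] := Zy _ rx2.
pose t1 := Num.min d1 (d / 2).
have t10 : 0 < t1 by rewrite lt_min d10 divr_gt0.
have /andP[t1d1 t1d] : (t1 <= d1) && (t1 <= d / 2) by rewrite /t1 !ge_min !lexx ?orbT.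
have [|||z /andP[z1 z2] Gz] := @Gam_dense _ Gam Gam_count (Num.max 0 (y - t1)) (Num.min 1 (y + t1)).
- by rewrite le_max lexx.
- by rewrite gt_max !lt_min; apply/andP; split; apply/andP; split; lra.
- by rewrite ge_min lexx.
move: z1 z2; rewrite gt_max lt_min => /andP[_ z1] /andP[_ z2].
have /hd1 : Gam z by []; move=> /(_ ltac:(rewrite ltr_norml; apply/andP; split; lra)).
have := hd z ltac:(rewrite ltr_norml; apply/andP; split; lra).
by rewrite ltr_norml => /andP[? ?]; lra.
Qed.

Local Notation CL w := (cvg (rho y @[y --> within Gam (nbhs w)])).

Lemma within_cvg_eps (h : R -> R) w l : h y @[y --> within Gam (nbhs w)] --> l ->
  forall e, 0 < e -> exists2 d : R, 0 < d &
    forall y, Gam y -> `|y - w| < d -> `|h y - l| < e.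
Proof.
move=> /cvgrPdist_lt H e e0; have := H e e0; rewrite near_withinE.
move=> /nbhs_ballP[d /= d0 hd]; exists d => // y Gy yw; rewrite distrC.
by apply: hd => //; rewrite /ball/= distrC.
Qed.

Lemma within_cvg_eq (h h' : R -> R) w d : 0 < d ->
  (forall y, Gam y -> `|y - w| < d -> h y = h' y) ->
  cvg (h y @[y --> within Gam (nbhs w)]) -> cvg (h' y @[y --> within Gam (nbhs w)]).
Proof.
move=> d0 hh /cvg_ex[l hl]; apply/cvg_ex; exists l.
apply: cvg_trans hl; apply: near_eq_cvg; rewrite near_withinE.
apply/nbhs_ballP; exists d => //= y; rewrite /ball/= distrC => yw Gy.
by rewrite hh.
Qed.

Lemma within_continuous (h : R -> R) w : {for w, continuous h} ->
  h y @[y --> within Gam (nbhs w)] --> h w.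
Proof. by move=> hw; apply: cvg_trans hw; apply: cvg_app; exact: cvg_within. Qed.

Section limits.
Context p q s p' q' s'.
Hypothesis Hb : monotone_branch p q f s lam L.
Hypothesis Hb' : monotone_branch p' q' f s' lam L.
Hypotheses (p0 : 0 <= p) (q1 : q <= 1) (p0' : 0 <= p') (q1' : q' <= 1).
Hypothesis pqU : forall y, p < y < q -> U y.
Hypothesis pqU' : forall y, p' < y < q' -> U y.
Hypothesis eq_pq : forall x, Gam x -> rho x =
  pushed p q f s (fun y => g y * rho y) x + pushed p' q' f s' (fun y => g y * rho y) x.

Lemma pushed_within_cvg x0 : x0 <> f p' -> x0 <> f q' ->
  (in_image p' q' f x0 -> CL (branch_inv p' q' f s' x0)) ->
  cvg (pushed p' q' f s' (fun y => g y * rho y) x @[x --> within Gam (nbhs x0)]).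
Proof.
move=> xp xq H; have [d d0 hd] := in_image_near Hb' xp xq.
case: (pselect (in_image p' q' f x0)) => Jx; last first.
  apply: (@within_cvg_eq (cst 0) _ _ d) => //; last exact: is_cvg_cst.
  by move=> y Gy /hd yJ; rewrite pushed_out// => /yJ.
have Uw := pqU' (interior_branch_inv Hb' xp xq Jx).
apply: (@within_cvg_eq (fun x => g (branch_inv p' q' f s' x) * rho (branch_inv p' q' f s' x)) _ _ d) => //.
  by move=> y Gy /hd yJ; rewrite pushedE//; apply/yJ.
have psiw : branch_inv p' q' f s' x @[x --> within Gam (nbhs x0)] -->
    within Gam (nbhs (branch_inv p' q' f s' x0)).
  apply: (@within_cvgP _ _ _ _ _ lam^-1); first by rewrite invr_gt0.
  exists d => // z Gz /hd zJ; have Jz : in_image p' q' f z by apply/zJ.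
  split; last by rewrite [leRHS]mulrC; exact: (branch_inv_lipschitz Hb' Jx Jz).
  apply: Gam_preim Gz _ (branch_invK s' Jz).
  by have /andP[u v] := branch_inv_itv Hb' z; rewrite (le_trans p0' u) (le_trans v q1').
have /cvg_ex[l hl] := H Jx.
apply/cvg_ex; exists (g (branch_inv p' q' f s' x0) * l).
have h1 := cvg_comp _ _ psiw (within_continuous (g_cont Uw)).
have h2 := cvg_comp _ _ psiw hl.
exact: (cvgM h1 h2).
Qed.

Lemma pushed_pq_image y : p <= y <= q ->
  pushed p q f s (fun y => g y * rho y) (f y) = g y * rho y.
Proof. by move=> yi; rewrite pushedE ?(branch_fK Hb)//; exists y. Qed.

(** Near [y0] the equation at [f y] can be solved for [rho y]: subtract from [rho (f y)] the term of
    the other branch and divide by [g y]. Each ingredient has a limit. *)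
Lemma limit_pullback y0 : p < y0 < q -> f y0 <> f p' -> f y0 <> f q' ->
  (in_image p' q' f (f y0) -> CL (branch_inv p' q' f s' (f y0))) ->
  CL (f y0) -> CL y0.
Proof.
move=> /andP[py yq] xp xq H Cx.
have y01 : 0 <= y0 <= 1 by rewrite (le_trans p0 (ltW py)) (le_trans (ltW yq) q1).
have Uy : U y0 by apply: pqU; rewrite py.
have [g0 _] := g_bounds Uy.
apply: (@within_cvg_eq (fun y => (g y)^-1 *
   (rho (f y) - pushed p' q' f s' (fun y => g y * rho y) (f y))) _ _ (Num.min (y0 - p) (q - y0))).
- by rewrite lt_min !subr_gt0 py.
- move=> y Gy; rewrite lt_min !ltr_norml => /andP[/andP[? ?] /andP[? ?]].
  have pyq : p < y < q by apply/andP; split; lra.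
  have [gy0 _] := g_bounds (pqU pyq).
  rewrite (eq_pq (Gam_image Gy)) addrK pushed_pq_image; last by move: pyq => /andP[/ltW -> /ltW ->].
  by rewrite mulKf// gt_eqF.
have fw := within_imageP y01.
have /cvg_ex[l hl] := Cx; have /cvg_ex[l' hl'] := pushed_within_cvg xp xq H.
apply/cvg_ex; exists ((g y0)^-1 * (l - l')); apply: cvgM.
  by apply: cvgV; [rewrite gt_eqF|exact: within_continuous (g_cont Uy)].
have h1 := cvg_comp _ _ fw hl; have h2 := cvg_comp _ _ fw hl'; exact: (cvgB h1 h2).
Qed.

Lemma Gam_side x d t : 0 < x < 1 -> 0 < d -> t = 1 \/ t = -1 ->
  exists z, [/\ Gam z, `|z - x| < d & t * x < t * z].
Proof.
move=> /andP[x0 x1] d0 [] ->.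
  have [|||z /andP[z1 z2] Gz] := @Gam_dense _ Gam Gam_count x (Num.min 1 (x + d)).
  - exact: ltW.
  - by rewrite lt_min x1; lra.
  - by rewrite ge_min lexx.
  move: z2; rewrite lt_min => /andP[_ z2]; exists z; split => //; last lra.
  by rewrite ltr_norml; apply/andP; split; lra.
have [|||z /andP[z1 z2] Gz] := @Gam_dense _ Gam Gam_count (Num.max 0 (x - d)) x.
- by rewrite le_max lexx.
- by rewrite gt_max x0; lra.
- exact: ltW.
move: z1; rewrite gt_max => /andP[_ z1]; exists z; split => //; last lra.
by rewrite ltr_norml; apply/andP; split; lra.
Qed.

Lemma vanishing_endpoint e0 : (e0 = p /\ p = 0) \/ (e0 = q /\ q = 1) ->
  0 < f e0 < 1 -> f e0 <> f p' -> f e0 <> f q' ->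
  (in_image p' q' f (f e0) -> CL (branch_inv p' q' f s' (f e0))) ->
  CL (f e0) -> vanishing e0.
Proof.
move=> e0E fe0 xp xq H Cx; have [pq _ Hs _] := Hb.
have /cvg_ex[l hl] := Cx; have /cvg_ex[l' hl'] := pushed_within_cvg xp xq H.
pose h x := rho x - pushed p' q' f s' (fun y => g y * rho y) x.
have hD : h x @[x --> within Gam (nbhs (f e0))] --> l - l' by exact: cvgB.
(* [t] is the orientation of the side of [f e0] that the image of the branch leaves free. There [h]
   vanishes, which forces its limit [l - l'] to be 0. *)
have [t [t1 ht]] : exists t, (t = 1 \/ t = -1) /\
    forall z, t * f e0 < t * z -> ~ in_image p q f z.
  have [e0p|e0q] : e0 = p \/ e0 = q by case: e0E => -[-> _]; [left|right].
    exists (- s); split; first by case: Hs => ->; [right|left]; rewrite ?opprK.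
    by move=> z + /(in_imageP Hb) /andP[+ _]; rewrite e0p !mulNr; lra.
  exists s; split => // z + /(in_imageP Hb) /andP[_]; rewrite e0q; lra.
have D0 : l - l' = 0.
  apply/eqP/negPn/negP => D0; have D1 : 0 < `|l - l'| by rewrite normr_gt0.
  have [d d0 hd] := within_cvg_eps hD D1.
  have [z [Gz zd tz]] := Gam_side fe0 d0 t1.
  have := hd z Gz zd; rewrite /h (eq_pq Gz) addrK pushed_out; last exact: ht.
  by rewrite sub0r normrN ltxx.
rewrite D0 in hD => {D0} e e_gt0.
have e01 : 0 <= e0 <= 1 by case: e0E => -[-> E]; rewrite E lexx ?ler01.
have eL : 0 < e / L1 by rewrite divr_gt0.
have [d d0 hd] := within_cvg_eps hD eL.
(* A point of [[0, 1]] within [q - p] of the end [e0] lies in the branch [[p, q]]; [d / L] brings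
   [f y] within [d] of [f e0]. *)
exists (Num.min (q - p) (d / L)).
  by rewrite lt_min subr_gt0 pq divr_gt0// (expansion_gt0 Hf).
move=> y Gy; rewrite lt_min => /andP[yp yd].
have [/andP[y0 y1] _ _ _ _] := Gam_itv Gy.
have pyq : p <= y <= q.
  move: yp; rewrite ltr_norml => /andP[h1 h2].
  by case: e0E => -[eE E]; rewrite eE in h1 h2; apply/andP; split; lra.
have /hd : Gam (f y) by exact: Gam_image.
have fyd : `|f y - f e0| < d.
  apply: le_lt_trans (unimodal_lipschitz Hf e01 _) _; first by rewrite !ltW.
  by rewrite mulrC -ltr_pdivlMr// (expansion_gt0 Hf).
move=> /(_ fyd); rewrite subr0 /h (eq_pq (Gam_image Gy)) addrK pushed_pq_image//.
have Uy : U y.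
  have [_ /eqP yc _ _ _] := Gam_itv Gy.
  by move: yc; rewrite neq_lt => /orP[?|?]; [left|right]; apply/andP.
have [g0 g1] := g_bounds Uy; have r0 := rho_ge0 Gy.
rewrite ger0_norm; last by rewrite mulr_ge0// ltW.
rewrite ltr_pdivlMr// mulrAC; apply: le_lt_trans.
by rewrite [g y * L1]mulrC ler_peMl.
Qed.

End limits.

Hypothesis orbit_dense : `[0, 1]%classic `<=` closure (critical_orbit f c).

Local Notation cn n := (iter n f c).

Lemma off_orbit_limit w : 0 < w < 1 -> (forall i, (0 < i)%N -> cn i <> w) -> CL w.
Proof.
move=> wi H; apply: rho_lim => // m z m0 /(orbit_of_endpoints Hf orbit_dense)[i _ ->].
by rewrite -iterD; apply: H; rewrite addn_gt0 m0.
Qed.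

(** The other preimage of [cn n.+1] is off the critical orbit: if it were [cn i], injectivity of the
    orbit would give [i = n], but [cn n] is not inside this branch. *)
Lemma other_branch_limit p q s n : monotone_branch p q f s lam L -> 0 <= p -> q <= 1 ->
  (0 < n)%N -> ~ (p < cn n < q) -> f (cn n) <> f p -> f (cn n) <> f q ->
  in_image p q f (f (cn n)) -> CL (branch_inv p q f s (f (cn n))).
Proof.
move=> Hb p0 q1 n0 nn xp xq Jx; have /andP[wp wq] := interior_branch_inv Hb xp xq Jx.
apply: off_orbit_limit; first by apply/andP; split; lra.
move=> i i0 iw; have fi : cn i.+1 = cn n.+1 by rewrite !iterS iw branch_invK.
have [iln|nli|ein] := ltngtP i n.
- by apply: (@orbit_injective _ f c orbit_dense i.+1 n.+1).
- by apply: (@orbit_injective _ f c orbit_dense n.+1 i.+1).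
- by apply: nn; rewrite -ein iw wp wq.
Qed.

Lemma orbit_no_limit n : (2 < n)%N -> ~ CL (cn n).
Proof.
have /andP[c0 c1] := c01.
have U0 y : 0 < y < c -> U y by left.
have U1 y : c < y < 1 -> U y by right.
have eq10 x : Gam x -> rho x = pushed c 1 f s1 (fun y => g y * rho y) x +
    pushed 0 c f s0 (fun y => g y * rho y) x by move=> /rho_eq ->; rewrite addrC.
have Hc : [\/ c = 0, c = c | c = 1] by constructor 2.
have H0 : [\/ 0 = 0 :> R, 0 = c | 0 = 1 :> R] by constructor 1.
have H1 : [\/ 1 = 0 :> R, 1 = c | 1 = 1 :> R] by constructor 3.
(* The images of 0, [c] and 1 are among [cn 1], [cn 2], [cn 3], so [m > 2] keeps [cn m.+1] away from
   them. This is why the pullback of limits ends at [cn 3]. *)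
have fneq m z : (2 < m)%N -> [\/ z = 0, z = c | z = 1] -> f (cn m) <> f z.
  move=> m2 /(orbit_of_endpoints Hf orbit_dense)[i i2 ->] E.
  by apply: (@orbit_injective _ f c orbit_dense i.+1 m.+1) => //; rewrite ltnS (leq_ltn_trans i2).
have down m : (2 < m)%N -> CL (cn m.+1) -> CL (cn m).
  move=> m2 Cm; have /andP[u v] := orbit_interior Hf orbit_dense m2.
  have m0 : (0 < m)%N by exact: ltn_trans m2.
  have /eqP := orbit_neq_critical orbit_dense m0; rewrite neq_lt => /orP[mc|mc].
    have mi : 0 < cn m < c by rewrite u mc.
    have nm : ~ (c < cn m < 1) by move=> /andP[? ?]; lra.
    exact: (limit_pullback B0 B1 (lexx 0) (ltW c1) (ltW c0) (lexx 1) U0 U1 rho_eq mi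
      (fneq m c m2 Hc) (fneq m 1 m2 H1) (other_branch_limit B1 (ltW c0) (lexx 1) m0 nm
      (fneq m c m2 Hc) (fneq m 1 m2 H1)) Cm).
  have mi : c < cn m < 1 by rewrite mc v.
  have nm : ~ (0 < cn m < c) by move=> /andP[? ?]; lra.
  exact: (limit_pullback B1 B0 (ltW c0) (lexx 1) (lexx 0) (ltW c1) U1 U0 eq10 mi
    (fneq m 0 m2 H0) (fneq m c m2 Hc) (other_branch_limit B0 (lexx 0) (ltW c1) m0 nm
    (fneq m 0 m2 H0) (fneq m c m2 Hc)) Cm).
have down3 m : (2 < m)%N -> CL (cn m) -> CL (cn 3).
  elim: m => [|m IH]; first by (move=> h; exfalso; rewrite ltn0 in h).
  rewrite ltnS leq_eqVlt => /predU1P[<-|m2]; first exact: id.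
  by move=> /(down m m2); exact: IH.
move=> n2 /(down3 n n2) C3.
have n13 : cn 3 <> cn 1 by move=> /esym; exact: (orbit_injective orbit_dense).
have n23 : cn 3 <> cn 2 by move=> /esym; exact: (orbit_injective orbit_dense).
suff Z2 : vanishing (cn 2).
  have c01' : 0 <= c <= 1 by rewrite !ltW.
  exact: not_vanishing_critical (@vanishing_iter 2 c c01' Z2).
case: (orbit_start Hf orbit_dense) => -[fc fe fi]; move: n13 n23 C3; rewrite /= fc fe => n13 n23 C3.
  have e0 : (0 = 0 :> R /\ 0 = 0 :> R) \/ (0 = c /\ c = 1) by left.
  have xc : f 0 <> f c by rewrite fc.
  have x1 : f 0 <> f 1 by rewrite fe.
  have H := @other_branch_limit c 1 s1 2 B1 (ltW c0) (lexx _) isT.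
  rewrite /= fc fe in H.
  have nm : ~ (c < (0 : R) < (1 : R)) by rewrite (lt_gtF c0).
  exact: (vanishing_endpoint B0 B1 (ltW c0) (lexx 1) U1 rho_eq e0 fi xc x1
    (H nm n13 n23) C3).
have e0 : (1 = c /\ c = 0) \/ (1 = 1 :> R /\ 1 = 1 :> R) by right.
have xc : f 1 <> f 0 by rewrite fe.
have x1 : f 1 <> f c by rewrite fc.
have H := @other_branch_limit 0 c s0 2 B0 (lexx _) (ltW c1) isT.
rewrite /= fc fe in H.
have nm : ~ ((0 : R) < (1 : R) < c) by rewrite (lt_gtF c1) andbF.
exact: (vanishing_endpoint B1 B0 (lexx 0) (ltW c1) U0 eq10 e0 fi xc x1
  (H nm n23 n13) C3).
Qed.

Lemma dense_orbit_discontinuities a b : 0 <= a -> a < b -> b <= 1 ->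
  exists2 p, a < p < b & ~ {for p, continuous rho}.
Proof.
move=> a0 ab b1; have xi : 0 <= (a + b) / 2 <= 1 by apply/andP; split; lra.
have d0 : 0 < (b - a) / 2 by lra.
have [n n0] := orbit_near orbit_dense xi d0.
rewrite ltr_norml => /andP[h1 h2].
have ni : a < cn n < b by apply/andP; split; lra.
exists (cn n) => // /within_continuous h.
(* [cn 1] and [cn 2] are the ends of [[0, 1]], which lie outside []a, b[]. *)
have n2 : (2 < n)%N.
  rewrite ltnNge; apply/negP => n2.
  have n12 : n = 1%N \/ n = 2%N.
    by move: n0 n2; clear; case: n => [|[|[|n]]]// _ _; [left|right].
  have e : cn n = 0 \/ cn n = 1.
    by case: n12 => ->; case: (endpoint_orbit Hf orbit_dense) => -[e1 e2];
      first [left; exact: e1|right; exact: e1|left; exact: e2|right; exact: e2].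
  by case: e => e; move: ni; rewrite e => /andP[? ?]; lra.
by apply: (orbit_no_limit n2); apply/cvg_ex; exists (rho (cn n)).
Qed.

End dense_orbit.

(** * Orbits and exceptional points *)

Lemma smooth_branch (R : realType) n (a b p q : R) (f g : R -> R) (s lam : R) :
  a <= p -> q <= b -> class_C n.+1 `[a, b] g -> (forall x : R, p < x < q -> f x = g x) ->
  0 < lam -> s = 1 \/ s = -1 ->
  (forall x : R, p < x < q -> lam <= s * deriv_within `[a, b] g x) ->
  [/\ forall y : R, p < y < q -> derive1 f y = deriv_within `[a, b] g y,
      smooth_on n.+1 `]p, q[ f & smooth_on n `]p, q[ (fun y => `|derive1 f y|^-1)].
Proof.
move=> ap qb gC fg l0 s1 gs.
have pqE (x : R) : (`]p, q[%classic : set R) x <-> p < x < q by rewrite /= in_itv.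
have oU : open (`]p, q[%classic : set R) by exact: interval_open.
have fS : smooth_on n.+1 `]p, q[ f.
  apply: (smooth_on_ext oU _ (class_C_smooth_on ap qb gC)).
  by move=> y /pqE /fg.
have df (y : R) : p < y < q -> derive1 f y = deriv_within `[a, b] g y.
  move=> /andP[py yq]; apply: is_derive_derive1.
  apply: (@is_derive_local _ g f y _ (Num.min (y - p) (q - y))).
  - by rewrite lt_min !subr_gt0 py.
  - move=> z; rewrite lt_min !ltr_norml => /andP[/andP[? ?] /andP[? ?]].
    by rewrite fg//; apply/andP; split; clra.
  - by apply: (class_C_is_derive gC); rewrite (le_lt_trans ap py) (lt_le_trans yq qb).
split => //.
have sd : smooth_on n `]p, q[ (fun y => s * derive1 f y).
  by apply: smooth_onM => //; [exact: smooth_on_cst|case: fS => _ []].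
have ns (y : R) : p < y < q -> `|derive1 f y| = s * derive1 f y.
  move=> yi; have h : 0 < s * derive1 f y by rewrite df//; exact: lt_le_trans (gs y yi).
  by rewrite -[RHS]ger0_norm ?(ltW h)// normrM; case: s1 => ->; rewrite ?normrN normr1 mul1r.
apply: (@smooth_on_ext _ _ _ (fun y => (s * derive1 f y)^-1)) => //.
  by move=> y /pqE /ns ->.
apply: (smooth_onV oU l0) => // y /pqE yi.
by rewrite ger0_norm df// ?gs//; apply: le_trans (gs y yi); exact: ltW.
Qed.

(** The lower bound on the derivatives of the extended branches fixes the orientations; the upper
    bound [L] comes from compactness of their domains. *)
Lemma peum_expanding (R : realType) k (f : R -> R) (c eps lam : R) (f1 f2 : R -> R) :
  peum f c eps lam f1 f2 -> class_C k.+1 `[0, c + eps] f1 -> class_C k.+1 `[c - eps, 1] f2 ->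
  exists s0 s1 L,
    [/\ expanding_unimodal f c s0 s1 lam L,
        smooth_on k.+1 [set y | 0 < y < c \/ c < y < 1] f,
        smooth_on k [set y | 0 < y < c \/ c < y < 1] (fun y => `|derive1 f y|^-1),
        (forall y, 0 < y < c -> lam <= s0 * derive1 f y <= L) &
        (forall y, c < y < 1 -> lam <= s1 * derive1 f y <= L)].
Proof.
move=> [f01 [+ e0 lam1] [ff1 ff2 f12] [C1 C2] [b1 b2]] K1 K2.
rewrite in_itv/= => /andP[c0 c1]; have l0 : 0 < lam by exact: lt_trans lam1.
have [L1 hL1] := within_continuous_bounded (C1.2 1%N isT).
have [L2 hL2] := within_continuous_bounded (C2.2 1%N isT).
pose L := Num.max L1 L2.
have ce : c <= c + eps by rewrite lerDl ltW.
have ec : c - eps <= c by rewrite gerBl ltW.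
have h1 (x : R) : 0 < x < c -> `|deriv_within `[0, c + eps] f1 x| <= L.
  move=> /andP[u v]; rewrite le_max; apply/orP; left; apply: hL1.
  by rewrite (ltW u) (le_trans (ltW v)).
have h2 (x : R) : c < x < 1 -> `|deriv_within `[c - eps, 1] f2 x| <= L.
  move=> /andP[u v]; rewrite le_max; apply/orP; right; apply: hL2.
  by rewrite (ltW v) (le_trans ec (ltW u)).
have [s0 [s0E d0 M0]] := class_C_branch (lexx _) c0 ce l0 C1 b1 h1.
have [s1 [s1E d1 M1]] := class_C_branch ec c1 (lexx _) l0 C2 b2 h2.
have e1 (x : R) : 0 <= x <= c -> f x = f1 x by move=> xi; apply: ff1; rewrite in_itv.
have e2 (x : R) : c <= x <= 1 -> f x = f2 x by move=> xi; apply: ff2; rewrite in_itv.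
have [D1 S1 V1] := smooth_branch (lexx _) ce K1 (fun x (h : 0 < x < c) =>
  e1 x (let: conj a b := andP h in introT andP (conj (ltW a) (ltW b)))) l0 s0E d0.
have [D2 S2 V2] := smooth_branch ec (lexx _) K2 (fun x (h : c < x < 1) =>
  e2 x (let: conj a b := andP h in introT andP (conj (ltW a) (ltW b)))) l0 s1E d1.
have UE : [set y : R | 0 < y < c \/ c < y < 1] = `]0, c[ `|` `]c, 1[.
  by apply/seteqP; split => y /=; rewrite !in_itv.
have sn (s d : R) : s = 1 \/ s = -1 -> `|d| <= L -> s * d <= L.
  move=> sE h; case: sE => ->; rewrite ?mul1r ?mulN1r; apply: le_trans h; first exact: ler_norm.
  by rewrite -normrN; exact: ler_norm.
exists s0, s1, L; rewrite UE; split; [split| | | |] => //.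
- by rewrite c0 c1.
- split=> // x y x0 xy yc; rewrite !e1; first exact: M0.
    by rewrite x0 (le_trans xy yc).
  by rewrite (le_trans x0 xy).
- split=> // x y x0 xy yc; rewrite !e2; first exact: M1.
    by rewrite x0 (le_trans xy yc).
  by rewrite (le_trans x0 xy).
- exact: (smooth_onU S1 S2).
- exact: (smooth_onU V1 V2).
- by move=> y yi; rewrite D1// d0// sn// h1.
- by move=> y yi; rewrite D2// d1// sn// h2.
Qed.

(** * Points whose grand orbit misses a countable set *)

Section grand_orbit.
Context (R : realType).
Variables (f : R -> R) (c s0 s1 lam L : R) (D : set R).
Hypothesis Hf : expanding_unimodal f c s0 s1 lam L.
Hypothesis D_count : countable D.
Hypothesis D0 : D 0.
Hypothesis D1 : D 1.
Hypothesis Dc : D c.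

(** Comparing all pairs of times makes the set stable under images as well as preimages. *)
Definition off_grand_orbit : set R :=
  [set x | 0 <= x <= 1 /\ forall m n d, D d -> iter m f x <> iter n f d].
Local Notation Gam := off_grand_orbit.

Lemma off_grand_orbitN x : Gam x -> ~ D x.
Proof. by move=> [_ H] /(H 0%N 0%N). Qed.

Lemma off_grand_orbit_iter m p x : Gam x -> [\/ p = 0, p = c | p = 1] -> x <> iter m f p.
Proof. by move=> [_ H] pE; apply: (H 0%N m); case: pE => ->. Qed.

Lemma off_grand_orbit_itv x : Gam x -> [/\ 0 < x < 1, x <> c, x <> f 0, x <> f c & x <> f 1].
Proof.
move=> Gx; have [/andP[x0 x1] _] := Gx.
have H m p : [\/ p = 0, p = c | p = 1] -> x <> iter m f p by exact: off_grand_orbit_iter.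
split; [|exact: (H 0%N c (Or32 _ _ erefl))|exact: (H 1%N 0 (Or31 _ _ erefl))
  |exact: (H 1%N c (Or32 _ _ erefl))|exact: (H 1%N 1 (Or33 _ _ erefl))].
rewrite !lt_neqAle x0 x1 !andbT; apply/andP; split; apply/eqP => E.
  by apply: (H 0%N 0 (Or31 _ _ erefl)).
by apply: (H 0%N 1 (Or33 _ _ erefl)).
Qed.

Lemma off_grand_orbit_preim x y : Gam x -> 0 <= y <= 1 -> f y = x -> Gam y.
Proof.
move=> [_ H] y01 fy; split => // -[|m] n d Dd E.
  by apply: (H 0%N n.+1 d Dd); rewrite /= -E.
by apply: (H m n d Dd); rewrite -fy -iterSr.
Qed.

Lemma off_grand_orbit_image x : Gam x -> Gam (f x).
Proof.
have [_ f01 _ _ _] := Hf; move=> [x01 H]; split; first exact: f01.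
by move=> m n d Dd; rewrite -iterSr; exact: H.
Qed.

Lemma countable_preimage (E : set R) : countable E -> countable [set x : R | 0 <= x <= 1 /\ E (f x)].
Proof.
have [/andP[c0 c1] _ _ B0 B1] := Hf => cE.
apply: (@sub_countable _ _ _ ((branch_inv 0 c f s0 @` E) `|` (branch_inv c 1 f s1 @` E))).
  apply: subset_card_le => x [/andP[x0 x1] Ex].
  have [xc|cx] := leP x c; [left|right]; exists (f x) => //.
    by rewrite (branch_fK B0)// x0.
  by rewrite (branch_fK B1)// (ltW cx).
pose F (b : bool) := if b then branch_inv 0 c f s0 @` E else branch_inv c 1 f s1 @` E.
apply: (@sub_countable _ _ _ (\bigcup_b F b)).
  by apply: subset_card_le => x [Fx|Fx]; [exists true|exists false].
apply: bigcup_countable => [|[] _]; first exact: countableP.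
- exact: sub_countable (card_image_le _ _) cE.
- exact: sub_countable (card_image_le _ _) cE.
Qed.

(** The excluded points are iterated preimages of countably many points, and [f] has at most two
    preimages per point. *)
Lemma off_grand_orbit_countable : countable ([set x : R | 0 <= x <= 1] `\` Gam).
Proof.
have [_ f01 _ _ _] := Hf.
pose A m n := [set x : R | 0 <= x <= 1 /\ (iter n f @` D) (iter m f x)].
have cA m n : countable (A m n).
  rewrite /A; elim: m => [|m IH].
    apply: (@sub_countable _ _ _ (iter n f @` D)); first by apply: subset_card_le => x [].
    exact: sub_countable (card_image_le _ _) D_count.
  apply: sub_countable (countable_preimage IH); apply: subset_card_le => x [x01].
  by rewrite iterSr => ?; split => //; split => //; exact: f01.
apply: (@sub_countable _ _ _ (\bigcup_m \bigcup_n A m n)).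
  apply: subset_card_le => x [x01 nG]; apply: contrapT => H; apply: nG; split => // m n d Dd E.
  by apply: H; exists m => //; exists n => //; split => //; exists d.
by apply: bigcup_countable => // m _; exact: bigcup_countable.
Qed.

End grand_orbit.

(** * Exceptional balls and decay of oscillations *)

Lemma bernoulli_le (R : realType) (a : R) n : 0 <= a <= 1 -> 1 - n%:R * a <= (1 - a) ^+ n.
Proof.
move=> /andP[a0 a1]; elim: n => [|n IH]; first by rewrite mul0r subr0 expr0.
rewrite exprS -natr1; have a1' : 0 <= 1 - a by rewrite subr_ge0.
apply: le_trans (ler_wpM2l a1' IH).
have : 0 <= n%:R * a * a by rewrite !mulr_ge0.
clra.
Qed.

Lemma root_above (R : realType) (th : R) n : 0 < th < 1 -> exists r, 0 < r < 1 /\ th < r ^+ n.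
Proof.
(* By Bernoulli [(1 - a) ^ n] is at least [1 - n * a], and [n * a < (1 - th) / 2]. *)
move=> /andP[t0 t1]; pose a := (1 - th) / (2 * n.+1%:R).
have n0 : (0 : R) < 2 * n.+1%:R by rewrite mulr_gt0.
have a0 : 0 < a by rewrite divr_gt0// subr_gt0.
have na : n.+1%:R * a = (1 - th) / 2.
  by rewrite /a; field; rewrite ?lt0r_neq0 ?ltr0n//; rewrite -natr1 gt_eqF// ltr_wpDl.
have na1 : n%:R * a + a = (1 - th) / 2 by rewrite -na -natr1 mulrDl mul1r.
have na0 : 0 <= n%:R * a by rewrite mulr_ge0// ltW.
exists (1 - a); split; first by apply/andP; split; clra.
apply: lt_le_trans (bernoulli_le n _); first clra.
by apply/andP; split; clra.
Qed.

(** Four sequences are interleaved modulo 4: the orbits of 0, [c] and 1, and an enumeration of [C]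
    with infinite repetition. The points of time [m] have index below [4 * m.+1], hence radius above
    [(r ^ 4) ^ m.+1]. *)
Lemma exceptional_balls (R : realType) (f : R -> R) (c r : R) (C : set R) : countable C -> 0 < r < 1 ->
  exists z, forall x, ~ limsup_balls z r x -> ~ C x /\ exists n0, forall m p, (n0 <= m)%N ->
    [\/ p = 0, p = c | p = 1] -> (r ^+ 4) ^+ m.+1 < `|x - iter m f p|.
Proof.
move=> cC /andP[r0 r1]; have [e he] := countable_enumeration cC.
pose p j : R := if j == 0%N then 0 else if j == 1%N then c else 1.
pose z i := if (i %% 4 == 3)%N then e (i %/ 4)%N else iter (i %/ 4) f (p (i %% 4)%N).
have zE q j : (j < 3)%N -> z (4 * q + j)%N = iter q f (p j).
  move=> j3; have j4 : (j < 4)%N by exact: ltn_trans j3 _.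
  rewrite /z mulnC divnMDl// modnMDl modn_small// divn_small// addn0.
  by case: eqP j3 => // ->.
have zE3 q : z (4 * q + 3)%N = e q.
  by rewrite /z mulnC divnMDl// modnMDl modn_small// divn_small// addn0.
exists z => x; rewrite /limsup_balls/= => /existsNP[n0 hn].
have {}hn i : (n0 <= i)%N -> r ^+ i <= `|x - z i|.
  by move=> ni; rewrite leNgt; apply/negP => h; apply: hn; exists i.
split=> [Cx|].
  have [i ni xE] := he x Cx n0.
  have ni' : (n0 <= 4 * i + 3)%N.
    by apply: (leq_trans ni); rewrite (leq_trans (leq_pmull i (isT : 0 < 4)%N))// leq_addr.
  by have := hn _ ni'; rewrite zE3 xE subrr normr0; apply/negP; rewrite -ltNge exprn_gt0.
have main m j : (j < 3)%N -> (n0 <= m)%N -> (r ^+ 4) ^+ m.+1 < `|x - iter m f (p j)|.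
  move=> j3 nm; rewrite -zE//; apply: lt_le_trans (hn _ _).
    by rewrite -exprM ltr_iXn2l// mulnS addnC ltn_add2r (ltn_trans j3).
  by apply: (leq_trans nm); rewrite (leq_trans (leq_pmull m (isT : 0 < 4)%N))// leq_addr.
exists n0 => m q nm; case => ->; [exact: (main m 0%N)|exact: (main m 1%N)|exact: (main m 2%N)].
Qed.

Lemma orbit_distance (R : realType) (f : R -> R) (c x : R) n :
  (forall m p, (m < n)%N -> [\/ p = 0, p = c | p = 1] -> x <> iter m f p) ->
  exists2 d : R, 0 < d & forall m p, (m < n)%N -> [\/ p = 0, p = c | p = 1] -> d <= `|x - iter m f p|.
Proof.
elim: n => [|n IH] H; first by exists 1.
have [|d d0 hd] := IH; first by move=> m p mn; apply: H; exact: ltnW.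
have pos p : [\/ p = 0, p = c | p = 1] -> 0 < `|x - iter n f p|.
  by move=> pE; rewrite normr_gt0 subr_eq0; apply/eqP; exact: H.
have p0 := pos 0 (Or31 _ _ erefl); have pc := pos c (Or32 _ _ erefl).
have p1 := pos 1 (Or33 _ _ erefl).
exists (Num.min d (Num.min `|x - iter n f 0| (Num.min `|x - iter n f c| `|x - iter n f 1|))).
  by rewrite !lt_min d0 p0 pc.
move=> m p; rewrite ltnS leq_eqVlt => /predU1P[->|mn] pE; rewrite !ge_min; last by rewrite hd.
by case: pE => ->; rewrite lexx ?orbT.
Qed.

(** Let [h = |y - x|] with [q ^ n.+2 < h <= q ^ n.+1]. The segment avoids the orbit points up to
    time [n], so the oscillation is at most [M * th ^ n]. This equals [M * u ^ n * (q ^ k) ^ n] with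
    [u = th / q ^ k < 1], while [(q ^ k) ^ n.+2 <= h ^ k]. *)
Lemma small_oscillation (R : realType) (f : R -> R) (c : R) (Gam : set R) (g : R -> R)
    (d th M q x : R) k n0 :
  0 < d -> 0 < M -> 0 < th -> 0 < q < 1 -> th < q ^+ k -> Gam x ->
  (forall m p, [\/ p = 0, p = c | p = 1] -> x <> iter m f p) ->
  (forall m p, (n0 <= m)%N -> [\/ p = 0, p = c | p = 1] -> q ^+ m.+1 < `|x - iter m f p|) ->
  (forall n y z, Gam y -> Gam z -> y <= z -> z - y <= d -> avoids f c n y z ->
    `|g z - g y| <= M * th ^+ n) ->
  forall e, 0 < e -> exists2 d' : R, 0 < d' &
    forall y, Gam y -> `|y - x| < d' -> `|g y - g x| <= e * `|y - x| ^+ k.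
Proof.
move=> d0 M0 t0 /andP[q0 q1] tq Gx xn far gM e e0.
have [|dl dl0 near_orbit] := @orbit_distance R f c x n0; first by move=> m p _; exact: xn.
pose u := th / q ^+ k; have qk0 : 0 < q ^+ k by rewrite exprn_gt0.
have u1 : 0 <= u < 1 by rewrite divr_ge0 ?(ltW t0) ?(ltW qk0)//= ltr_pdivrMr// mul1r.
have e1 : 0 < e * (q ^+ k) ^+ 2 / M by rewrite divr_gt0 ?mulr_gt0 ?exprn_gt0.
have [N0 hN0] := geometric_lt u1 e1.
(* [dl] takes care of the finitely many times before [n0]. The last bound makes [n] exceed [N0], so
   that [u ^ n] absorbs [M] and the lost factor [(q ^ k) ^ 2]. *)
exists (Num.min d (Num.min dl (q ^+ N0.+2))); first by rewrite !lt_min d0 dl0 exprn_gt0.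
move=> y Gy; rewrite !lt_min => /and3P[yd ydl yq].
have [->|yx] := eqVneq y x.
  by rewrite !subrr normr0; apply: mulr_ge0; [exact: ltW|exact: exprn_ge0].
pose h := `|y - x|; have h0 : 0 < h by rewrite normr_gt0 subr_eq0.
have [n1 hn1] : exists n, q ^+ n < h.
  have q01 : 0 <= q < 1 by rewrite ltW.
  by have [n hn] := geometric_lt q01 h0; exists n; apply: hn.
have exn : exists n, (fun n => q ^+ n < h) n by exists n1.
case: (ex_minnP exn) => n2 hn2 min2.
have n2N : (N0.+2 < n2)%N.
  rewrite ltnNge; apply/negP => h'; have : q ^+ n2 < q ^+ N0.+2 by exact: lt_trans hn2 yq.
  by apply/negP; rewrite -leNgt; apply: ler_wiXn2l => //; exact: ltW.
case: n2 => [|[|n]]// in hn2 min2 n2N *.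
have hle : h <= q ^+ n.+1.
  by rewrite leNgt; apply/negP => /min2; rewrite ltnn.
have av a b : `|a - x| <= h -> `|b - x| <= h -> avoids f c n a b.
  move=> ah bh m p /andP[m0 mn] pE /andP[ua ub].
  have hlt : h < `|x - iter m f p|.
    have [mn0|n0m] := ltnP m n0; first exact: lt_le_trans (near_orbit m p mn0 pE).
    apply: le_lt_trans (far m p n0m pE); apply: (le_trans hle).
    by apply: ler_wiXn2l; [exact: ltW|exact: ltW|].
  move: hlt; rewrite ltNge => /negP; apply.
  by move: ah bh; rewrite !ler_norml => /andP[? ?] /andP[? ?]; apply/andP; split; clra.
have osc : `|g y - g x| <= M * th ^+ n.
  have hh : `|x - x| <= h by rewrite subrr normr0 ltW.
  have [xy|/ltW yx'] := leP x y.
    apply: gM => //; last exact: av.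
    by apply: ltW; apply: le_lt_trans yd; exact: ler_norm.
  rewrite distrC; apply: gM => //; last exact: av.
  by apply: ltW; apply: le_lt_trans yd; rewrite distrC; exact: ler_norm.
apply: (le_trans osc); rewrite -/h.
have thE : th ^+ n = u ^+ n * (q ^+ k) ^+ n by rewrite -exprMn /u divfK// gt_eqF.
have un : u ^+ n < e * (q ^+ k) ^+ 2 / M by apply: hN0; rewrite -ltnS -ltnS ltnW.
have qh : (q ^+ k) ^+ n.+2 <= h ^+ k.
  rewrite -exprM mulnC exprM; apply: lerXn2r; rewrite ?nnegrE ?exprn_ge0 ?ltW//.
have le1 : M * u ^+ n <= e * (q ^+ k) ^+ 2.
  by rewrite mulrC -ler_pdivlMr// ltW.
rewrite thE mulrA.
apply: (@le_trans _ _ (e * (q ^+ k) ^+ 2 * (q ^+ k) ^+ n)).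
  by apply: ler_wpM2r le1; rewrite exprn_ge0// ltW.
rewrite -mulrA -exprD add2n; apply: ler_wpM2l qh; exact: ltW.
Qed.

(** * Invariant densities *)

Lemma averaged_side_limits (R : realType) (u : R -> R) (y : R) :
  averaged_at_discontinuities u -> 0 < y < 1 ->
  exists l1 l2 : R, [/\ u z @[z --> y^'-] --> l1, u z @[z --> y^'+] --> l2 & u y = (l1 + l2) / 2].
Proof.
move=> hu yi; case: (pselect {for y, continuous u}) => [cu|nc]; last first.
  by apply: hu => //; rewrite in_itv.
exists (u y), (u y); split; [exact: cvg_at_left_filter|exact: cvg_at_right_filter|lra].
Qed.

(** * Estimates passing from a dense set to averaged values *)

Section limits_along_dense_set.
Context (R : realType).
Variables (u T B : R -> R) (Gam : set R) (a d y : R).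
Hypothesis uT : forall z, Gam z -> `|z - a| < d -> `|u z - T z| <= B z.
Hypothesis T_cont : {for y, continuous T}.
Hypothesis B_cont : {for y, continuous B}.
Hypothesis ya : `|y - a| < d.

Lemma approximable_bound l :
  (forall e, 0 < e -> exists z, [/\ Gam z, `|z - y| < e & `|u z - l| < e]) -> `|l - T y| <= B y.
Proof.
move=> H; rewrite leNgt; apply/negP => lt.
pose e := (`|l - T y| - B y) / 4; have e0 : 0 < e by rewrite divr_gt0// subr_gt0.
have [dT dT0 hT] := (continuous_epsP _ _).1 T_cont _ e0.
have [dB dB0 hB] := (continuous_epsP _ _).1 B_cont _ e0.
pose m := Num.min (Num.min e (d - `|y - a|)) (Num.min dT dB).
have m0 : 0 < m by rewrite !lt_min e0 subr_gt0 ya dT0.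
have [z [Gz]] := H m m0; rewrite !lt_min.
move=> /andP[/andP[_ zd] /andP[zT zB]] /andP[/andP[ze _] _].
have za : `|z - a| < d.
  rewrite (_ : z - a = (z - y) + (y - a)); last ring.
  by apply: le_lt_trans (ler_normD _ _) _; rewrite -ltrBrDr.
have h1 := uT Gz za; have h2 := hT z zT; have h3 := hB z zB.
have h4 : `|l - T y| <= `|u z - l| + (`|u z - T z| + `|T z - T y|).
  rewrite (_ : l - T y = - (u z - l) + ((u z - T z) + (T z - T y))); last ring.
  apply: le_trans (ler_normD _ _) _; rewrite normrN lerD2l; exact: ler_normD.
have h5 : 4 * e = `|l - T y| - B y by rewrite /e; field.
move: h3; rewrite ltr_norml => /andP[_ h3].
by move: (`|l - T y|) (`|u z - l|) (`|u z - T z|) (`|T z - T y|) h1 h2 h4 h5 ze; intros; lra.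
Qed.

Hypothesis Gam_count : countable ([set x | 0 <= x <= 1] `\` Gam).
Hypothesis y01 : 0 < y < 1.

Lemma right_limit_bound (l : R) : u z @[z --> y^'+] --> l -> `|l - T y| <= B y.
Proof.
move=> /at_right_eps H; apply: approximable_bound => e e0.
have [e1 e10 he1] := H e e0; have /andP[y0 y1] := y01.
have [|||z /andP[yz zm] Gz] := @Gam_dense _ Gam Gam_count y (Num.min 1 (y + Num.min e e1)).
- exact: ltW.
- by rewrite lt_min y1 ltrDl lt_min e0.
- by rewrite ge_min lexx.
move: zm; rewrite lt_min -ltrBlDl lt_min => /and3P[_ ze ze1].
exists z; split => //; first by rewrite gtr0_norm// subr_gt0.
by apply: he1 => //; rewrite -ltrBlDl.
Qed.

Lemma left_limit_bound (l : R) : u z @[z --> y^'-] --> l -> `|l - T y| <= B y.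
Proof.
move=> /at_left_eps H; apply: approximable_bound => e e0.
have [e1 e10 he1] := H e e0; have /andP[y0 y1] := y01.
have [|||z /andP[zm zy] Gz] := @Gam_dense _ Gam Gam_count (Num.max 0 (y - Num.min e e1)) y.
- by rewrite le_max lexx.
- by rewrite gt_max y0 gtrBl lt_min e0.
- exact: ltW.
move: zm; rewrite gt_max ltrBlDr -ltrBlDl lt_min => /and3P[_ ze ze1].
exists z; split => //; first by rewrite distrC gtr0_norm// subr_gt0.
by apply: he1 => //; rewrite ltrBlDr -ltrBlDl.
Qed.

(** Both side limits at [y] inherit the bound from points of the dense set [Gam], and a convex bound
    passes to their average. *)
Lemma averaged_bound : averaged_at_discontinuities u -> `|u y - T y| <= B y.
Proof.
move=> hu; have [l1 [l2 [/left_limit_bound h1 /right_limit_bound h2 ->]]] := averaged_side_limits hu y01.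
move: h1 h2; rewrite !ler_norml => /andP[? ?] /andP[? ?]; apply/andP; split; lra.
Qed.

End limits_along_dense_set.

Section densities.
Context (R : realType) (k : nat).
Variables (f : R -> R) (c s0 s1 lam L : R) (mu : probability (measurableTypeR R) R).
Variable (r : nat -> R -> R).
Local Notation U := [set y | 0 < y < c \/ c < y < 1].
Local Notation df := (derive1 f).

Hypothesis Hf : expanding_unimodal f c s0 s1 lam L.
Hypothesis fU : smooth_on k.+1 U f.
Hypothesis absf : smooth_on k U (fun y => `|df y|^-1).
Hypothesis df0 : forall y, 0 < y < c -> lam <= s0 * df y <= L.
Hypothesis df1 : forall y, c < y < 1 -> lam <= s1 * df y <= L.
Hypothesis mu_f : acip f mu.
Hypothesis mu_r : density mu (r 0%N).
Hypothesis r_bv : forall j, (j <= k)%N -> bounded_variation 0 1 (r j).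
Hypothesis r_ae : forall j, (j < k)%N -> (@lebesgue_measure R).-negligible
  [set x : R | 0 < x < 1 /\ ~ is_derive x 1 (r j) (r j.+1 x)].

Lemma expanding_derivative_bounds y : U y -> lam <= `|df y| <= L.
Proof.
have [_ _ lam1 [_ _ s0E _] [_ _ s1E _]] := Hf.
have key (s : R) : s = 1 \/ s = -1 -> lam <= s * df y <= L -> lam <= `|df y| <= L.
  move=> sE /andP[h1 h2]; rewrite (_ : `|df y| = s * df y) ?h1//.
  rewrite -[RHS]ger0_norm; first by rewrite normrM; case: sE => ->; rewrite ?normrN normr1 mul1r.
  by apply: le_trans h1; apply: ltW; exact: lt_trans lam1.
by case=> yi; [exact: (key s0 s0E (df0 yi))|exact: (key s1 s1E (df1 yi))].
Qed.

Lemma expanding_derivative_ge y : U y -> lam <= `|df y|.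
Proof. by move=> /expanding_derivative_bounds/andP[]. Qed.

Definition singular_points : set R := [set x | [\/ x = 0, x = c | x = 1] \/
  exists2 l, (l <= k)%N & 0 < x < 1 /\ ~ {for x, continuous (r l)}].

Local Notation Gam := (off_grand_orbit f singular_points).

Lemma singular_points_countable : countable singular_points.
Proof.
pose F (i : nat) : set R := if i is i'.+3 then
    if (i' <= k)%N then [set x : R | 0 < x < 1 /\ ~ {for x, continuous (r i')}] else set0
  else if i == 0%N then [set 0] else if i == 1%N then [set c] else [set 1].
apply: (@sub_countable _ _ _ (\bigcup_i F i)).
  apply: subset_card_le => x [[] ->|[l lk xl]].
  - by exists 0%N.
  - by exists 1%N.
  - by exists 2%N.
  - by exists l.+3 => //=; rewrite lk.
apply: bigcup_countable => // -[|[|[|i]]] _ /=.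
- exact: countable1.
- exact: countable1.
- exact: countable1.
- by case: leqP => // ik; exact: bounded_variation_discontinuities (r_bv ik).
Qed.

Let S0 : singular_points 0. Proof. by left; constructor 1. Qed.
Let Sc : singular_points c. Proof. by left; constructor 2. Qed.
Let S1 : singular_points 1. Proof. by left; constructor 3. Qed.

Lemma regular_itv x : Gam x -> [/\ 0 < x < 1, x <> c, x <> f 0, x <> f c & x <> f 1].
Proof. exact: off_grand_orbit_itv. Qed.

Lemma regular_preim x y : Gam x -> 0 <= y <= 1 -> f y = x -> Gam y.
Proof. exact: off_grand_orbit_preim. Qed.

Lemma regular_image x : Gam x -> Gam (f x).
Proof. exact: (off_grand_orbit_image Hf). Qed.

Lemma regular_count : countable ([set x : R | 0 <= x <= 1] `\` Gam).
Proof. exact: (off_grand_orbit_countable Hf singular_points_countable). Qed.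

Lemma regular_cont l x : (l <= k)%N -> Gam x -> {for x, continuous (r l)}.
Proof.
move=> lk Gx; have [xi _ _ _ _] := regular_itv Gx.
apply: contrapT => nc; apply: (off_grand_orbitN Gx); right; by exists l.
Qed.

Definition primitive l (x : R) : R := \int[lebesgue_measure]_(t in `[0, x]) r l t.

Lemma primitive_deriv l x : (l <= k)%N -> Gam x -> is_derive x 1 (primitive l) (r l x).
Proof.
move=> lk Gx; have [_] := bounded_variation_primitive (r_bv lk).
by apply; [have [] := regular_itv Gx|exact: regular_cont].
Qed.

Lemma primitive_lipschitz l : (l <= k)%N -> exists2 M : R, 0 < M &
  forall x y : R, 0 <= x <= 1 -> 0 <= y <= 1 -> `|primitive l y - primitive l x| <= M * `|y - x|.
Proof. by move=> lk; have [] := bounded_variation_primitive (r_bv lk). Qed.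

Lemma primitive_cont l x : (l <= k)%N -> 0 < x < 1 -> {for x, continuous (primitive l)}.
Proof.
move=> lk /andP[x0 x1]; have [M M0 hM] := primitive_lipschitz lk.
apply/continuous_epsP => e e0; exists (Num.min (e / M) (Num.min x (1 - x))).
  by rewrite !lt_min divr_gt0// x0 subr_gt0.
move=> y; rewrite !lt_min => /and3P[ye yx yx1].
have xi : 0 <= x <= 1 by rewrite !ltW.
have yi : 0 <= y <= 1.
  by move: yx yx1; rewrite !ltr_norml => /andP[? ?] /andP[? ?]; apply/andP; split; lra.
by apply: le_lt_trans (hM x y xi yi) _; rewrite mulrC -ltr_pdivlMr.
Qed.

Lemma density_invariance j x : (j <= k)%N -> Gam x -> r j x =
  pushed 0 c f s0 (coef_comb f r j) x + pushed c 1 f s1 (coef_comb f r j) x.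
Proof.
have [c01 f01 lam1 B0 B1] := Hf; have [mu01 mu_ac mu_inv] := mu_f.
have l0 : 0 < lam by exact: lt_trans lam1.
have [K0 hK] := invariant_primitive mu_r mu_ac (r_bv (leq0n k)) c01 f01 B0 B1 mu_inv.
apply: (@invariance_equation _ f c s0 s1 lam L k r (primitive 0) K0 Gam Hf fU
  expanding_derivative_ge absf _ _ regular_itv regular_preim regular_count regular_cont _ hK r_ae).
- by move=> y /df0 /andP[h _]; exact: lt_le_trans h.
- by move=> y /df1 /andP[h _]; exact: lt_le_trans h.
- by move=> y; exact: primitive_deriv.
Qed.

(** The majorant is that of [r l] plus the Lipschitz constant of the primitive times the
    identity. *)
Lemma density_gap_majorant l : (l < k)%N -> exists v : R -> R, {homo v : x y / x <= y} /\
  forall y z, Gam y -> Gam z -> y <= z ->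
    `|r l z - primitive l.+1 z - (r l y - primitive l.+1 y)| <= v z - v y.
Proof.
move=> lk; have [v [vh hv]] := bounded_variation_majorant (r_bv (ltnW lk)).
have [M M0 hM] := primitive_lipschitz lk.
exists (fun x => v x + M * x); split.
  by move=> x y xy; apply: lerD; [exact: vh|exact: ler_wpM2l (ltW M0) _ _ xy].
move=> y z Gy Gz yz; have [/andP[y0 y1] _ _ _ _] := regular_itv Gy.
have [/andP[z0 z1] _ _ _ _] := regular_itv Gz.
have h1 := hv y z (ltW y0) yz (ltW z1).
have yi : 0 <= y <= 1 by rewrite !ltW.
have zi : 0 <= z <= 1 by rewrite !ltW.
have h2 := hM y z yi zi; rewrite (ger0_norm (_ : 0 <= z - y)) ?subr_ge0// in h2.
rewrite (_ : r l z - primitive l.+1 z - (r l y - primitive l.+1 y) =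
  (r l z - r l y) - (primitive l.+1 z - primitive l.+1 y)); last ring.
apply: le_trans (ler_normB _ _) _.
rewrite (_ : v z + M * z - (v y + M * y) = (v z - v y) + M * (z - y)); last ring.
exact: lerD.
Qed.


Lemma density_contraction : exists d th M : R, [/\ 0 < d, 0 < th < 1, 0 < M &
  forall n l y z, (l < k)%N -> Gam y -> Gam z -> y <= z -> z - y <= d -> avoids f c n y z ->
    `|r l z - primitive l.+1 z - (r l y - primitive l.+1 y)| <= M * th ^+ n].
Proof.
exact: (gap_contraction Hf fU expanding_derivative_ge absf regular_itv regular_preim regular_count
  primitive_deriv primitive_cont density_invariance density_gap_majorant).
Qed.

(** One exceptional set serves all orders [i <= k]: order 1 will give differentiability, order [k]
    the expansion in the sense of Whitney. *)
Lemma expansion_at_typical_points : (0 < k)%N -> exists (z : nat -> R) (q : R), 0 < q < 1 /\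
  forall x, 0 <= x <= 1 -> ~ limsup_balls z q x -> Gam x /\
    forall i, (0 < i <= k)%N -> forall e, 0 < e -> exists2 d : R, 0 < d &
      forall y, Gam y -> `|y - x| < d ->
        `|r 0%N y - \sum_(m < i.+1) r m x / (m`!)%:R * (y - x) ^+ m| <= e * `|y - x| ^+ i.
Proof.
move=> k0; have [d [th [M [d0 /andP[t0 t1] M0 hM]]]] := density_contraction.
have th01 : 0 < th < 1 by rewrite t0.
(* The factor 4 pays for the interleaving in [exceptional_balls], after which [q ^ 4] is the
   effective ratio. *)
have [q [/andP[q0 q1] tq]] := root_above (4 * k) th01.
have q01 : 0 < q < 1 by rewrite q0.
have [z hz] := exceptional_balls f c regular_count q01.
exists z, q; split => // x x01 /hz[nC [n0 hn0]].
have Gx : Gam x by apply: contrapT => nG; apply: nC.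
split=> // i /andP[i0 ik] e e0.
have q4 : 0 < q ^+ 4 < 1 by rewrite exprn_gt0//= exprn_ilt1// ltW.
have tqi : th < (q ^+ 4) ^+ i.
  rewrite -exprM; apply: lt_le_trans tq _; apply: ler_wiXn2l; [exact: ltW|exact: ltW|].
  by rewrite leq_mul2l.
have off m p : [\/ p = 0, p = c | p = 1] -> x <> iter m f p.
  exact: (off_grand_orbit_iter S0 S1 Sc).
have small l e1 : (l < i)%N -> 0 < e1 -> exists2 d1, 0 < d1 & forall y, Gam y -> `|y - x| < d1 ->
    `|r l y - primitive l.+1 y - (r l x - primitive l.+1 x)| <= e1 * `|y - x| ^+ i.
  move=> li e10; apply: (small_oscillation (g := fun y => r l y - primitive l.+1 y)
    d0 M0 t0 q4 tqi Gx off hn0 _ e10).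
  by move=> n y1 y2; apply: hM; exact: leq_trans ik.
have Gam01 y : Gam y -> 0 < y < 1 by move=> /regular_itv[].
(* Applied with [i] in the role of [k], so that the polynomial ends with [r i]. *)
have := @taylor_expansion _ i r primitive Gam x Gx Gam01 regular_count (regular_cont ik Gx)
  (fun l y li => primitive_deriv (leq_trans li ik)) (fun l y li => primitive_cont (leq_trans li ik))
  small i (leqnn i) e e0.
move=> [d1 d10 hd1]; exists d1 => // y Gy yx; have := hd1 y Gy yx.
by rewrite /taylor_poly subnn; under eq_bigr do rewrite add0n.
Qed.

(** Cauchy criterion: for any [N] a neighbourhood of [w] avoids the first [N] images of 0, [c] and
    1, so the singular part oscillates there by at most [M * th ^ N], and the primitive is
    continuous at [w]. *)
Lemma density_cvg_off_orbit w : (0 < k)%N -> 0 < w < 1 ->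
  (forall m p, (0 < m)%N -> [\/ p = 0, p = c | p = 1] -> iter m f p <> w) ->
  cvg (r 0%N y @[y --> within Gam (nbhs w)]).
Proof.
move=> k0 wi off; have [d [th [M [d0 /andP[t0 t1] M0 hM]]]] := density_contraction.
have /andP[w0 w1] := wi.
have near e : 0 < e -> exists2 d1 : R, 0 < d1 & forall y z, Gam y -> Gam z ->
    `|y - w| < d1 -> `|z - w| < d1 -> `|r 0%N z - r 0%N y| < e.
  move=> e0; have e2 : 0 < e / 2 / M by rewrite !divr_gt0.
  have t01 : 0 <= th < 1 by rewrite ltW.
  have [N hN] := geometric_lt t01 e2.
  have offS m p : (m < N)%N -> [\/ p = 0, p = c | p = 1] -> w <> iter m f (f p).
    by move=> _ pE; rewrite -iterSr => /esym; exact: off.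
  have [dl dl0 hdl] : exists2 dl : R, 0 < dl & forall m p, (1 <= m <= N)%N ->
      [\/ p = 0, p = c | p = 1] -> dl <= `|w - iter m f p|.
    clear -offS off; elim: N {offS} => [|N [dl dl0 IH]]; first by exists 1 => // -[|m].
    have pos p : [\/ p = 0, p = c | p = 1] -> 0 < `|w - iter N.+1 f p|.
      by move=> pE; rewrite normr_gt0 subr_eq0; apply/eqP => /esym; exact: off.
    have p0 := pos 0 (Or31 _ _ erefl); have pc := pos c (Or32 _ _ erefl).
    have p1 := pos 1 (Or33 _ _ erefl).
    exists (Num.min dl (Num.min `|w - iter N.+1 f 0|
        (Num.min `|w - iter N.+1 f c| `|w - iter N.+1 f 1|))).
      by rewrite !lt_min dl0 p0 pc.
    move=> m p /andP[m1]; rewrite leq_eqVlt => /predU1P[->|mN] pE; rewrite !ge_min.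
      by case: pE => ->; rewrite lexx ?orbT.
    by rewrite IH// m1.
  have e4 : 0 < e / 4 by rewrite divr_gt0.
  have [dP dP0 hP] := (continuous_epsP _ _).1 (primitive_cont k0 wi) _ e4.
  exists (Num.min (d / 2) (Num.min dl dP)); first by rewrite !lt_min divr_gt0// dl0.
  have main y z : Gam y -> Gam z -> y <= z -> `|y - w| < Num.min (d / 2) (Num.min dl dP) ->
      `|z - w| < Num.min (d / 2) (Num.min dl dP) -> `|r 0%N z - r 0%N y| < e.
    move=> Gy Gz yz; rewrite !lt_min => /and3P[yd yl yP] /and3P[zd zl zP].
    have zy : z - y <= d.
      by move: yd zd; rewrite !ltr_norml => /andP[? ?] /andP[? ?]; lra.
    have av : avoids f c N y z.
      move=> m p mN pE /andP[u v]; have := hdl m p mN pE.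
      rewrite leNgt => /negP; apply; move: yl zl; rewrite !ltr_norml.
      by move=> /andP[? ?] /andP[? ?]; apply/andP; split; lra.
    have h1 := hM N 0%N y z k0 Gy Gz yz zy av.
    have h2 : M * th ^+ N < e / 2 by rewrite mulrC -ltr_pdivlMr// hN.
    have := hP y yP; have := hP z zP; have := le_lt_trans h1 h2; rewrite !ltr_norml.
    by move=> /andP[? ?] /andP[? ?] /andP[? ?]; apply/andP; split; lra.
  move=> y z Gy Gz yd zd; have [yz|/ltW zy] := leP y z; first exact: main.
  by rewrite distrC; exact: main.
have w01 : 0 <= w <= 1 by rewrite !ltW.
have pf := within_Gam_proper regular_count w01.
apply: cauchy_cvg; apply: cauchy_exP => e e0.
have [d1 d10 hd1] := near e e0.
have [|||y /andP[y1 y2] Gy] := @Gam_dense _ Gam regular_count w (Num.min 1 (w + d1)).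
- exact: ltW.
- by rewrite lt_min w1 ltrDl.
- by rewrite ge_min lexx.
move: y2; rewrite lt_min -ltrBlDl => /andP[_ y2].
exists (r 0%N y); apply/nbhs_ballP; exists d1 => // z; rewrite /ball/= => zw Gz.
rewrite distrC; apply: hd1 => //; last by rewrite distrC.
by rewrite gtr0_norm// subr_gt0.
Qed.

(** The primitive measures intervals and so is nondecreasing; on [Gam] its derivative is the
    density. *)
Lemma density_ge0 x : Gam x -> 0 <= r 0%N x.
Proof.
move=> Gx; have [/andP[x0 x1] _ _ _ _] := regular_itv Gx.
rewrite leNgt; apply/negP => neg; have e0 : 0 < - r 0%N x / 2 by lra.
have [d d0 hd] := (is_derive_epsP _ _ _).1 (primitive_deriv (leq0n k) Gx) _ e0.
pose t := Num.min (d / 2) (1 - x).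
have t0 : 0 < t by rewrite lt_min divr_gt0// subr_gt0.
have /andP[td tx] : (t <= d / 2) && (t <= 1 - x) by rewrite /t !ge_min !lexx orbT.
have := hd (x + t); rewrite addrAC subrr add0r (gtr0_norm t0) => /(_ ltac:(lra)).
have xt : x + t <= 1 by lra.
have := primitive_le mu_r (r_bv (leq0n k)) (ltW x0) (ltW (_ : x < x + t)) xt.
rewrite ltrDl => /(_ t0); rewrite -![\int[lebesgue_measure]_(_ in _) _]/(primitive 0 _) => h1.
rewrite ler_norml => /andP[_ h2].
have : 0 < - r 0%N x / 2 * t by exact: mulr_gt0.
by lra.
Qed.

(** A density vanishing on [Gam] would make the primitive constant inside, whereas its total
    increment is 1. Two-sided continuity of the primitive is available in the open interval, hence
    the margins of length [t], whose increments are at most 1/4 each by the Lipschitz bound. *)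
Lemma density_neq0 : exists2 x, Gam x & r 0%N x != 0.
Proof.
have [mu01 _ _] := mu_f; have tot := density_total mu_r (r_bv (leq0n k)) mu01.
have [M M0 hM] := primitive_lipschitz (leq0n k).
apply: contrapT => H.
have r0 x : Gam x -> r 0%N x = 0.
  by move=> Gx; apply/eqP; apply: contrapT => /negP rx; apply: H; exists x.
pose t := Num.min 4^-1 (4 * M)^-1.
have M4 : 0 < 4 * M by rewrite mulr_gt0.
have t0 : 0 < t by rewrite lt_min !invr_gt0 M4 ltr0n.
have /andP[t4 tM] : (t <= 4^-1) && (t <= (4 * M)^-1) by rewrite /t !ge_min !lexx orbT.
have Mt : M * t <= 4^-1.
  apply: (le_trans (ler_wpM2l (ltW M0) tM)).
  by rewrite invfM mulrCA divff ?mulr1// gt_eqF.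
have tt : t <= 1 - t by lra.
have P0 : `|primitive 0 (1 - t) - primitive 0 t| <= 0 * (1 - t - t).
  apply: (mean_value_countable_norm tt regular_count).
    by move=> x /andP[u v]; apply: primitive_cont => //; apply/andP; split; lra.
  move=> x /andP[u v] nx; have Gx : Gam x.
    by apply: contrapT => nG; apply: nx; split => //=; apply/andP; split; lra.
  by exists (r 0%N x); [exact: primitive_deriv|rewrite r0// normr0].
have i0 : 0 <= (0 : R) <= 1 by rewrite lexx ler01.
have i1 : 0 <= (1 : R) <= 1 by rewrite lexx ler01.
have it : 0 <= t <= 1 by apply/andP; split; lra.
have it1 : 0 <= 1 - t <= 1 by apply/andP; split; lra.
have := hM _ _ i0 it; have := hM _ _ it1 i1; move: P0 tot.
rewrite -!/(primitive 0 _) mul0r subr0 (gtr0_norm t0) (_ : 1 - (1 - t) = t) ?(gtr0_norm t0); last ring.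
move: (primitive 0 (1 - t)) (primitive 0 t) (primitive 0 1) (primitive 0 0) => p1 p2 p3 p4.
by clear mu01; rewrite !ler_norml => /andP[? ?] ? /andP[? ?] /andP[? ?]; lra.
Qed.

Lemma density_discontinuities_dense : (0 < k)%N ->
  `[0, 1]%classic `<=` closure (critical_orbit f c) ->
  forall a b : R, 0 <= a -> a < b -> b <= 1 -> exists2 p, a < p < b & ~ {for p, continuous (r 0%N)}.
Proof.
move=> k0 od; pose g y := `|df y|^-1.
have [[/andP[c0 c1] _ lam1 _ _] _] := (Hf, tt).
have l0 : 0 < lam by exact: lt_trans lam1.
have lL : lam <= L.
  have Uc : U (c / 2) by left; apply/andP; split; lra.
  by have /andP[h1 h2] := expanding_derivative_bounds Uc; exact: le_trans h2.
have L0 : 0 < L by exact: lt_le_trans lL.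
have gb y : U y -> 0 < g y /\ 1 <= L * g y.
  move=> /expanding_derivative_bounds/andP[h1 h2].
  have a0 : 0 < `|df y| by exact: lt_le_trans h1.
  by split; [rewrite invr_gt0|rewrite ler_pdivlMr// mul1r].
have [_ gc] := smooth_on_bounded_continuous absf.
have ccE : coef_comb f r 0 = (fun y => g y * r 0%N y).
  by apply/funext => y; rewrite /coef_comb big_ord_recl big_ord0 addr0.
have req x : Gam x -> r 0%N x = pushed 0 c f s0 (fun y => g y * r 0%N y) x +
    pushed c 1 f s1 (fun y => g y * r 0%N y) x.
  by move=> Gx; rewrite (density_invariance (leq0n k) Gx) ccE.
exact: (dense_orbit_discontinuities Hf regular_itv regular_preim regular_image regular_count
  (fun x => @regular_cont 0%N x (leq0n k)) L0 gb gc density_ge0 density_neq0 req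
  (fun w => @density_cvg_off_orbit w k0) od).
Qed.

End densities.

Lemma continuous_taylor (R : realType) (a : nat -> R) (x y : R) n :
  {for y, continuous (fun z : R => \sum_(m < n) a m * (z - x) ^+ m)}.
Proof.
apply: (@continuous_sum _ n (fun m z => a m * (z - x) ^+ m)) => m _.
apply: (@continuousM _ _ (cst (a m)) (fun z : R => (z - x) ^+ m)); first exact: cvg_cst.
apply: (@continuous_comp R R R (fun z : R => z - x) (fun w : R => w ^+ m)); last exact: exprn_continuous.
by apply: (@continuousB _ _ _ id (cst x)); [exact: cvg_id|exact: cvg_cst].
Qed.

Lemma continuous_norm_power (R : realType) (e x y : R) n :
  {for y, continuous (fun z : R => e * `|z - x| ^+ n)}.
Proof.
apply: (@continuousM _ _ (cst e) (fun z : R => `|z - x| ^+ n)); first exact: cvg_cst.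
apply: (@continuous_comp R R R (fun z : R => `|z - x|) (fun w : R => w ^+ n)); last exact: exprn_continuous.
apply: (@continuous_comp R R R (fun z : R => z - x) (fun w : R => `|w|)); last exact: norm_continuous.
by apply: (@continuousB _ _ _ id (cst x)); [exact: cvg_id|exact: cvg_cst].
Qed.

Lemma eq_continuous_interior (R : realType) (u v : R -> R) (p : R) :
  (forall x, 0 <= x <= 1 -> u x = v x) -> 0 < p < 1 ->
  {for p, continuous u} -> {for p, continuous v}.
Proof.
move=> uv /andP[p0 p1] /continuous_epsP H; apply/continuous_epsP => e e0.
have [d d0 hd] := H e e0; exists (Num.min d (Num.min p (1 - p))).
  by rewrite !lt_min d0 p0 subr_gt0.
move=> y; rewrite !lt_min => /and3P[yd yp yp1]; rewrite -!uv ?hd//.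
  by rewrite !ltW.
by move: yp yp1; rewrite !ltr_norml => /andP[? ?] /andP[? ?]; apply/andP; split; clra.
Qed.

Theorem theorem1p2 (R : realType) (k : nat) (f : R -> R) (c eps lam : R)
    (f1 f2 : R -> R) (mu : probability (measurableTypeR R) R)
    (rho : R -> R) (rhos : nat -> R -> R) :
  (1 <= k)%N ->
  peum f c eps lam f1 f2 ->
  class_C k.+1 `[0, c + eps] f1 ->
  class_C k.+1 `[c - eps, 1] f2 ->
  acip f mu ->
  mixing f mu ->
  density mu rho ->
  averaged_at_discontinuities rho ->
  (forall j, (j <= k)%N -> bounded_variation 0 1 (rhos j)) ->
  (forall x, x \in `[0, 1] -> rhos 0%N x = rho x) ->
  (forall j, (j < k)%N ->
     {ae lebesgue_measure, forall x : R, x \in `[0, 1] ->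
        has_deriv_within `[0, 1] (rhos j) x (rhos j.+1 x)}) ->
  [/\ hausdorff_dim (nondiff_set rho) = 0%E,
      (`[0, 1] `<=` closure (critical_orbit f c) ->
         ~ countable (nondiff_set rho)) &
      exists N : set R,
        [/\ N `<=` `[0, 1], hausdorff_dim N = 0%E &
          forall xbar : R, xbar \in `[0, 1] -> ~ N xbar ->
            (fun x => rho x - rho xbar
                      - \sum_(1 <= m < k.+1)
                          rhos m xbar / (m`!)%:R * (x - xbar) ^+ m)
            =o_ (within `[0, 1] (nbhs xbar)) (fun x => (x - xbar) ^+ k)]].
Proof.
move=> k1 peumf K1 K2 mu_f _ mu_rho rho_avg r_bv r_rho r_ae.
have [s0 [s1 [L [Hf fU absf df0 df1]]]] := peum_expanding peumf K1 K2.
have r0 x : 0 <= x <= 1 -> rhos 0%N x = rho x by move=> xi; apply: r_rho; rewrite in_itv.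
have mu_r : density mu (rhos 0%N).
  move=> A mA; rewrite mu_rho//; apply: eq_integral => x; rewrite inE => -[_ /=].
  by rewrite in_itv/= => xi; rewrite r0.
have r_nae j : (j < k)%N -> (@lebesgue_measure R).-negligible
    [set x : R | 0 < x < 1 /\ ~ is_derive x 1 (rhos j) (rhos j.+1 x)].
  move=> jk; apply: (@negligibleS _ _ _ (@lebesgue_measure R) _ _ _ (r_ae j jk)).
  move=> x [xi nd] /= H; apply: nd; apply: (has_deriv_within_interior xi); apply: H.
  by rewrite in_itv/=; case/andP: xi => /ltW -> /ltW ->.
have [z [q [q01 hz]]] :=
  expansion_at_typical_points Hf fU absf df0 df1 mu_f mu_r r_bv r_nae k1.
(* The points 0 and 1 are covered infinitely often as well, so outside [N] a point is interior and
   derivatives relative to [[0, 1]] are the ordinary ones. *)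
pose N := `[0, 1]%classic `&` limsup_balls z q.
have taylor x i e : 0 <= x <= 1 -> ~ N x -> (0 < i <= k)%N -> 0 < e ->
    exists2 d : R, 0 < d & forall y, `|y - x| < d ->
      `|rho y - rho x - \sum_(1 <= m < i.+1) rhos m x / (m`!)%:R * (y - x) ^+ m|
        <= e * `|y - x| ^+ i.
  move=> xi nN ik e0.
  have nB : ~ limsup_balls z q x by move=> B; apply: nN; split => //; rewrite /= in_itv.
  have [Gx /(_ i ik e e0)[d d0 hd]] := hz x xi nB.
  have [/andP[x0 x1] _ _ _ _] := regular_itv Gx.
  exists (Num.min d (Num.min x (1 - x))); first by rewrite !lt_min d0 x0 subr_gt0.
  move=> y; rewrite !lt_min => /and3P[yd yx yx1].
  have yi : 0 < y < 1.
    by move: yx yx1; rewrite !ltr_norml => /andP[? ?] /andP[? ?]; apply/andP; split; clra.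
  (* The expansion of [rhos 0] on [Gam] reaches [rho] at every nearby [y] through the averaging; the
     term [m = 0] of the sum is [rho x]. *)
  have := @averaged_bound R rho (fun y => \sum_(m < i.+1) rhos m x / (m`!)%:R * (y - x) ^+ m)
    (fun y => e * `|y - x| ^+ i) _ x d y _ (@continuous_taylor _ (fun m => rhos m x / (m`!)%:R) _ _ _)
    (@continuous_norm_power _ _ _ _ _) yd (regular_count Hf r_bv) yi rho_avg.
  rewrite -(big_mkord xpredT (fun m => rhos m x / (m`!)%:R * (y - x) ^+ m)) big_ltn//.
  rewrite fact0 divr1 expr0 mulr1 r0// opprD addrA; apply.
  move=> w Gw wx; have [/andP[w0 w1] _ _ _ _] := regular_itv Gw.
  by rewrite -r0 ?hd// !ltW.
have NB : N `<=` limsup_balls z q by move=> x [].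
(* The expansion of order 1 is differentiability, with derivative [rhos 1]. *)
have nondiffN : nondiff_set rho `<=` N.
  move=> x [x01 nd]; apply: contrapT => nN; apply: nd; apply/cvg_ex; exists (rhos 1%N x).
  rewrite in_itv/= in x01; apply/cvgrPdist_le => e e0.
  have [d d0 hd] := taylor x 1%N e x01 nN k1 e0.
  rewrite !near_withinE; apply/nbhs_ballP; exists d => // y; rewrite /ball/= distrC => yx ynx _.
  have yx0 : y - x != 0 by rewrite subr_eq0.
  have := hd y yx; rewrite big_nat1 (_ : 1`! = 1%N)// divr1 !expr1 => h.
  rewrite /diff_quotient distrC.
  rewrite (_ : _ - _ = (rho y - rho x - rhos 1%N x * (y - x)) / (y - x)); last by field.
  by rewrite normrM normfV ler_pdivrMr// normr_gt0.
split.
- exact: limsup_balls_dim0 q01 (subset_trans nondiffN NB).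
- move=> od; apply: dense_discontinuities_nondiff_uncountable => a b a0 ab b1.
  have [p /andP[pa pb] np] := density_discontinuities_dense Hf fU absf df0 df1 mu_f mu_r r_bv r_nae
    k1 od a0 ab b1.
  have p01 : 0 < p < 1 by rewrite (le_lt_trans a0 pa) (lt_le_trans pb b1).
  exists p; first by rewrite pa.
  by move=> /(eq_continuous_interior (fun x xi => esym (r0 x xi)) p01).
- exists N; split; [by move=> x []|exact: limsup_balls_dim0 q01 NB|].
  move=> x; rewrite in_itv/= => x01 nN; apply/eqoP => e e0.
  have ik : (0 < k <= k)%N by rewrite k1 leqnn.
  have [d d0 hd] := taylor x k e x01 nN ik e0.
  rewrite near_withinE; apply/nbhs_ballP; exists d => // y; rewrite /ball/= distrC => yx _.
  by rewrite normrX; exact: hd.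
Qed.
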